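(* Let $n,m,r\ge 1$ be integers, and regard each family of probability distributions below as the dually flat manifold given by its Fisher metric and its exponential connection. (1) $\mathbb{T}^1\times\mathbb{C}\to\mathbb{C}$, $([t],z)\mapsto e^{2i\pi t}z$, is a torification of the family $\mathscr{P}$ of Poisson distributions. (2) $\Phi_n:\mathbb{T}^n\times\mathbb{P}_n(1)\to\mathbb{P}_n(1)$ is a torification of $\mathcal{P}_{n+1}^{\times}$ (categorical distributions). (3) $\Phi_1:\mathbb{T}^1\times\mathbb{P}_1(\tfrac1n)\to\mathbb{P}_1(\tfrac1n)$ is a torification of $\mathcal{B}(n)$ (binomial distributions). (4) $\Phi_m:\mathbb{T}^m\times\mathbb{P}_m(\tfrac1n)\to\mathbb{P}_m(\tfrac1n)$ is a torification of $\mathcal{M}(m+1,n)$ (multinomial distributions). (5) $\mathbb{T}^1\times\mathbb{D}(-\tfrac1r)\to\mathbb{D}(-\tfrac1r)$, $([t],z)\mapsto e^{2i\pi t}z$, is a torification of $\mathcal{NB}(r)$ (negative binomial distributions).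
   Context: Dually flat spaces. A linear connection is flat if its torsion and curvature both vanish. If $(M,h)$ is a Riemannian manifold with a linear connection $\nabla$, the dual connection $\nabla^*$ is the unique linear connection with $Xh(Y,Z)=h(\nabla_XY,Z)+h(Y,\nabla^*_XZ)$ for all vector fields $X,Y,Z$. The triple $(M,h,\nabla)$ is a dually flat space if $\nabla$ and $\nabla^*$ are both flat. Kähler structure on $TM$ (Dombrowski). Let $(M,h,\nabla)$ be dually flat, $\pi:TM\to M$ the projection, and $K:TTM\to TM$ the connector of $\nabla$ (the map, linear on each $T_u(TM)$, with $K(Y_*X)=\nabla_XY$ for all vector fields). For $u\in T_pM$ the map $A\mapsto(\pi_*A,KA)$ identifies $T_u(TM)$ with $T_pM\oplus T_pM$; under it set $g_u((v,w),(v',w'))=h_p(v,v')+h_p(w,w')$, $J_u(v,w)=(-w,v)$, $\omega_u((v,w),(v',w'))=h_p(v,w')-h_p(w,v')$. This makes $TM$ a Kähler manifold, and $TM$ always carries this structure. Parallel lattices. Let $(M,h,\nabla)$ be connected, $\dim M=n$. A parallel lattice is a subset $L\subset TM$ of the form $L=\{\sum_i k_iX_i(p)\mid p\in M,\ k_i\in\mathbb{Z}\}$ where $X=(X_1,\dots,X_n)$ are $\nabla$-parallel vector fields forming a basis of $T_pM$ at every $p$; $X$ is called a generator of $L$. $\Gamma(L)$ is the group of maps $TM\to TM$, $u\mapsto u+\sum_ik_iX_i$ ($k\in\mathbb{Z}^n$); it does not depend on the generator, acts freely and properly by holomorphic isometries, and $M_L=TM/\Gamma(L)$ carries the quotient Kähler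 structure, with quotient map $q_L:TM\to M_L$. Put $\mathbb{T}^n=\mathbb{R}^n/\mathbb{Z}^n$; for a generator $X$ let $\Phi_X([t],q_L(u))=q_L(u+\sum_it_iX_i)$, an action of $\mathbb{T}^n$ on $M_L$. Torifications. Let $N$ be a connected Kähler manifold of real dimension $2n$ with an effective holomorphic isometric action $\Phi:\mathbb{T}^n\times N\to N$; write $\Phi_a=\Phi(a,\cdot)$ and let $N^\circ$ be the set of points where $\Phi$ is free. $N$ (or $\Phi$) is a torification of the connected $n$-dimensional dually flat space $(M,h,\nabla)$ if there are a parallel lattice $L$, a generator $X$ of $L$ and a holomorphic isometric diffeomorphism $F:M_L\to N^\circ$ with $F\circ(\Phi_X)_a=\Phi_a\circ F$ for all $a\in\mathbb{T}^n$. Exponential families. An exponential family on a measure space $(\Omega,dx)$ is a set of probability densities $p(x;\theta)=\exp\{C(x)+\sum_{i=1}^n\theta_iF_i(x)-\psi(\theta)\}$, $\theta\in\Theta\subseteq\mathbb{R}^n$ open, with $1,F_1,\dots,F_n$ linearly independent; the natural parameters $\theta_i$ are global coordinates and $\psi$ is the cumulant generating function. The Fisher metric $h_F$ has components $\mathbb{E}_{p_\theta}(\partial_i\ln p_\theta\cdot\partial_j\ln p_\theta)$, which equal $\partial^2\psi/\partial\theta_i\partial\theta_j$ in the natural parameters, and the exponential connection $\nabla^{(e)}$, with Christoffel symbols $\Gamma_{ij,k}=\mathbb{E}_{p_\theta}(\partial_i\partial_j\ln p_\theta\cdot\partial_k\ln p_\theta)$, is the flat connection for which the natural parameters are affine coordinates.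 The families here (discrete, with counting measure) are: - $\mathscr{P}$: $p(k)=e^{-\lambda}\lambda^k/k!$ on $\mathbb{N}=\{0,1,\dots\}$, $\lambda>0$; $\theta=\ln\lambda$, $\psi=e^\theta$. - $\mathcal{P}_n^\times$: all $p:\Omega\to\mathbb{R}$ with $p>0$, $\sum p=1$, on $\Omega=\{x_1,\dots,x_n\}$; $p(x;\theta)=\exp\{\sum_{i=1}^{n-1}\theta_iF_i(x)-\psi(\theta)\}$, $F_i(x_j)=\delta_{ij}$, $\psi=\ln(1+\sum_{i=1}^{n-1}e^{\theta_i})$. - $\mathcal{B}(n)$: $p(k)=\binom nk q^k(1-q)^{n-k}$ on $\{0,\dots,n\}$, $q\in(0,1)$; $\theta=\ln\frac{q}{1-q}$, $\psi=n\ln(1+e^\theta)$. - $\mathcal{M}(m,n)$: $p(k)=\frac{n!}{k_1!\cdots k_m!}\pi_1^{k_1}\cdots\pi_m^{k_m}$ on $\{k\in\mathbb{N}^m:\sum k_i=n\}$, where $\pi_i>0$, $\sum_i\pi_i=1$; $\theta_i=\ln(\pi_i/(1-\sum_{j<m}\pi_j))$, $i=1,\dots,m-1$, $\psi=n\ln(1+\sum_{i=1}^{m-1}e^{\theta_i})$. - $\mathcal{NB}(r)$: $p(k)=\binom{k+r-1}{r-1}(1-q)^kq^r$ on $\mathbb{N}$, $q\in(0,1)$; $\theta=\ln(1-q)\in(-\infty,0)$, $\psi=-r\ln(1-e^\theta)$. Kähler manifolds. $\mathbb{C}$ has its standard flat Kähler structure. $\mathbb{P}_n(c)$ is complex projective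 space of complex dimension $n$ with the Fubini–Study metric normalized to have holomorphic sectional curvature $c>0$. $\mathbb{D}(c)$ is the open unit disk in $\mathbb{C}$ with metric $ds^2=-\frac4c\frac{dx^2+dy^2}{(1-x^2-y^2)^2}$, of holomorphic sectional curvature $c<0$. $\Phi_n([t],[z])=[e^{2i\pi t_1}z_1,\dots,e^{2i\pi t_n}z_n,z_{n+1}]$ in homogeneous coordinates on $\mathbb{P}_n$. *)

(* Defs.v *)
From HB Require Import structures.
From mathcomp Require Import all_boot all_order all_algebra ring_quotient.
From mathcomp Require Import complex.
From mathcomp Require Import all_classical all_reals all_analysis.

Set Implicit Arguments.
Unset Strict Implicit.
Unset Printing Implicit Defensive.

Import Order.TTheory GRing.Theory Num.Theory.
Import numFieldNormedType.Exports.

Local Open Scope classical_set_scope.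
Local Open Scope ring_scope.

Section Calculus.
Variable R : realType.

Definition partial d (a : 'I_d) (f : 'rV[R]_d -> R) : 'rV[R]_d -> R :=
  'D_(delta_mx 0 a) f.

(* C^infinity on an open set: all iterated partial derivatives exist and are
   continuous there. *)
Definition smooth_on d (U : set 'rV[R]_d) (f : 'rV[R]_d -> R) : Prop :=
  forall (s : seq 'I_d) x, U x ->
    let g := foldr (@partial d) f s in
    {for x, continuous g} /\ forall a, derivable g x (delta_mx 0 a).

Definition smooth_vec d e (U : set 'rV[R]_d) (f : 'rV[R]_d -> 'rV[R]_e) : Prop :=
  forall b, smooth_on U (fun x => f x 0 b).

Definition smooth_mx d m n (U : set 'rV[R]_d) (f : 'rV[R]_d -> 'M[R]_(m, n)) :
  Prop := forall a b, smooth_on U (fun x => f x a b).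

(* The differential acts on row vectors from the right: v |-> v *m jac f x. *)
Definition jac d e (f : 'rV[R]_d -> 'rV[R]_e) (x : 'rV[R]_d) : 'M[R]_(d, e) :=
  \matrix_(a, b) partial a (fun y => f y 0 b) x.

End Calculus.

Section Manifolds.
Variable R : realType.

(* A chart i is the map chart_map i restricted to the set chart_dom i; the values of
   chart_map i outside chart_dom i carry no information. *)
Record premanifold (d : nat) := Premanifold {
  pt :> Type;
  chart : Type;
  chart_dom : chart -> set pt;
  chart_map : chart -> pt -> 'rV[R]_d }.

Definition chart_cod d (M : premanifold d) (i : chart M) : set 'rV[R]_d :=
  chart_map i @` chart_dom i.

(* f o (chart_map i)^-1 on chart_cod i, and 0 elsewhere. *)
Definition in_chart d (M : premanifold d) (V : zmodType) (i : chart M)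
    (f : M -> V) (x : 'rV[R]_d) : V :=
  xget 0 [set f p | p in chart_dom i `&` [set p | chart_map i p = x]].

Definition mopen d (M : premanifold d) (U : set M) : Prop :=
  forall i : chart M, open (chart_map i @` (chart_dom i `&` U)).

Definition smooth_map d e (M : premanifold d) (N : premanifold e) (f : M -> N) :
  Prop :=
  forall (i : chart M) (j : chart N),
    let U := chart_map i @` (chart_dom i `&` f @^-1` chart_dom j) in
    open U /\ smooth_vec U (in_chart i (fun p => chart_map j (f p))).

(* Smoothness of the identity says that the charts have open images and smooth
   transition maps defined on open sets. *)
Definition is_manifold d (M : premanifold d) : Prop :=
  [/\ forall p : M, exists i, chart_dom i p,
      forall i : chart M, set_inj (chart_dom i) (chart_map i),
      smooth_map (fun p : M => p),
      forall p q : M, p <> q -> exists U V : set M,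
        [/\ mopen U, mopen V, U p, V q & U `&` V = set0]
    & exists B : nat -> set M, (forall k, mopen (B k)) /\
        forall (U : set M) p, mopen U -> U p -> exists k, B k p /\ B k `<=` U].

Definition mconnected d (M : premanifold d) : Prop :=
  forall U : set M, mopen U -> mopen (~` U) -> U = set0 \/ U = setT.

(* The matrix of df in the charts i and j, at the point with i-coordinates x. *)
Definition dmap d e (M : premanifold d) (N : premanifold e) (f : M -> N)
    (i : chart M) (j : chart N) : 'rV[R]_d -> 'M[R]_(d, e) :=
  jac (in_chart i (fun p => chart_map j (f p))).

Definition transition d (M : premanifold d) (i j : chart M) :
  'rV[R]_d -> 'rV[R]_d := in_chart i (chart_map j).

Definition euclid (d : nat) : premanifold d :=
  @Premanifold d 'rV[R]_d unit (fun _ => setT) (fun _ x => x).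

Definition prod_mfd d e (M : premanifold d) (N : premanifold e) :
  premanifold (d + e) :=
  @Premanifold (d + e) (M * N)%type (chart M * chart N)%type
    (fun c => [set p | chart_dom c.1 p.1 /\ chart_dom c.2 p.2])
    (fun c p => row_mx (chart_map c.1 p.1) (chart_map c.2 p.2)).

(* A field of endomorphisms, or of bilinear forms, is given by its matrix in
   every chart, as a function of the coordinates of that chart. *)
Definition mxfield d (M : premanifold d) := chart M -> 'rV[R]_d -> 'M[R]_d.

Definition preserves_form d e (M : premanifold d) (N : premanifold e)
    (g : mxfield M) (h : mxfield N) (f : M -> N) : Prop :=
  forall (i : chart M) (j : chart N) p, chart_dom i p -> chart_dom j (f p) ->
    let T := dmap f i j (chart_map i p) in
    g i (chart_map i p) = T *m h j (chart_map j (f p)) *m T^T.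

Definition preserves_endo d e (M : premanifold d) (N : premanifold e)
    (g : mxfield M) (h : mxfield N) (f : M -> N) : Prop :=
  forall (i : chart M) (j : chart N) p, chart_dom i p -> chart_dom j (f p) ->
    let T := dmap f i j (chart_map i p) in
    g i (chart_map i p) *m T = T *m h j (chart_map j (f p)).

Definition is_metric d (M : premanifold d) (g : mxfield M) : Prop :=
  [/\ forall i, smooth_mx (chart_cod i) (g i),
      preserves_form g g (fun p : M => p)
    & forall (i : chart M) x, chart_cod i x ->
        (g i x)^T = g i x /\
        forall v : 'rV[R]_d, v != 0 -> 0 < (v *m g i x *m v^T) 0 0].

End Manifolds.

Arguments euclid : clear implicits.

Section Kaehler.
Variable R : realType.

Record kmfd (d : nat) := Kmfd {
  kbase :> premanifold R d;
  kmetric : mxfield kbase;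
  kcplx : mxfield kbase }.

Definition kform d (N : kmfd d) : mxfield N :=
  fun i x => kcplx i x *m kmetric i x.

(* The components of [J d_a, J d_b] - J [J d_a, d_b] - J [d_a, J d_b] - [d_a, d_b],
   where J d_a = sum_c (J a c) d_c. *)
Definition nijenhuis d (J : 'rV[R]_d -> 'M[R]_d) (x : 'rV[R]_d)
    (a b k : 'I_d) : R :=
  let D c e f := partial c (fun y => J y e f) x in
  \sum_c (J x a c * D c b k - J x b c * D c a k
          + D b a c * J x c k - D a b c * J x c k).

Definition is_kaehler d (N : kmfd d) : Prop :=
  [/\ is_manifold N, is_metric (@kmetric _ N),
      [/\ forall i : chart N, smooth_mx (chart_cod i) (kcplx i),
          preserves_endo (@kcplx _ N) (@kcplx _ N) (fun p : N => p)
        & forall (i : chart N) x, chart_cod i x -> kcplx i x *m kcplx i x = - 1%:M],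
      forall (i : chart N) x, chart_cod i x ->
        kcplx i x *m kmetric i x *m (kcplx i x)^T = kmetric i x
    & forall (i : chart N) x, chart_cod i x -> forall a b k,
        nijenhuis (kcplx i) x a b k = 0 /\
        partial a (fun y => kform i y b k) x
        + partial b (fun y => kform i y k a) x
        + partial k (fun y => kform i y a b) x = 0].

Definition holo_isometric d e (M : kmfd d) (N : kmfd e) (f : M -> N) : Prop :=
  [/\ smooth_map f, preserves_form (@kmetric _ M) (@kmetric _ N) f
    & preserves_endo (@kcplx _ M) (@kcplx _ N) f].

Definition holo_isometric_diffeo d e (M : kmfd d) (N : kmfd e) (f : M -> N) :
  Prop :=
  holo_isometric f /\
  exists f' : N -> M, [/\ cancel f f', cancel f' f & smooth_map f'].

(* The structure induced on a subset, meant for open ones. *)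
Definition restrict d (N : kmfd d) (A : set N) : kmfd d :=
  @Kmfd d
    (@Premanifold R d {p : N | A p} (chart N)
       (fun i p => chart_dom i (sval p)) (fun i p => chart_map i (sval p)))
    (@kmetric _ N) (@kcplx _ N).

(* Coordinates z_k = x_k + i y_k are stored as the row (x, y); on R^n + R^n,
   std_cplx n is (v, w) |-> (-w, v). *)
Definition std_cplx n : 'M[R]_(n + n) := block_mx 0 1%:M (- 1%:M) 0.

End Kaehler.

Section DuallyFlat.
Variable R : realType.

(* G i x a b k is the Christoffel symbol defined by
   nabla_(d_a) d_b = sum_k (G i x a b k) d_k in the chart i. *)
Definition christoffel d (M : premanifold R d) :=
  chart M -> 'rV[R]_d -> 'I_d -> 'I_d -> 'I_d -> R.

Definition is_connection d (M : premanifold R d) (G : christoffel M) : Prop :=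
  (forall (i : chart M) a b k, smooth_on (chart_cod i) (fun x => G i x a b k)) /\
  forall (i j : chart M) p, chart_dom i p -> chart_dom j p -> forall a b k,
    let x := chart_map i p in
    let T := transition i j in
    \sum_c G i x a b c * jac T x c k =
    partial a (partial b (fun y => T y 0 k)) x
    + \sum_c \sum_e G j (chart_map j p) c e k * jac T x a c * jac T x b e.

Definition torsion d (G : 'rV[R]_d -> 'I_d -> 'I_d -> 'I_d -> R)
    (x : 'rV[R]_d) (a b k : 'I_d) : R := G x a b k - G x b a k.

(* The d_k-component of R(d_a, d_b) d_c. *)
Definition curvature d (G : 'rV[R]_d -> 'I_d -> 'I_d -> 'I_d -> R)
    (x : 'rV[R]_d) (a b c k : 'I_d) : R :=
  partial a (fun y => G y b c k) x - partial b (fun y => G y a c k) x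
  + \sum_e (G x a e k * G x b c e - G x b e k * G x a c e).

Definition is_flat d (M : premanifold R d) (G : christoffel M) : Prop :=
  forall (i : chart M) x, chart_cod i x ->
    (forall a b k, torsion (G i) x a b k = 0) /\
    (forall a b c k, curvature (G i) x a b c k = 0).

Definition dual_connections d (M : premanifold R d) (h : mxfield M)
    (G G' : christoffel M) : Prop :=
  forall (i : chart M) x, chart_cod i x -> forall a b c,
    partial a (fun y => h i y b c) x =
    \sum_e G i x a b e * h i x e c + \sum_e h i x b e * G' i x a c e.

Record dmfd (n : nat) := Dmfd {
  dbase :> premanifold R n;
  dmetric : mxfield dbase;
  dconn : christoffel dbase }.

Definition is_dually_flat n (M : dmfd n) : Prop :=
  [/\ is_manifold M, is_metric (@dmetric _ M), is_connection (@dconn _ M),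
      is_flat (@dconn _ M)
    & exists G' : christoffel M,
      [/\ is_connection G', dual_connections (@dmetric _ M) (@dconn _ M) G'
        & is_flat G']].

End DuallyFlat.

Section TangentBundle.
Variables (R : realType) (n : nat) (M : premanifold R n).

(* A tangent vector at p is the family of its components in the charts around p,
   related by the Jacobians of the transition maps; the entries of the charts
   which do not contain p are set to 0. *)
Definition tcompat (p : M) : {pred (chart M -> 'rV[R]_n)} :=
  fun v => `[< (forall i j, chart_dom i p -> chart_dom j p ->
                  v j = v i *m jac (transition i j) (chart_map i p)) /\
               (forall i, ~ chart_dom i p -> v i = 0) >].

Lemma tcompat_submod p : submod_closed (tcompat p).
Proof.
split; first by apply/asboolP; split=> [i j _ _|//]; rewrite mul0mx.
move=> a u v /asboolP[u1 u2] /asboolP[v1 v2]; apply/asboolP; split=> [i j pi pj|i pi].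
  have -> : (a *: u + v) j = a *: u j + v j by [].
  have -> : (a *: u + v) i = a *: u i + v i by [].
  by rewrite (u1 _ _ pi pj) (v1 _ _ pi pj) mulmxDl scalemxAl.
have -> : (a *: u + v) i = a *: u i + v i by [].
by rewrite u2 // v2 // scaler0 addr0.
Qed.

HB.instance Definition _ p :=
  GRing.isSubmodClosed.Build R (chart M -> 'rV[R]_n) (tcompat p)
    (tcompat_submod p).

Record tspace (p : M) := TVec {
  tcomp :> chart M -> 'rV[R]_n;
  _ : tcomp \in tcompat p }.

HB.instance Definition _ p := [isSub for @tcomp p].
HB.instance Definition _ p := [Choice of tspace p by <:].
HB.instance Definition _ p := [SubChoice_isSubLmodule of tspace p by <:].

Definition tangent := {p : M & tspace p}.

Definition tangent_mfd : premanifold R (n + n) :=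
  @Premanifold R (n + n) tangent (chart M)
    (fun i u => chart_dom i (projT1 u))
    (fun i u => row_mx (chart_map i (projT1 u)) (tcomp (projT2 u) i)).

Definition vfield := forall p : M, tspace p.

Definition smooth_vfield (X : vfield) : Prop :=
  forall i, smooth_vec (chart_cod i) (in_chart i (fun p => tcomp (X p) i)).

End TangentBundle.

Section Dombrowski.
Variables (R : realType) (n : nat) (M : dmfd R n).

(* The matrix of A |-> (pi_* A, K A) at the point of TM with coordinates z = (x, y):
   a vector with components (a, b) has pi_*-part a and K-part b + G_x(a, y),
   because nabla_X Y = dY(X) + G(X, Y). *)
Definition splitting (i : chart M) (z : 'rV[R]_(n + n)) : 'M[R]_(n + n) :=
  block_mx 1%:M
    (\matrix_(a, k) \sum_b dconn i (lsubmx z) a b k * rsubmx z 0 b) 0 1%:M.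

Definition tangent_kmfd : kmfd R (n + n) :=
  @Kmfd R (n + n) (tangent_mfd M)
    (fun (i : chart M) z =>
       let h := dmetric i (lsubmx z) in
       splitting i z *m block_mx h 0 0 h *m (splitting i z)^T)
    (fun (i : chart M) z =>
       splitting i z *m std_cplx R n *m invmx (splitting i z)).

End Dombrowski.

Section Torus.
Variables (R : realType) (n : nat).

Definition int_lattice : {pred 'rV[R]_n} :=
  [pred t : 'rV[R]_n | [forall i, t 0 i \is a Num.int]].

Lemma int_lattice_zmod : zmod_closed int_lattice.
Proof.
split=> [|s t /forallP hs /forallP ht]; apply/forallP => i; rewrite !mxE ?rpred0 //.
exact: rpredB.
Qed.

HB.instance Definition _ :=
  GRing.isZmodClosed.Build 'rV[R]_n int_lattice int_lattice_zmod.

Definition torus := Quotient.quot int_lattice.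
HB.instance Definition _ := GRing.Zmodule.on torus.
HB.instance Definition _ := EqQuotient.on torus.

Definition tclass (t : 'rV[R]_n) : torus := (\pi_(torus) t)%qT.

End Torus.

Section Lattices.
Variables (R : realType) (n : nat) (M : dmfd R n).

Definition parallel (X : vfield M) : Prop :=
  smooth_vfield X /\
  forall i p, chart_dom i p -> forall a k,
    let x := chart_map i p in
    partial a (fun y => in_chart i (fun q => tcomp (X q) i) y 0 k) x
    + \sum_b dconn i x a b k * tcomp (X p) i 0 b = 0.

Definition vframe := 'I_n -> vfield M.

Definition tcomb (X : vframe) (t : 'rV[R]_n) (p : M) : tspace p :=
  \sum_i t 0 i *: X i p.

Definition generator (L : set (tangent M)) (X : vframe) : Prop :=
  [/\ forall i, parallel (X i),
      forall p (v : tspace p), exists! t : 'rV[R]_n, v = tcomb X t p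
    & L = [set u | exists (p : M) (k : 'I_n -> int),
             u = existT _ p (tcomb X (\row_i (k i)%:~R) p)]].

Definition parallel_lattice (L : set (tangent M)) : Prop :=
  exists X, generator L X.

Definition translation (X : vframe) (t : 'rV[R]_n) (u : tangent M) : tangent M :=
  existT _ (projT1 u) (projT2 u + tcomb X t (projT1 u)).

Definition lattice_group (L : set (tangent M)) : set (tangent M -> tangent M) :=
  [set f | exists (X : vframe) (k : 'I_n -> int),
     generator L X /\ f = translation X (\row_i (k i)%:~R)].

Section Quotient.
Variable L : set (tangent M).

Definition lattice_orbit (u : tangent M) : set (tangent M) :=
  [set f u | f in lattice_group L].

Definition lattice_quot := {A : set (tangent M) | exists u, A = lattice_orbit u}.

Definition qmap (u : tangent M) : lattice_quot :=
  exist _ (lattice_orbit u) (ex_intro _ u erefl).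

Definition qrepr (A : lattice_quot) : tangent M := projT1 (cid (svalP A)).

(* The charts of TM / Gamma(L) are the charts of TM on open sets on which the
   quotient map is injective; the tensors have the same components as on TM. *)
Record qchart := QChart {
  qch : chart M;
  sheet : set (tangent M);
  sheet_open : @mopen R _ (tangent_mfd M) sheet;
  sheet_dom : sheet `<=` [set u | chart_dom qch (projT1 u)];
  sheet_inj : set_inj sheet qmap }.

Definition quot_kmfd : kmfd R (n + n) :=
  @Kmfd R (n + n)
    (@Premanifold R (n + n) lattice_quot qchart
       (fun c => qmap @` sheet c)
       (fun c A => xget 0 [set @chart_map _ _ (tangent_mfd M) (qch c) u |
                           u in sheet c `&` [set u | qmap u = A]]))
    (fun c => @kmetric _ _ (tangent_kmfd M) (qch c))
    (fun c => @kcplx _ _ (tangent_kmfd M) (qch c)).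

Definition lattice_action (X : vframe) (a : torus R n) (A : quot_kmfd) :
  quot_kmfd := qmap (translation X (repr a) (qrepr A)).

End Quotient.
End Lattices.

Section Torification.
Variables (R : realType) (n : nat).

Definition is_torus_action (N : premanifold R (n + n))
    (Phi : torus R n -> N -> N) : Prop :=
  [/\ forall x, Phi 0 x = x,
      forall a b x, Phi (a + b) x = Phi a (Phi b x)
    & smooth_map
        (fun tx : prod_mfd (euclid R n) N => Phi (tclass tx.1) tx.2)].

Definition effective (N : Type) (Phi : torus R n -> N -> N) : Prop :=
  forall a, (forall x, Phi a x = x) -> a = 0.

Definition free_set (N : Type) (Phi : torus R n -> N -> N) : set N :=
  [set x | forall a, Phi a x = x -> a = 0].

(* The set of points where the action is free is open for every smooth torus
   action; this is stated so that it carries a manifold structure. *)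
Definition torification (N : kmfd R (n + n)) (Phi : torus R n -> N -> N)
    (M : dmfd R n) : Prop :=
  [/\ is_kaehler N /\ mconnected N,
      [/\ is_torus_action Phi, effective Phi & forall a, holo_isometric (Phi a)],
      is_dually_flat M /\ mconnected M,
      mopen (free_set Phi)
    & exists (L : set (tangent M)) (X : vframe M)
             (F : quot_kmfd L -> restrict (free_set Phi)),
      [/\ parallel_lattice L, generator L X, holo_isometric_diffeo F
        & forall a A, sval (F (lattice_action X a A)) = Phi a (sval (F A))]].

End Torification.

Section Discrete.
Variable T : pointedType.

Definition discrete_space : Type := T.

HB.instance Definition _ := Pointed.on discrete_space.
HB.instance Definition _ :=
  @isMeasurable.Build default_measure_display discrete_space
    discrete_measurable discrete_measurable0
    discrete_measurableC discrete_measurableU.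

End Discrete.

Section StatisticalManifold.
Variables (R : realType) (d : measure_display) (T : measurableType d).
Variable mu : {measure set T -> \bar R}.
Variables (n : nat) (P : Type) (A : set P).
Variables (density : P -> T -> R) (theta : P -> 'rV[R]_n).

(* The set of densities { density a | a in A } with the single chart theta *)
Definition family_mfd : premanifold R n :=
  @Premanifold R n {f : T -> R | (density @` A) f} unit
    (fun _ => setT)
    (fun _ f => xget 0 (theta @` (A `&` [set a | density a = sval f]))).

Definition pdens (t : 'rV[R]_n) (x : T) : R :=
  in_chart (tt : chart family_mfd) (fun f : family_mfd => sval f x) t.

Definition loglik (x : T) (t : 'rV[R]_n) : R := ln (pdens t x).

Definition expectation_at (t : 'rV[R]_n) (f : T -> R) : R :=
  Rintegral mu setT (fun x => pdens t x * f x).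

Definition fisher (t : 'rV[R]_n) : 'M[R]_n :=
  \matrix_(a, b) expectation_at t
    (fun x => partial a (loglik x) t * partial b (loglik x) t).

Definition exp_christoffel1 (t : 'rV[R]_n) (a b c : 'I_n) : R :=
  expectation_at t
    (fun x => partial a (partial b (loglik x)) t * partial c (loglik x) t).

Definition stat_mfd : dmfd R n :=
  @Dmfd R n family_mfd (fun _ => fisher)
    (fun _ t a b k => \sum_c exp_christoffel1 t a b c * invmx (fisher t) c k).

End StatisticalManifold.

Section SampleSpaces.

HB.instance Definition _ n := isPointed.Build 'I_n.+1 ord0.

(* The k in N^(m+1) with sum_i k_i = n; each k_i is at most n. *)
Definition outcomes (m n : nat) :=
  {k : {ffun 'I_m.+1 -> 'I_n.+1} | (\sum_i (k i : nat))%N == n}.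

Lemma outcomes_point m n :
  (\sum_i ([ffun i : 'I_m.+1 => if i == ord0 then @ord_max n else ord0] i : nat))%N
    == n.
Proof.
rewrite (bigD1 ord0) //= big1 ?addn0 ?ffunE // => i /negPf i0.
by rewrite ffunE i0.
Qed.

HB.instance Definition _ m n := Finite.on (outcomes m n).
HB.instance Definition _ m n :=
  isPointed.Build (outcomes m n)
    (exist (fun k : {ffun 'I_m.+1 -> 'I_n.+1} => (\sum_i (k i : nat))%N == n)
       _ (outcomes_point m n)).

End SampleSpaces.

Section Families.
Variable R : realType.

Definition counting_measure d (T : measurableType d) :
  {measure set T -> \bar R} := @counting T R.

Definition poisson_mfd : dmfd R 1 :=
  stat_mfd (counting_measure nat) [set l : R | 0 < l]
    (fun l k => poisson_pmf l k) (fun l => const_mx (ln l)).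

(* The positive probability functions on a set of n + 1 points; theta_i is
   forced by p(x; theta) = exp (sum_i theta_i F_i(x) - psi(theta)). *)
Definition categorical_mfd (n : nat) : dmfd R n :=
  stat_mfd (counting_measure (discrete_space 'I_n.+1))
    [set p : 'I_n.+1 -> R | (forall x, 0 < p x) /\ \sum_x p x = 1]
    (fun p => p)
    (fun p => \row_i ln (p (lift ord_max i) / p ord_max)).

Definition binomial_mfd (n : nat) : dmfd R 1 :=
  stat_mfd (counting_measure (discrete_space 'I_n.+1))
    [set q : R | 0 < q < 1]
    (fun q (k : 'I_n.+1) => binomial_pmf n q k)
    (fun q => const_mx (ln (q / (1 - q)))).

(* The multinomial distributions with n trials and m + 1 outcomes *)
Definition multinomial_mfd (m n : nat) : dmfd R m :=
  stat_mfd (counting_measure (discrete_space (outcomes m n)))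
    [set w : 'I_m.+1 -> R | (forall i, 0 < w i) /\ \sum_i w i = 1]
    (fun w (k : outcomes m n) =>
       n`!%:R / \prod_i (val k i)`!%:R * \prod_i w i ^+ val k i)
    (fun w => \row_i ln (w (lift ord_max i) / (1 - \sum_j w (lift ord_max j)))).

Definition negative_binomial_mfd (r : nat) : dmfd R 1 :=
  stat_mfd (counting_measure nat) [set q : R | 0 < q < 1]
    (fun q k => 'C(k + r - 1, r - 1)%:R * (1 - q) ^+ k * q ^+ r)
    (fun q => const_mx (ln (1 - q))).

End Families.

Section Models.
Variable R : realType.
Local Notation C := (R[i]).

Definition phase (s : R) : C := Complex (cos (2 * pi * s)) (sin (2 * pi * s)).

Lemma norm_phase s : `|phase s| = 1.
Proof. by rewrite normc_def /= cos2Dsin2 sqrtr1. Qed.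

Definition plane : premanifold R (1 + 1) :=
  @Premanifold R (1 + 1) C unit (fun _ => setT)
    (fun _ z => row_mx (const_mx (complex.Re z)) (const_mx (complex.Im z))).

Definition complex_plane : kmfd R (1 + 1) :=
  @Kmfd R (1 + 1) plane (fun _ _ => 1%:M) (fun _ _ => std_cplx R 1).

Definition plane_action (a : torus R 1) (z : complex_plane) : complex_plane :=
  phase (repr a 0 0) * z.

Definition unit_disk : set C := [set z | `|z| < 1].

Definition disk (c : R) : kmfd R (1 + 1) :=
  restrict (N := @Kmfd R (1 + 1) plane
    (fun _ x => (- (4 / c) / (1 - \sum_k x 0 k ^+ 2) ^+ 2)%:M)
    (fun _ _ => std_cplx R 1)) unit_disk.

Lemma disk_action_subproof (s : R) (z : C) :
  unit_disk z -> unit_disk (phase s * z).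
Proof. by rewrite /unit_disk /= normrM norm_phase mul1r. Qed.

Definition disk_action c (a : torus R 1) (z : disk c) : disk c :=
  exist _ (phase (repr a 0 0) * sval z) (disk_action_subproof _ (svalP z)).

Section Projective.
Variable n : nat.

Definition nonzero := {z : 'rV[C]_n.+1 | z != 0}.

(* Two nonzero vectors are equivalent when they span the same line. *)
Definition same_line : rel nonzero := fun z w => (val z == val w)%MS.

Lemma same_line_equiv : equiv_class_of same_line.
Proof.
split=> [z|z w|z w t].
- by rewrite /same_line submx_refl.
- by rewrite /same_line andbC.
- rewrite /same_line => /eqmxP zw /eqmxP wt.
  by apply/eqmxP/(eqmx_trans zw wt).
Qed.

Canonical same_line_equiv_rel := EquivRelPack same_line_equiv.

Definition proj_space := {eq_quot same_line}%qT.

Definition homog (p : proj_space) : 'rV[C]_n.+1 := val (repr p).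

Definition realify (z : 'rV[C]_n) : 'rV[R]_(n + n) :=
  row_mx (map_mx (@complex.Re R) z) (map_mx (@complex.Im R) z).

Definition complexify (x : 'rV[R]_(n + n)) : 'rV[C]_n :=
  \row_k Complex (lsubmx x 0 k) (rsubmx x 0 k).

Definition hdot (v w : 'rV[C]_n) : C := \sum_k v 0 k * conjc (w 0 k).

(* The real part of the Fubini-Study Hermitian form
   (4 / c) ((1 + |z|^2) <v, w> - <v, z> <z, w>) / (1 + |z|^2)^2
   in affine coordinates (Kobayashi-Nomizu, chapter IX); the factor 4 / c makes
   the holomorphic sectional curvature equal to c. *)
Definition fubini_study (c : R) (z v w : 'rV[C]_n) : R :=
  4 / c * complex.Re (((1 + hdot z z) * hdot v w - hdot v z * hdot z w)
              / (1 + hdot z z) ^+ 2).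

Definition projective (c : R) : kmfd R (n + n) :=
  @Kmfd R (n + n)
    (@Premanifold R (n + n) proj_space 'I_n.+1
       (fun j => [set p | homog p 0 j != 0])
       (fun j p => realify (\row_k (homog p 0 (lift j k) / homog p 0 j))))
    (fun _ x => \matrix_(a, b)
       fubini_study c (complexify x) (complexify (delta_mx 0 a))
                                     (complexify (delta_mx 0 b)))
    (fun _ _ => std_cplx R n).

Definition rotate (t : 'rV[R]_n) (z : 'rV[C]_n.+1) : 'rV[C]_n.+1 :=
  \row_k (if unlift ord_max k is Some l then phase (t 0 l) * z 0 k else z 0 k).

Lemma rotate_neq0 t (z : nonzero) : rotate t (val z) != 0.
Proof.
case: z => z /= /eqP z0; apply/eqP => rz; apply: z0; apply/rowP => k.
have /rowP/(_ k) := rz; rewrite !mxE.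
case: unliftP => [l _|//] /eqP; rewrite mulf_eq0 => /orP[/eqP ph0|/eqP//].
by have := norm_phase (t 0 l); rewrite ph0 normr0 => /esym/eqP; rewrite oner_eq0.
Qed.

Definition projective_action c (a : torus R n) (p : projective c) :
  projective c :=
  (\pi_(proj_space) (exist _ (rotate (repr a) (homog p))
                           (rotate_neq0 (repr a) (repr p)) : nonzero))%qT.

End Projective.
End Models.

(* Main.v *)
Require Import Defs.
From mathcomp Require Import all_boot all_order all_algebra ring_quotient.
From mathcomp Require Import complex.
From mathcomp Require Import all_classical all_reals all_analysis.
From mathcomp Require Import ring lra.

Set Implicit Arguments.
Unset Strict Implicit.
Unset Printing Implicit Defensive.

Import Order.TTheory GRing.Theory Num.Theory.
Import numFieldNormedType.Exports.

Local Open Scope classical_set_scope.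
Local Open Scope ring_scope.


(** Let theta be the natural parameters of one of the families and psi its cumulant
    generating function. In these coordinates the exponential connection is the ordinary
    derivative and the Fisher metric is the Hessian of psi. The tangent bundle becomes the
    tube of the z = theta + i y with its standard complex structure, and its metric is the
    Hessian of psi on both the real and the imaginary directions. A torification is then a
    holomorphic local isometry E from the tube onto the free orbits, equivariant for the
    translations in the imaginary directions and injective modulo its periods
    ([uniformization]): the map induced by E on the quotient by the lattice of periods is
    the required diffeomorphism.

    In all five cases E is exponential. Coordinatewise it is a constant times
    w_k = exp (z_k / 2), so that |w_k|^2 = exp theta_k; it lands in the plane or the disk,
    or in projective space as the point [w_1 : ... : w_n : 1]. The period is 4 pi i,
    and a translation by 4 pi i t rotates w by the angle 2 pi t. Up to constants the Kaehler
    potentials |w|^2, log (1 + sum |w_k|^2) and - log (1 - |w|^2) of the plane, of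
    projective space and of the disk pull back to exp theta, log (1 + sum exp theta_k) and
    - log (1 - exp theta). These are psi for the Poisson family, for the categorical,
    binomial and multinomial families up to the factor N, the number of trials, and for the
    negative binomial family up to the factor r: multiplying a metric by N or r divides
    its curvature, which explains P(1 / N) and D(- 1 / r). The proof compares the metrics
    themselves rather than potentials.

    There are two geometric models. [rotation_torification] treats rotations of the plane
    and of a disk, where holomorphic maps are conformal and only the conformal factor has
    to be compared. [projective_torification] treats projective space: charts, action and
    exponential are lifted to the cone of nonzero vectors, where the Fubini-Study form is
    invariant under scaling and kills radial vectors, and evaluating it on the exponential
    lift gives the covariance matrix p_i (delta_ij - p_j).

    On the statistical side, [affine_chart_family] gives the affine chart and the Fisher
    metric of an exponential family from the first two moments of its statistics. On a
    finite sample space the moments follow by differentiating the normalization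
    ([finite_family]), whose instance for multinomial distributions is the multinomial
    theorem ([multinomial_sum]). On the natural numbers they are obtained from factorial
    moments ([moments]). Dual flatness is automatic in dimension one; for the covariance
    metric the connection dual to the exponential one is computed and its curvature
    vanishes ([softmax_dual_flat]). *)
(** * Smooth real functions on open subsets of R^d *)

Lemma open_inter_preim (T T' : topologicalType) (U : set T) (g : T -> T') (A : set T') :
  open U -> (forall x, U x -> {for x, continuous g}) -> open A -> open (U `&` g @^-1` A).
Proof.
move=> oU cg oA; rewrite openE => x [Ux Ax].
by apply: filterI; [exact: open_nbhs_nbhs|apply: (cg _ Ux); exact: open_nbhs_nbhs].
Qed.

Section RealCalculus.
Variables (R : realType) (d : nat).
Implicit Types (U : set 'rV[R]_d) (f g : 'rV[R]_d -> R) (x v : 'rV[R]_d).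

(** Restricting to the line x + h v reduces the chain rule to one real variable. *)
Lemma is_derive_comp1 f x v df (phi : R -> R) dphi :
  is_derive x v f df -> is_derive (f x) 1 phi dphi ->
  is_derive x v (fun y => phi (f y)) (dphi * df).
Proof.
move=> [fd <-] [pd <-].
pose f1 := fun h : R => f (h *: v + x).
have f1d : derivable f1 0 1 by exact/(derivable1P _ _ _).1.
have f10 : f1 0 = f x by rewrite /f1 scale0r add0r.
have e (g : 'rV[R]_d -> R) : 'D_v g x = derive1 (fun h : R => g (h *: v + x)) 0.
  rewrite derive1E /derive; set g1 := fun h => h^-1 *: _; set g2 := fun h => h^-1 *: _.
  suff -> : g1 = g2 by [].
  by rewrite funeqE /g1 /g2 => h /=; rewrite addr0 scale0r add0r [_%:A]mulr1.
have pd1 : derivable phi (f1 0) 1 by rewrite f10.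
have gd : derivable (phi \o f1) 0 1.
  by apply/derivable1_diffP; apply: differentiable_comp; apply/derivable1_diffP.
split; first exact: (derivable1P (fun y => phi (f y)) x v).2 gd.
by rewrite (e (fun y => phi (f y))) (e f) (derive1_comp f1d pd1) f10 derive1E.
Qed.

Lemma derivable_eq_on U f g x v : open U -> U x -> {in U, f =1 g} ->
  derivable f x v -> derivable g x v.
Proof.
move=> oU Ux fg; apply: near_eq_derivable.
by near=> y; apply: fg; rewrite inE; near: y; exact: open_nbhs_nbhs.
Unshelve. all: by end_near. Qed.

Lemma derive_eq_on U f g x v : open U -> U x -> {in U, f =1 g} ->
  'D_v f x = 'D_v g x.
Proof.
move=> oU Ux fg; apply: near_eq_derive.
by near=> y; apply: fg; rewrite inE; near: y; exact: open_nbhs_nbhs.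
Unshelve. all: by end_near. Qed.

(** Finite order of differentiability, by recursion on the partial derivatives
    taken from the inside out: closure under the operations of analysis is then an
    induction on the order, which the list of partial derivatives in [smooth_on],
    peeled from the outside, does not allow directly. *)
Fixpoint Ck (k : nat) U f : Prop :=
  (forall x, U x -> {for x, continuous f}) /\
  (if k is k'.+1 then
     (forall x a, U x -> derivable f x (delta_mx 0 a)) /\
     (forall a, Ck k' U (partial a f))
   else True).

Lemma smooth_onP U f : smooth_on U f <-> forall k, Ck k U f.
Proof.
split=> [sf k|].
  elim: k f sf => [|k IH] f sf /=; first by split=> // x /(sf [::])[].
  split; first by move=> x /(sf [::])[].
  split=> [x a /(sf [::])[_] //|a]; apply: IH => s x Ux.
  by have := sf (rcons s a) x Ux; rewrite foldr_rcons.
move=> + s; elim/last_ind: s f => [|s a IH] f cf x Ux.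
  by have [c [dd _]] := cf 1%N; split=> [|a]; [exact: c|exact: dd].
rewrite foldr_rcons; apply: IH => // k.
by have [_ [_ ]] := cf k.+1; exact.
Qed.

Lemma CkS k U f : Ck k.+1 U f -> Ck k U f.
Proof.
elim: k f => [|k IH] f; first by case.
by move=> [c [dd pd]]; split=> //; split=> // a; apply: IH.
Qed.

Lemma Ck_cont k U f x : Ck k U f -> U x -> {for x, continuous f}.
Proof. by case: k => [|k] [c _]; exact: c. Qed.

Lemma Ck_eq k U f g : open U -> {in U, f =1 g} -> Ck k U f -> Ck k U g.
Proof.
move=> oU; elim: k f g => [|k IH] f g fg.
- move=> [c _]; split=> // x Ux; have nU : nbhs x U := open_nbhs_nbhs (conj oU Ux).
  rewrite /prop_for /continuous_at -(fg x) ?inE//.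
  have fgx : {near x, f =1 g} by apply: filterS nU => y Uy; apply/fg; rewrite inE.
  exact: cvg_trans (near_eq_cvg fgx) (c x Ux).
- move=> [c [dd pd]]; split.
    move=> x Ux; have nU : nbhs x U := open_nbhs_nbhs (conj oU Ux).
    rewrite /prop_for /continuous_at -(fg x) ?inE//.
    have fgx : {near x, f =1 g} by apply: filterS nU => y Uy; apply/fg; rewrite inE.
    exact: cvg_trans (near_eq_cvg fgx) (c x Ux).
  split=> [x a Ux|a]; first exact: (derivable_eq_on oU Ux fg (dd _ a Ux)).
  apply: IH (pd a) => x; rewrite inE => Ux.
  exact: derive_eq_on fg.
Qed.

Lemma Ck_cst k U (c : R) : Ck k U (fun=> c).
Proof.
elim: k c => [|k IH] c; (split; first by move=> x _; exact: cst_continuous) => //.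
split=> [x a _|a]; first exact: derivable_cst.
by have -> : partial a (fun=> c) = fun=> 0 by rewrite funeqE => x; exact: derive_cst.
Qed.

Lemma is_derive_coord i x v : is_derive x v (fun y : 'rV[R]_d => y 0 i) (v 0 i).
Proof.
have dc : differentiable (fun y : 'rV[R]_d => y 0 i : R) x by exact: differentiable_coord.
split; first exact: diff_derivable.
have e : (fun h : R => (h *: v + x) 0 i) = (fun h : R => h * v 0 i + x 0 i).
  by rewrite funeqE => h; rewrite !mxE.
have -> : 'D_v (fun y : 'rV[R]_d => y 0 i) x = derive1 (fun h : R => h * v 0 i + x 0 i) 0.
  rewrite derive1E /derive; set g1 := fun h => h^-1 *: _; set g2 := fun h => h^-1 *: _.
  suff -> : g1 = g2 by [].
  by rewrite funeqE /g1 /g2 => h /=; rewrite !mxE addr0 mul0r add0r [_%:A]mulr1.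
rewrite derive1E.
have -> : (fun h : R => h * v 0 i + x 0 i) = (v 0 i \*: (@id R)) + cst (x 0 i).
  by rewrite funeqE => h /=; rewrite mulrC.
by rewrite derive_val addr0 [LHS]mulr1.
Qed.

Lemma partial_coord a i x : partial a (fun y : 'rV[R]_d => y 0 i) x = (a == i)%:R.
Proof.
rewrite /partial; have [_ ->] := is_derive_coord i x (delta_mx 0 a).
by rewrite mxE eqxx eq_sym.
Qed.

Lemma Ck_coord k U i : Ck k U (fun y : 'rV[R]_d => y 0 i).
Proof.
case: k => [|k]; first by split=> // x _; exact: coord_continuous.
split; first by move=> x _; exact: coord_continuous.
split=> [x a _|a]; first by case: (is_derive_coord i x (delta_mx 0 a)).
rewrite (_ : partial a _ = fun=> (a == i)%:R); first exact: Ck_cst.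
by rewrite funeqE => x; exact: partial_coord.
Qed.

Lemma partialD f g a x : derivable f x (delta_mx 0 a) -> derivable g x (delta_mx 0 a) ->
  partial a (fun y => f y + g y) x = partial a f x + partial a g x.
Proof. exact: deriveD. Qed.

Lemma partialM f g a x : derivable f x (delta_mx 0 a) -> derivable g x (delta_mx 0 a) ->
  partial a (fun y => f y * g y) x = f x * partial a g x + g x * partial a f x.
Proof. exact: deriveM. Qed.

Lemma CkD k U f g : open U -> Ck k U f -> Ck k U g -> Ck k U (fun y => f y + g y).
Proof.
move=> oU; elim: k f g => [|k IH] f g.
  move=> [cf _] [cg _]; split=> // x Ux.
  by apply: (@continuousD _ _ _ f g); [exact: cf|exact: cg].
move=> [cf [df pf]] [cg [dg pg]]; split.
  by move=> x Ux; apply: (@continuousD _ _ _ f g); [exact: cf|exact: cg].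
split=> [x a Ux|a]; first by apply: derivableD; [exact: df|exact: dg].
apply: Ck_eq (IH _ _ (pf a) (pg a)) => // x; rewrite inE => Ux.
by rewrite partialD; [|exact: df|exact: dg].
Qed.

Lemma CkM k U f g : open U -> Ck k U f -> Ck k U g -> Ck k U (fun y => f y * g y).
Proof.
move=> oU; elim: k f g => [|k IH] f g.
  move=> [cf _] [cg _]; split=> // x Ux.
  by apply: (@continuousM _ _ f g); [exact: cf|exact: cg].
move=> Cf Cg; have [cf [df pf]] := Cf; have [cg [dg pg]] := Cg; split.
  by move=> x Ux; apply: (@continuousM _ _ f g); [exact: cf|exact: cg].
split=> [x a Ux|a]; first by apply: derivableM; [exact: df|exact: dg].
apply: Ck_eq (CkD oU (IH _ _ (CkS Cf) (pg a)) (IH _ _ (CkS Cg) (pf a))) => // x.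
by rewrite inE => Ux; rewrite partialM; [|exact: df|exact: dg].
Qed.

(** By the chain rule the partial derivatives of the composite are products of two
    functions of order k, so each elementary function needs only its derivative. *)
Lemma Ck_compS k U f (phi dphi : R -> R) : open U -> Ck k.+1 U f ->
  (forall x, U x -> is_derive (f x) 1 phi (dphi (f x))) ->
  Ck k U (fun x => dphi (f x)) -> Ck k.+1 U (fun x => phi (f x)).
Proof.
move=> oU [cf [df pf]] dp Cd.
have dc x a : U x -> is_derive x (delta_mx 0 a) (fun y => phi (f y))
    (dphi (f x) * partial a f x).
  move=> Ux; apply: is_derive_comp1; last exact: dp.
  by apply: derivableP; exact: df.
split; [|split].
- move=> x Ux; apply: (@continuous_comp _ _ _ f phi); first exact: cf.
  apply: differentiable_continuous; apply/derivable1_diffP.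
  by case: (dp x Ux).
- by move=> x a Ux; case: (dc x a Ux).
- move=> a; apply: Ck_eq (CkM oU Cd (pf a)) => // x; rewrite inE => Ux.
  by have [_ <-] := dc x a Ux.
Qed.

Lemma Ck0_comp k U f (phi : R -> R) : Ck k U f ->
  (forall x, U x -> {for f x, continuous phi}) -> Ck 0 U (fun x => phi (f x)).
Proof.
move=> Cf cp; split=> // x Ux; apply: (@continuous_comp _ _ _ f phi).
  exact: Ck_cont Cf Ux.
exact: cp.
Qed.

Lemma Ck_expR k U f : open U -> Ck k U f -> Ck k U (fun x => expR (f x)).
Proof.
move=> oU; elim: k => [|k IH] Cf.
  by apply: (Ck0_comp Cf) => x _; exact: continuous_expR.
by apply: (Ck_compS (dphi := expR)) => //; exact/IH/CkS.
Qed.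

Lemma Ck_cos_sin k U f : open U -> Ck k U f ->
  Ck k U (fun x => cos (f x)) /\ Ck k U (fun x => sin (f x)).
Proof.
move=> oU; elim: k => [|k IH] Cf.
  split; apply: (Ck0_comp Cf) => x _; first exact: continuous_cos.
  exact: continuous_sin.
have [Cc Cs] := IH (CkS Cf); split.
  apply: (Ck_compS (dphi := fun t => - sin t)) => //.
  apply: Ck_eq (CkM oU (Ck_cst k U (-1)) Cs) => // x _.
  by rewrite mulN1r.
exact: (Ck_compS (dphi := cos)).
Qed.

Lemma Ck_inv k U f : open U -> (forall x, U x -> f x != 0) -> Ck k U f ->
  Ck k U (fun x => (f x)^-1).
Proof.
move=> oU f0; elim: k => [|k IH] Cf.
  by apply: (Ck0_comp Cf) => x Ux; apply: inv_continuous; exact: f0.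
apply: (Ck_compS (phi := fun t => t^-1) (dphi := fun t => - (t^-1 * t^-1))) => //.
  move=> x Ux; have /(_ (f x) 1) := @deriveV R _ id; rewrite derive_id => e.
  split; first by apply: derivableV; [exact: f0|exact: derivable_id].
  rewrite e; [|exact: f0|exact: derivable_id].
  by rewrite [LHS]mulr1 expr2 invfM.
apply: Ck_eq (CkM oU (Ck_cst k U (-1)) (CkM oU (IH (CkS Cf)) (IH (CkS Cf)))) => // x _.
by rewrite mulN1r.
Qed.

Lemma Ck_ln k U f : open U -> (forall x, U x -> 0 < f x) -> Ck k U f ->
  Ck k U (fun x => ln (f x)).
Proof.
move=> oU f0; case: k => [|k] Cf.
  by apply: (Ck0_comp Cf) => x Ux; apply: continuous_ln; exact: f0.
apply: (Ck_compS (dphi := fun t => t^-1)) => //.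
  by move=> x Ux; apply: is_derive1_ln; exact: f0.
apply: Ck_inv => //; last exact: CkS.
by move=> x /f0; rewrite lt0r => /andP[].
Qed.

Lemma Ck_atan k U f : open U -> Ck k U f -> Ck k U (fun x => atan (f x)).
Proof.
move=> oU; case: k => [|k] Cf.
  by apply: (Ck0_comp Cf) => x Ux; exact: continuous_atan.
apply: (Ck_compS (dphi := fun t => (1 + t ^+ 2)^-1)) => //.
apply: (@Ck_inv _ _ (fun x => 1 + f x ^+ 2)) => //.
  by move=> x _; apply: lt0r_neq0; rewrite ltr_wpDr ?sqr_ge0.
apply: CkD => //; first exact: Ck_cst.
by apply: CkM => //; exact: CkS.
Qed.

Lemma smooth_on_eq U f g : open U -> {in U, f =1 g} -> smooth_on U f -> smooth_on U g.
Proof. by move=> oU fg /smooth_onP Cf; apply/smooth_onP => k; exact: Ck_eq (Cf k). Qed.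

Lemma smooth_on_cst U (c : R) : smooth_on U (fun=> c).
Proof. by apply/smooth_onP => k; exact: Ck_cst. Qed.

Lemma smooth_on_coord U i : smooth_on U (fun y : 'rV[R]_d => y 0 i).
Proof. by apply/smooth_onP => k; exact: Ck_coord. Qed.

Lemma smooth_onD U f g : open U -> smooth_on U f -> smooth_on U g ->
  smooth_on U (fun y => f y + g y).
Proof. by move=> oU /smooth_onP F /smooth_onP G; apply/smooth_onP => k; exact: CkD. Qed.

Lemma smooth_onM U f g : open U -> smooth_on U f -> smooth_on U g ->
  smooth_on U (fun y => f y * g y).
Proof. by move=> oU /smooth_onP F /smooth_onP G; apply/smooth_onP => k; exact: CkM. Qed.

Lemma smooth_onN U f : open U -> smooth_on U f -> smooth_on U (fun y => - f y).
Proof.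
move=> oU sf; refine (smooth_on_eq oU _ (smooth_onM oU (smooth_on_cst (-1)) sf)).
by move=> x _; rewrite mulN1r.
Qed.

Lemma smooth_onB U f g : open U -> smooth_on U f -> smooth_on U g ->
  smooth_on U (fun y => f y - g y).
Proof. by move=> oU sf sg; exact (smooth_onD oU sf (smooth_onN oU sg)). Qed.

Lemma smooth_on_sum U I (r : seq I) (P : pred I) (F : I -> 'rV[R]_d -> R) : open U ->
  (forall i, smooth_on U (F i)) -> smooth_on U (fun y => \sum_(i <- r | P i) F i y).
Proof.
move=> oU sF; elim: r => [|i r IH].
  refine (smooth_on_eq oU _ (smooth_on_cst 0)).
  by move=> x _; rewrite big_nil.
case Pi : (P i).
  refine (smooth_on_eq oU _ (smooth_onD oU (sF i) IH)).
  by move=> x _; rewrite big_cons Pi.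
by refine (smooth_on_eq oU _ IH) => x _; rewrite big_cons Pi.
Qed.

Lemma smooth_onV U f : open U -> (forall x, U x -> f x != 0) -> smooth_on U f ->
  smooth_on U (fun y => (f y)^-1).
Proof. by move=> oU f0 /smooth_onP F; apply/smooth_onP => k; exact: Ck_inv. Qed.

Lemma smooth_on_expR U f : open U -> smooth_on U f -> smooth_on U (fun y => expR (f y)).
Proof. by move=> oU /smooth_onP F; apply/smooth_onP => k; exact: Ck_expR. Qed.

Lemma smooth_on_cos U f : open U -> smooth_on U f -> smooth_on U (fun y => cos (f y)).
Proof. by move=> oU /smooth_onP F; apply/smooth_onP => k; case: (Ck_cos_sin oU (F k)). Qed.

Lemma smooth_on_sin U f : open U -> smooth_on U f -> smooth_on U (fun y => sin (f y)).
Proof. by move=> oU /smooth_onP F; apply/smooth_onP => k; case: (Ck_cos_sin oU (F k)). Qed.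

Lemma smooth_on_ln U f : open U -> (forall x, U x -> 0 < f x) -> smooth_on U f ->
  smooth_on U (fun y => ln (f y)).
Proof. by move=> oU f0 /smooth_onP F; apply/smooth_onP => k; exact: Ck_ln. Qed.

Lemma smooth_on_atan U f : open U -> smooth_on U f -> smooth_on U (fun y => atan (f y)).
Proof. by move=> oU /smooth_onP F; apply/smooth_onP => k; exact: Ck_atan. Qed.

Lemma smooth_on_cont U f x : smooth_on U f -> U x -> {for x, continuous f}.
Proof. by move=> sf Ux; have [] := sf [::] x Ux. Qed.

Lemma smooth_on_der U f x a : smooth_on U f -> U x -> derivable f x (delta_mx 0 a).
Proof. by move=> sf Ux; have [_] := sf [::] x Ux; exact. Qed.

Lemma smooth_on_is_derive U f x a : smooth_on U f -> U x ->
  is_derive x (delta_mx 0 a) f (partial a f x).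
Proof. by move=> sf Ux; apply: derivableP; exact: smooth_on_der sf Ux. Qed.

Lemma smooth_on_sub U W f : W `<=` U -> smooth_on U f -> smooth_on W f.
Proof. by move=> WU sf s x /WU; exact: sf. Qed.

Lemma smooth_on_local U f :
  (forall x, U x -> exists2 W, W x & smooth_on W f) -> smooth_on U f.
Proof. by move=> loc s x /loc[W Wx]; exact. Qed.

Lemma smooth_on_partial U f a : smooth_on U f -> smooth_on U (partial a f).
Proof. by move=> sf s x Ux; have := sf (rcons s a) x Ux; rewrite foldr_rcons. Qed.

End RealCalculus.

(** * Complex-valued functions of real variables *)

Section ComplexCalculus.
Variables (R : realType) (d : nat).
Local Notation C := (R[i]).
Implicit Types (U : set 'rV[R]_d) (f g : 'rV[R]_d -> C) (x v : 'rV[R]_d) (df dg : C).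

(** Complex functions are differentiated through their real and imaginary parts: only
    real differentiability is ever used, and being holomorphic is a relation between
    two partial derivatives. *)
Definition csmooth U f := smooth_on U (fun x => complex.Re (f x)) /\
  smooth_on U (fun x => complex.Im (f x)).

Definition cderive x v f df :=
  is_derive x v (fun y => complex.Re (f y)) (complex.Re df) /\
  is_derive x v (fun y => complex.Im (f y)) (complex.Im df).

Definition cpartial (a : 'I_d) f x : C :=
  Complex (partial a (fun y => complex.Re (f y)) x)
          (partial a (fun y => complex.Im (f y)) x).

Lemma ReM (z w : C) : complex.Re (z * w) =
  complex.Re z * complex.Re w - complex.Im z * complex.Im w.
Proof. by case: z w => [a b] [c e]. Qed.

Lemma ImM (z w : C) : complex.Im (z * w) =
  complex.Re z * complex.Im w + complex.Im z * complex.Re w.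
Proof. by case: z w => [a b] [c e]. Qed.

Lemma ReD (z w : C) : complex.Re (z + w) = complex.Re z + complex.Re w.
Proof. by case: z w => [a b] [c e]. Qed.

Lemma ImD (z w : C) : complex.Im (z + w) = complex.Im z + complex.Im w.
Proof. by case: z w => [a b] [c e]. Qed.

Definition nrm2 (z : C) : R := complex.Re z ^+ 2 + complex.Im z ^+ 2.

Lemma nrm2_ge0 z : 0 <= nrm2 z.
Proof. by rewrite addr_ge0 ?sqr_ge0. Qed.

Lemma nrm2_eq0 z : (nrm2 z == 0) = (z == 0).
Proof.
by rewrite paddr_eq0 ?sqr_ge0 // !sqrf_eq0; case: z => a b; rewrite eq_complex.
Qed.

Lemma nrm2_gt0 z : z != 0 -> 0 < nrm2 z.
Proof. by rewrite lt0r nrm2_ge0 andbT nrm2_eq0. Qed.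

Lemma mulcJ (z : C) : z * conjc z = (nrm2 z)%:C%C.
Proof.
case: z => a b; rewrite /nrm2 /=; apply/eqP; rewrite eq_complex /=.
by apply/andP; split; apply/eqP; ring.
Qed.

Lemma nrm2M (z w : C) : nrm2 (z * w) = nrm2 z * nrm2 w.
Proof. by rewrite /nrm2 ReM ImM; ring. Qed.

(** Reduces the inverse of a complex function to the inverse of a real one. *)
Lemma invcE (z : C) : z^-1 = conjc z * ((nrm2 z)^-1)%:C%C.
Proof.
have [->|z0] := eqVneq z 0; first by rewrite conjc0 invr0 mul0r.
apply: (mulfI z0); rewrite divff // mulrA mulcJ -rmorphM /= mulfV ?rmorph1 //.
by rewrite nrm2_eq0.
Qed.

Lemma csmooth_eq U f g : open U -> {in U, f =1 g} -> csmooth U f -> csmooth U g.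
Proof.
move=> oU fg [s1 s2]; split.
  by refine (smooth_on_eq oU _ s1) => x Ux; rewrite fg.
by refine (smooth_on_eq oU _ s2) => x Ux; rewrite fg.
Qed.

Lemma csmooth_sub U W f : W `<=` U -> csmooth U f -> csmooth W f.
Proof. by move=> WU [s1 s2]; split; exact: smooth_on_sub WU _. Qed.

Lemma csmooth_cst U (c : C) : csmooth U (fun=> c).
Proof. by split; exact: smooth_on_cst. Qed.

Lemma csmooth_real U (f : 'rV[R]_d -> R) : smooth_on U f -> csmooth U (fun x => (f x)%:C%C).
Proof. by move=> sf; split=> //; exact: smooth_on_cst. Qed.

Lemma csmoothD U f g : open U -> csmooth U f -> csmooth U g ->
  csmooth U (fun x => f x + g x).
Proof.
move=> oU [f1 f2] [g1 g2]; split.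
  by refine (smooth_on_eq oU _ (smooth_onD oU f1 g1)) => x _; rewrite ReD.
by refine (smooth_on_eq oU _ (smooth_onD oU f2 g2)) => x _; rewrite ImD.
Qed.

Lemma csmoothM U f g : open U -> csmooth U f -> csmooth U g ->
  csmooth U (fun x => f x * g x).
Proof.
move=> oU [f1 f2] [g1 g2]; split.
  refine (smooth_on_eq oU _ (smooth_onB oU (smooth_onM oU f1 g1) (smooth_onM oU f2 g2))).
  by move=> x _; rewrite ReM.
refine (smooth_on_eq oU _ (smooth_onD oU (smooth_onM oU f1 g2) (smooth_onM oU f2 g1))).
by move=> x _; rewrite ImM.
Qed.

Lemma csmooth_conj U f : open U -> csmooth U f -> csmooth U (fun x => conjc (f x)).
Proof.
move=> oU [f1 f2]; split.
  by refine (smooth_on_eq oU _ f1) => x _; case: (f x).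
by refine (smooth_on_eq oU _ (smooth_onN oU f2)) => x _; case: (f x).
Qed.

Lemma smooth_nrm2 U f : open U -> csmooth U f -> smooth_on U (fun x => nrm2 (f x)).
Proof.
move=> oU [f1 f2].
exact: (smooth_onD oU (smooth_onM oU f1 f1) (smooth_onM oU f2 f2)).
Qed.

Lemma csmoothV U f : open U -> (forall x, U x -> f x != 0) -> csmooth U f ->
  csmooth U (fun x => (f x)^-1).
Proof.
move=> oU f0 sf.
have n0 x : U x -> nrm2 (f x) != 0 by move=> /f0; rewrite nrm2_eq0.
refine (csmooth_eq oU _ (csmoothM oU (csmooth_conj oU sf)
  (csmooth_real (smooth_onV oU n0 (smooth_nrm2 oU sf))))).
by move=> x _; rewrite invcE.
Qed.

Lemma csmooth_sum U I (r : seq I) (P : pred I) (F : I -> 'rV[R]_d -> C) : open U ->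
  (forall i, csmooth U (F i)) -> csmooth U (fun y => \sum_(i <- r | P i) F i y).
Proof.
move=> oU sF; elim: r => [|i r IH].
  by refine (csmooth_eq oU _ (csmooth_cst U 0)) => x _; rewrite big_nil.
case Pi : (P i).
  by refine (csmooth_eq oU _ (csmoothD oU (sF i) IH)) => x _; rewrite big_cons Pi.
by refine (csmooth_eq oU _ IH) => x _; rewrite big_cons Pi.
Qed.

Lemma open_neq0 : open [set r : R | r != 0].
Proof.
rewrite (_ : [set r : R | r != 0] = [set r | r < 0] `|` [set r | r > 0]).
  by apply: openU; [exact: open_lt|exact: open_gt].
by apply/seteqP; split=> r /=; rewrite neq_lt => /orP.
Qed.

Lemma csmooth_open_neq0 U f : open U -> csmooth U f -> open (U `&` [set x | f x != 0]).
Proof.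
move=> oU sf; rewrite (_ : _ `&` _ = U `&` (fun x => nrm2 (f x)) @^-1` [set r | r != 0]).
  apply: (@open_inter_preim _ R U (fun x => nrm2 (f x)) [set r | r != 0] oU _ open_neq0).
  by move=> x Ux; exact: smooth_on_cont (smooth_nrm2 oU sf) Ux.
by apply/seteqP; split=> x [Ux]; rewrite /= nrm2_eq0.
Qed.

Lemma csmooth_cderive U f x a : csmooth U f -> U x ->
  cderive x (delta_mx 0 a) f (cpartial a f x).
Proof. by move=> [s1 s2] Ux; split=> /=; [exact: (smooth_on_is_derive a s1)|exact: (smooth_on_is_derive a s2)]. Qed.

Lemma cderive_cpartial x a f df : cderive x (delta_mx 0 a) f df -> cpartial a f x = df.
Proof. by case: df => u w [[_ /= <-] [_ /= <-]]. Qed.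

Lemma cderive_cst x v (c : C) : cderive x v (fun=> c) 0.
Proof. by split; exact: is_derive_cst. Qed.

Lemma cderiveD x v f g df dg : cderive x v f df -> cderive x v g dg ->
  cderive x v (fun y => f y + g y) (df + dg).
Proof.
move=> [f1 f2] [g1 g2]; split.
  by under eq_fun do rewrite ReD; rewrite ReD; exact: is_deriveD.
by under eq_fun do rewrite ImD; rewrite ImD; exact: is_deriveD.
Qed.

Lemma cderiveM x v f g df dg : cderive x v f df -> cderive x v g dg ->
  cderive x v (fun y => f y * g y) (f x * dg + g x * df).
Proof.
move=> [f1 f2] [g1 g2]; split.
  under eq_fun do rewrite ReM.
  apply: (is_derive_eq (is_deriveB (is_deriveM f1 g1) (is_deriveM f2 g2))).
  by rewrite ReD !ReM /GRing.scale /=; ring.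
under eq_fun do rewrite ImM.
apply: (is_derive_eq (is_deriveD (is_deriveM f1 g2) (is_deriveM f2 g1))).
by rewrite ImD !ImM /GRing.scale /=; ring.
Qed.

Lemma cderive_real x v (f : 'rV[R]_d -> R) (df : R) : is_derive x v f df ->
  cderive x v (fun y => (f y)%:C%C) df%:C%C.
Proof. by move=> h; split=> //=; exact: is_derive_cst. Qed.

Lemma cderive_sum x v I (r : seq I) (F : I -> 'rV[R]_d -> C) (dF : I -> C) :
  (forall i, cderive x v (F i) (dF i)) ->
  cderive x v (fun y => \sum_(i <- r) F i y) (\sum_(i <- r) dF i).
Proof.
move=> h; elim: r => [|i r IH].
  by under eq_fun do rewrite big_nil; rewrite big_nil; exact: cderive_cst.
by under eq_fun do rewrite big_cons; rewrite big_cons; exact: cderiveD.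
Qed.

Lemma cderiveV x v f df : f x != 0 -> cderive x v f df ->
  cderive x v (fun y => (f y)^-1) (- df / f x ^+ 2).
Proof.
move=> fx0 [f1 f2].
have n0 : nrm2 (f x) != 0 by rewrite nrm2_eq0.
have dn : is_derive x v (fun y => nrm2 (f y))
    (2 * (complex.Re (f x) * complex.Re df + complex.Im (f x) * complex.Im df)).
  apply: (is_derive_eq (is_deriveD (is_deriveM f1 f1) (is_deriveM f2 f2))).
  by rewrite /GRing.scale /=; ring.
have di : is_derive x v (fun y => (nrm2 (f y))^-1)
   (- (nrm2 (f x)) ^- 2 * (2 * (complex.Re (f x) * complex.Re df + complex.Im (f x) * complex.Im df))).
  case: (dn) => dn1 dn2; split; first exact: derivableV.
  by rewrite (@deriveV _ _ (fun y => nrm2 (f y))) // dn2.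
have dc : cderive x v (fun y => conjc (f y)) (conjc df).
  split; last first.
    rewrite (_ : complex.Im (conjc df) = - complex.Im df); last by case: (df).
    rewrite (_ : (fun y => _) = (fun y => - complex.Im (f y))); first exact: is_deriveN.
    by rewrite funeqE => y; case: (f y).
  rewrite (_ : complex.Re (conjc df) = complex.Re df); last by case: (df).
  rewrite (_ : (fun y => _) = (fun y => complex.Re (f y))); first exact: f1.
  by rewrite funeqE => y; case: (f y).
have := cderiveM dc (cderive_real di).
rewrite (_ : (fun y => conjc (f y) * ((nrm2 (f y))^-1)%:C%C) = (fun y => (f y)^-1)); last first.
  by rewrite funeqE => y; rewrite invcE.
rewrite (_ : conjc (f x) * _ + _ = - df / f x ^+ 2) //.
rewrite -[(f x ^+ 2)^-1]exprVn [(f x)^-1]invcE; move: n0; rewrite /nrm2.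
case: (f x) => a b; case: df {f1 f2 dn di dc} => u w /= n0.
by apply/eqP; rewrite eq_complex /=; apply/andP; split; apply/eqP; field.
Qed.

Lemma cderive_div x v f g df dg : g x != 0 -> cderive x v f df -> cderive x v g dg ->
  cderive x v (fun y => f y / g y) (df / g x - f x * dg / g x ^+ 2).
Proof.
move=> g0 hf hg; have := cderiveM hf (cderiveV g0 hg).
by congr (cderive _ _ _ _); rewrite mulNr mulrN addrC mulrC mulrA.
Qed.

End ComplexCalculus.

(** * Manifolds given by atlases *)

Section Atlases.
Variable R : realType.

Lemma nbhs_rV d (x : 'rV[R]_d) (P : 'I_d -> set R) :
  (forall l, nbhs (x 0 l) (P l)) -> nbhs x [set y | forall l, P l (y 0 l)].
Proof.
move=> nP; exists (fun _ l => P l); first by move=> i l; rewrite ord1; exact: nP.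
by move=> y h l; exact: (h ord0 l).
Qed.

Lemma nbhs_rVP d (x : 'rV[R]_d) (A : set 'rV[R]_d) : nbhs x A ->
  exists2 P : 'I_d -> set R, forall l, nbhs (x 0 l) (P l) &
    [set y : 'rV[R]_d | forall l, P l (y 0 l)] `<=` A.
Proof.
move=> [P nP PA]; exists (P ord0); first by move=> l; exact: nP.
by move=> y Py; apply: PA => i l; rewrite ord1; exact: Py.
Qed.

Lemma continuous_rV d (T : topologicalType) (f : T -> 'rV[R]_d) t :
  (forall l, {for t, continuous (fun s => f s 0 l)}) -> {for t, continuous f}.
Proof.
move=> cf A /nbhs_rVP[P nP PA].
have : \forall s \near t, forall l, P l (f s 0 l).
  by apply: filter_forall => l; exact: (cf l _ (nP l)).
by apply: filterS => s h; exact: PA.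
Qed.

Lemma smooth_vec_cont d e (U : set 'rV[R]_d) (f : 'rV[R]_d -> 'rV[R]_e) x :
  smooth_vec U f -> U x -> {for x, continuous f}.
Proof. by move=> sf Ux; apply: continuous_rV => l; exact: smooth_on_cont (sf l) Ux. Qed.

Lemma open_local d (U : set 'rV[R]_d) :
  (forall x, U x -> exists W, [/\ open W, W x & W `<=` U]) -> open U.
Proof.
move=> h; rewrite openE => x /h[W [oW Wx WU]].
by apply: filterS WU _; exact: open_nbhs_nbhs.
Qed.

Definition inj_charts d (M : premanifold R d) :=
  forall i : chart M, set_inj (chart_dom i) (@chart_map _ _ M i).

Lemma in_chartE d (M : premanifold R d) (V : zmodType) (i : chart M) (f : M -> V) p :
  inj_charts M -> chart_dom i p -> in_chart i f (chart_map i p) = f p.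
Proof.
move=> iM ip; apply: xget_unique; first by exists p.
by move=> _ [q [iq /= qp] <-]; congr f; apply: (iM i); rewrite ?inE.
Qed.

(** A formula for f that is known only on an open set of coordinates. Smoothness and the
    differential are local, so such formulas replace [in_chart], whose values outside
    the chart are arbitrary. *)
Definition local_rep d e (M : premanifold R d) (N : premanifold R e) (f : M -> N)
    (i : chart M) (j : chart N) (W : set 'rV[R]_d) (w : 'rV[R]_d -> 'rV[R]_e) :=
  open W /\ forall x, W x -> exists q,
    [/\ chart_dom i q, chart_map i q = x, chart_dom j (f q) & chart_map j (f q) = w x].

Section LocalRep.
Variables (d e : nat) (M : premanifold R d) (N : premanifold R e) (f : M -> N).
Hypothesis iM : inj_charts M.

Lemma local_rep_eq i j W w : local_rep f i j W w ->
  {in W, in_chart i (fun p => chart_map j (f p)) =1 w}.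
Proof.
move=> [_ h] x; rewrite inE => /h[q [iq <- _ <-]].
by rewrite in_chartE.
Qed.

Lemma local_rep_smooth :
  (forall i j p, chart_dom i p -> chart_dom j (f p) -> exists W w,
     [/\ W (chart_map i p), local_rep f i j W w & smooth_vec W w]) ->
  smooth_map f.
Proof.
move=> h i j U; split.
  apply: open_local => x [p [ip jp] <-]; have [W [w [Wp rw sw]]] := h i j p ip jp.
  exists W; split=> //; first by case: rw.
  by case: rw => _ rw y /rw[q [iq <- jq _]]; exists q.
move=> l; apply: smooth_on_local => _ [p [ip jp] <-].
have [W [w [Wp rw sw]]] := h i j p ip jp; exists W => //.
have [oW _] := rw; refine (smooth_on_eq oW _ (sw l)) => x Wx.
by rewrite (local_rep_eq rw).
Qed.

Lemma jac_eq_on m n (W : set 'rV[R]_m) (w w' : 'rV[R]_m -> 'rV[R]_n) x :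
  open W -> W x -> {in W, w =1 w'} -> jac w x = jac w' x.
Proof.
move=> oW Wx ww; apply/matrixP => a b; rewrite !mxE.
by refine (derive_eq_on (U := W) _ oW Wx _) => y Wy; rewrite ww.
Qed.

Lemma local_rep_dmap i j W w p : local_rep f i j W w -> W (chart_map i p) ->
  dmap f i j (chart_map i p) = jac w (chart_map i p).
Proof. by move=> rw Wp; have [oW _] := rw; exact: jac_eq_on (local_rep_eq rw). Qed.

End LocalRep.

Lemma jac_id d (x : 'rV[R]_d) : jac id x = 1%:M.
Proof. by apply/matrixP => a b; rewrite !mxE partial_coord. Qed.

(** The topology of a manifold is only given through [mopen]; continuity of f is
    therefore expressed in the charts. *)
Lemma mopen_preim d (M : premanifold R d) (T : topologicalType) (f : M -> T) (A : set T)
    (g : chart M -> 'rV[R]_d -> T) :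
  (forall i : chart M, open (chart_cod i)) ->
  (forall (i : chart M) p, chart_dom i p -> f p = g i (chart_map i p)) ->
  (forall (i : chart M) x, chart_cod i x -> {for x, continuous (g i)}) ->
  open A -> mopen (f @^-1` A).
Proof.
move=> oM fg cg oA i; rewrite (_ : _ @` _ = chart_cod i `&` g i @^-1` A).
  by apply: open_inter_preim oA => // x; exact: cg.
apply/seteqP; split=> [_ [p [ip /= Ap] <-]|_ [[p ip <-] Ap]].
  by split; [exists p|rewrite /= -fg].
by exists p => //; split=> //=; rewrite (fg i).
Qed.

Lemma separated_by_function d (M : premanifold R d) (f : M -> R)
    (g : chart M -> 'rV[R]_d -> R) p q :
  (forall i : chart M, open (chart_cod i)) ->
  (forall (i : chart M) r, chart_dom i r -> f r = g i (chart_map i r)) ->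
  (forall (i : chart M) x, chart_cod i x -> {for x, continuous (g i)}) ->
  f p < f q -> exists U V : set M, [/\ mopen U, mopen V, U p, V q & U `&` V = set0].
Proof.
move=> oM fg cg pq; pose c := (f p + f q) / 2.
have pc : f p < c by rewrite /c; lra.
have cq : c < f q by rewrite /c; lra.
exists (f @^-1` [set t | t < c]), (f @^-1` [set t | t > c]); split=> //.
- by apply: mopen_preim fg cg _ => //; exact: open_lt.
- by apply: mopen_preim fg cg _ => //; exact: open_gt.
- by apply/seteqP; split=> // r [/= rc cr]; have := lt_trans rc cr; rewrite ltxx.
Qed.

(** Boxes with rational corners, read in the charts of a countable atlas, are a
    basis of the topology. *)
Lemma second_countable d (M : premanifold R d) (ch : nat -> chart M) :
  inj_charts M -> (forall p : M, exists k, chart_dom (ch k) p) ->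
  smooth_map (fun p : M => p) ->
  exists B : nat -> set M, (forall k, mopen (B k)) /\
    forall (U : set M) p, mopen U -> U p -> exists k, B k p /\ B k `<=` U.
Proof.
move=> iM cM sM.
pose box (lh : 'rV[rat]_d * 'rV[rat]_d) : set 'rV[R]_d :=
  [set x | forall l, ratr (lh.1 0 l) < x 0 l < ratr (lh.2 0 l)].
have obox lh : open (box lh).
  rewrite openE => x bx.
  apply: (nbhs_rV (P := fun l => [set z | ratr (lh.1 0 l) < z < ratr (lh.2 0 l)])) => l.
  have xl : x 0 l \in `]ratr (lh.1 0 l), ratr (lh.2 0 l)[ by rewrite in_itv; exact: bx.
  by have := near_in_itvoo xl; apply: filterS => y; rewrite in_itv.
pose Bt (t : nat * ('rV[rat]_d * 'rV[rat]_d)) : set M :=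
  [set p | chart_dom (ch t.1) p /\ box t.2 (chart_map (ch t.1) p)].
exists (fun k => if unpickle k is Some t then Bt t else set0); split.
  move=> k; case: unpickle => [t|]; last first.
    move=> i; rewrite setI0 image_set0; exact: open0.
  move=> j; have [oU sU] := sM j (ch t.1).
  have := open_inter_preim oU (fun x Ux => smooth_vec_cont sU Ux) (obox t.2).
  congr open; apply/seteqP; split=> [_ [[p [jp ip] <-]]|_ [p [jp [ip bp]] <-]].
    by rewrite /= in_chartE // => bp; exists p.
  by split; [exists p|rewrite /= in_chartE].
move=> U p oU Up; have [k kp] := cM p.
have : nbhs (chart_map (ch k) p) (chart_map (ch k) @` (chart_dom (ch k) `&` U)).
  by apply: open_nbhs_nbhs; split; [exact: oU|exists p].
move=> /nbhs_rVP[P nP PU]; set x := chart_map _ _ in nP PU.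
have ex l : exists lh : rat * rat, ratr lh.1 < x 0 l < ratr lh.2 /\
    forall y : R, ratr lh.1 < y < ratr lh.2 -> P l y.
  have /nbhs_ballP[e /= e0 eP] := nP l.
  have [a] : exists q : rat, ratr q \in `]x 0 l - e, x 0 l[.
    by apply: rat_in_itvoo; lra.
  have [b] : exists q : rat, ratr q \in `]x 0 l, x 0 l + e[.
    by apply: rat_in_itvoo; lra.
  rewrite !in_itv /= => /andP[b1 b2] /andP[a1 a2]; exists (a, b) => /=.
  split=> [|y /andP[y1 y2]]; first by rewrite a2 b1.
  by apply: eP; rewrite /ball /= ltr_norml; lra.
have [lh hlh] := choice ex.
pose t := (k, (\row_l (lh l).1, \row_l (lh l).2)).
exists (pickle t); rewrite pickleK; split.
  by split=> // l; rewrite /= !mxE; case: (hlh l).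
move=> q [kq bq]; have /PU[r [kr Ur] rq] : [set y | forall l, P l (y 0 l)] (chart_map (ch k) q).
  by move=> l; case: (hlh l) => _; apply; have := bq l; rewrite /= !mxE.
by rewrite -(iM (ch k) r q) ?inE.
Qed.

Definition convex_rV d (U : set 'rV[R]_d) :=
  forall x y t, U x -> U y -> 0 <= t <= 1 -> U (x + t *: (y - x)).

(** The two sets cut the segment from x to y into relatively open and closed pieces. *)
Lemma convex_rV_clopen d (U A B : set 'rV[R]_d) : convex_rV U -> open A -> open B ->
  U `<=` A `|` B -> A `&` B = set0 -> forall x y, U x -> U y -> A x -> A y.
Proof.
move=> cU oA oB UAB AB x y Ux Uy Ax; apply: contrapT => nAy.
pose g := fun t : R => x + t *: (y - x).
have cg : continuous g.
  move=> t; apply: continuous_rV => l.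
  rewrite (_ : (fun s => g s 0 l) = (fun s => x 0 l + s * (y - x) 0 l)).
    by apply: cvgD; [exact: cvg_cst|apply: cvgM; [exact: cvg_id|exact: cvg_cst]].
  by rewrite funeqE => s; rewrite !mxE.
have Ug t : `[0, 1]%classic t -> U (g t) by move=> h; exact: cU.
have nA t : `[0, 1]%classic t -> ~ (g @^-1` B) t <-> (g @^-1` A) t.
  move=> /Ug /UAB /=; rewrite /preimage /= => ABt; split=> [nB|At Bt].
    by case: ABt.
  by have : (A `&` B) (g t) by []; rewrite AB.
have e : `[0, 1]%classic `&` g @^-1` A = `[(0:R), 1]%classic.
  apply: (@segment_connected R 0 1).
  - exists 0; split=> /=; first by rewrite in_itv /= lexx ler01.
    by rewrite /g scale0r addr0.
  - by exists (g @^-1` A) => //; apply: open_comp => // t _; exact: cg.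
  - exists (~` (g @^-1` B)).
      by apply: open_closedC; apply: open_comp => // t _; exact: cg.
    by apply/seteqP; split=> t [t1 /= h]; split=> //; apply/(nA t t1).
have : (`[0, 1]%classic `&` g @^-1` A) 1 by rewrite e /= in_itv /= lexx ler01.
by case=> _; rewrite /preimage /g /= scale1r addrC subrK.
Qed.

(** A clopen set is determined in each convex chart by whether it contains the common
    point p0. *)
Lemma mconnected_charts d (M : premanifold R d) (p0 : M) :
  inj_charts M -> (forall p : M, exists i, chart_dom i p) ->
  (forall i : chart M, chart_dom i p0) ->
  (forall i : chart M, convex_rV (chart_cod i)) -> mconnected M.
Proof.
move=> iM cM p0M vM.
have key (U : set M) : mopen U -> mopen (~` U) -> U p0 -> U = setT.
  move=> oU oU' Up0; apply/seteqP; split=> // p _.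
  have [i ip] := cM p.
  have : (chart_map i @` (chart_dom i `&` U)) (chart_map i p).
    apply: (convex_rV_clopen (vM i) (oU i) (oU' i)) (chart_map i p0) _ _ _ _.
    - move=> _ [q iq <-]; have [Uq|Uq] := pselect (U q).
        by left; exists q.
      by right; exists q.
    - apply/seteqP; split=> // _ [[q [iq Uq] <-] [r [ir Ur]]] /iM e.
      by apply: Ur; rewrite /= e ?inE.
    - by exists p0.
    - by exists p.
    - by exists p0.
  by move=> [q [iq Uq]] /iM <-; rewrite ?inE.
move=> U oU oU'; have [Up|Up] := pselect (U p0); first by right; exact: key.
left; rewrite -(setCK U) (key (~` U)) ?setCT // setCK //.
Qed.

Lemma one_chart_rep d (M : premanifold R d) (i0 : chart M) :
  (forall i : chart M, i = i0) -> chart_dom i0 = setT -> open (chart_cod i0) ->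
  forall i j : chart M, local_rep (fun p : M => p) i j (chart_cod i0) id.
Proof.
move=> ei dM oM i j; rewrite (ei i) (ei j); split=> // _ [p ip <-].
by exists p; rewrite dM.
Qed.

Lemma one_chart_manifold d (M : premanifold R d) (i0 : chart M) :
  (forall i : chart M, i = i0) -> chart_dom i0 = setT -> open (chart_cod i0) ->
  inj_charts M -> is_manifold M.
Proof.
move=> ei dM oM iM.
have sM : smooth_map (fun p : M => p).
  apply: local_rep_smooth => // i j p _ _; exists (chart_cod i0), id; split.
  - by exists p; rewrite ?dM // (ei i).
  - exact: one_chart_rep.
  - by move=> l; exact: smooth_on_coord.
split=> //.
- by move=> p; exists i0; rewrite dM.
- move=> p q pq.
  have [l] : exists l, chart_map i0 p 0 l != chart_map i0 q 0 l.
    apply: contrapT => h; apply: pq; apply: (iM i0); rewrite ?dM ?inE //.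
    by apply/rowP => l; apply/eqP; apply: contrapT => /negP hl; apply: h; exists l.
  have sep (r s : M) : chart_map i0 r 0 l < chart_map i0 s 0 l ->
      exists U V : set M, [/\ mopen U, mopen V, U r, V s & U `&` V = set0].
    apply: (separated_by_function (f := fun r => chart_map i0 r 0 l)
      (g := fun _ x => x 0 l)) => [i|i t _|i x _].
    - by rewrite (ei i).
    - by rewrite (ei i).
    - exact: coord_continuous.
  rewrite neq_lt => /orP[/sep //|/sep[U [V [oU oV Uq Vp UV]]]].
  by exists V, U; split=> //; rewrite setIC.
- by apply: (second_countable (ch := fun=> i0)) => // p; exists 0; rewrite dM.
Qed.

Lemma one_chart_dmap_id d (M : premanifold R d) (i0 : chart M) :
  (forall i : chart M, i = i0) -> chart_dom i0 = setT -> open (chart_cod i0) ->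
  inj_charts M -> forall (i j : chart M) x, chart_cod i0 x ->
  dmap (fun p : M => p) i j x = 1%:M.
Proof.
move=> ei dM oM iM i j _ [p _ <-]; rewrite (ei i).
rewrite (local_rep_dmap iM (one_chart_rep ei dM oM i0 j)) ?jac_id //.
by exists p; rewrite ?dM.
Qed.

End Atlases.

(** * The tangent bundle of a manifold with one affine chart *)

Section AffineChart.
Variables (R : realType) (n : nat) (M : dmfd R n) (i0 : chart M) (Theta : set 'rV[R]_n).
Hypothesis ei : forall i : chart M, i = i0.
Hypothesis dM : chart_dom i0 = setT.
Hypothesis iM : inj_charts M.
Hypothesis cM : chart_cod i0 = Theta.
Hypothesis oT : open Theta.
Hypothesis conn0 : forall x a b k, Theta x -> dconn i0 x a b k = 0.
Implicit Types (p : M) (u : tangent M) (y t : 'rV[R]_n) (z : 'rV[R]_(n + n)).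

Definition tube : set 'rV[R]_(n + n) := [set z | Theta (lsubmx z)].

Let oM : open (chart_cod i0). Proof. by rewrite cM. Qed.

Lemma chart_dom_all (i : chart M) p : chart_dom i p.
Proof. by rewrite (ei i) dM. Qed.

Lemma chart_mapT (i : chart M) p : Theta (chart_map i p).
Proof. by rewrite (ei i) -cM; exists p; rewrite ?dM. Qed.

Lemma chart_point y : Theta y -> exists p, chart_map i0 p = y.
Proof. by rewrite -cM => -[p _ <-]; exists p. Qed.

Lemma jac_transition (i j : chart M) x : Theta x -> jac (transition i j) x = 1%:M.
Proof. by rewrite -cM; exact: (one_chart_dmap_id ei dM oM iM i j). Qed.

(** With a single chart the compatibility condition only involves the identity
    transition, so every row of components is a tangent vector. *)
Lemma tvec_subproof p y : (fun _ : chart M => y) \in tcompat p.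
Proof.
apply/asboolP; split=> [i j _ _|i np]; last by case: np; exact: chart_dom_all.
by rewrite jac_transition ?mulmx1 //; exact: chart_mapT.
Qed.

Definition tvec p y : tspace p := TVec (tvec_subproof p y).

Lemma tspace_eq p (v w : tspace p) : tcomp v i0 = tcomp w i0 -> v = w.
Proof. by move=> vw; apply: val_inj; apply/funext => i; rewrite (ei i). Qed.

Lemma tcompD p (v w : tspace p) i : tcomp (v + w) i = tcomp v i + tcomp w i.
Proof. by have /(congr1 (fun f => f i)) := raddfD (\val : tspace p -> _) v w. Qed.

Lemma tcompZ p a (v : tspace p) i : tcomp (a *: v) i = a *: tcomp v i.
Proof. by have /(congr1 (fun f => f i)) := linearZ_LR (\val : tspace p -> _) a v. Qed.

Lemma tcomp_sum p I (r : seq I) (P : pred I) (v : I -> tspace p) i :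
  tcomp (\sum_(j <- r | P j) v j) i = \sum_(j <- r | P j) tcomp (v j) i.
Proof.
elim/big_rec2: _ => [|j y w _ <-]; last by rewrite tcompD.
by have /(congr1 (fun f => f i)) := raddf0 (\val : tspace p -> _).
Qed.

Definition tco u : 'rV[R]_(n + n) := @chart_map _ _ (tangent_mfd M) i0 u.

Lemma tcoE p (v : tspace p) : tco (existT _ p v) = row_mx (chart_map i0 p) (tcomp v i0).
Proof. by []. Qed.

Lemma tco_tube u : tube (tco u).
Proof. by case: u => p v; rewrite /tube /= tcoE row_mxKl; exact: chart_mapT. Qed.

Lemma tco_inj u u' : tco u = tco u' -> u = u'.
Proof.
case: u u' => p v [p' v']; rewrite !tcoE => /eq_row_mx[pp].
have : p = p' by apply: (iM (i := i0)) pp; rewrite inE dM.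
by move=> e; subst p' => /tspace_eq ->.
Qed.

Lemma tco_surj z : tube z -> exists u, tco u = z.
Proof.
move=> /chart_point[p pz]; exists (existT _ p (tvec p (rsubmx z))).
by rewrite tcoE pz /= hsubmxK.
Qed.

(** The frame is c times the coordinate frame of the affine chart, so that c will have
    to be the imaginary period of the map out of the tangent bundle. *)
Variable c : R.
Hypothesis c0 : c != 0.

Definition aframe : vframe M := fun k p => tvec p (c *: delta_mx 0 k).

Lemma tcomp_tcomb t p i : tcomp (tcomb aframe t p) i = c *: t.
Proof.
rewrite tcomp_sum; under eq_bigr do rewrite tcompZ.
rewrite [in RHS](row_sum_delta t) scaler_sumr; apply: eq_bigr => k _.
by rewrite /= scalerA mulrC -scalerA.
Qed.

Lemma tco_translation t u : tco (translation aframe t u) = tco u + row_mx 0 (c *: t).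
Proof.
case: u => p v; rewrite /translation !tcoE /= add_row_mx addr0.
by rewrite -(tcomp_tcomb t p i0) -tcompD.
Qed.

Definition alattice : set (tangent M) :=
  [set u | exists (p : M) (k : 'I_n -> int),
           u = existT _ p (tcomb aframe (\row_i (k i)%:~R) p)].

Lemma aframe_generator : generator alattice aframe.
Proof.
split=> // [k|p v].
- have inE' i x l : Theta x ->
      in_chart i (fun q => tcomp (aframe k q) i) x 0 l = (c *: delta_mx 0 k : 'rV[R]_n) 0 l.
    by move=> /chart_point[p <-]; rewrite -(ei i) in_chartE //; exact: chart_dom_all.
  split.
    move=> i l; rewrite (ei i) cM.
    refine (smooth_on_eq oT _ (smooth_on_cst ((c *: delta_mx 0 k : 'rV[R]_n) 0 l))).
    by move=> x; rewrite inE => Tx; rewrite inE'.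
  move=> i p _ a l /=; rewrite big1 => [|b _]; last first.
    by rewrite (ei i) conn0 ?mul0r //; exact: chart_mapT.
  rewrite addr0; set f := (fun y => _).
  rewrite /partial (derive_eq_on (g := fun=> (c *: delta_mx 0 k : 'rV[R]_n) 0 l) _ oT).
  - exact: derive_cst.
  - exact: chart_mapT.
  - by move=> x; rewrite inE => Tx; rewrite /f inE'.
- exists (c^-1 *: tcomp v i0); split.
    by apply: tspace_eq; rewrite tcomp_tcomb scalerA mulfV // scale1r.
  by move=> t ->; rewrite tcomp_tcomb scalerA mulVf // scale1r.
Qed.

Lemma tclass_int (k : 'I_n -> int) : tclass (\row_i (k i)%:~R : 'rV[R]_n) = 0.
Proof.
rewrite /tclass; have -> : (0 : torus R n) = (\pi_(torus R n) 0)%qT by rewrite pi_zeror.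
apply/eqP; rewrite -subr_eq0 -[_ - _]/(_ - _)%R; apply/eqP.
apply/eqP; rewrite subr_eq0; apply/eqP/eqquotP.
rewrite /= Quotient.equivE subr0; apply/forallP => i; rewrite mxE.
exact: intr_int.
Qed.

(** The group of the lattice is defined with all generators X. Another generator
    produces the same lattice points, hence the same orbit as the coordinate frame. *)
Lemma lattice_orbitE u : lattice_orbit alattice u =
  [set u' | exists k : 'I_n -> int, tco u' = tco u + row_mx 0 (c *: \row_i (k i)%:~R)].
Proof.
apply/seteqP; split=> [_ [_ [X [k [gX ->]]] <-]|u' [k uu']]; last first.
  exists (translation aframe (\row_i (k i)%:~R)).
    by exists aframe, k; split=> //; exact: aframe_generator.
  by apply: tco_inj; rewrite tco_translation.
case: gX => _ _ eL.
have : alattice (existT _ (projT1 u) (tcomb X (\row_i (k i)%:~R) (projT1 u))).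
  by rewrite eL; exists (projT1 u), k.
case=> p [k' e]; exists k'.
have /(congr1 tco) := e; rewrite !tcoE => /eq_row_mx[_]; rewrite tcomp_tcomb => ek.
by case: u e ek => q v e ek; rewrite /translation !tcoE add_row_mx addr0 tcompD ek.
Qed.

Local Notation L := alattice.

Lemma row_mx0_scaleD (s t : 'rV[R]_n) :
  row_mx 0 (c *: s) + row_mx 0 (c *: t) = row_mx (0 : 'rV[R]_n) (c *: (s + t)).
Proof. by rewrite add_row_mx addr0 scalerDr. Qed.

Lemma qmapP u u' : qmap L u = qmap L u' <->
  exists k : 'I_n -> int, tco u' = tco u + row_mx 0 (c *: \row_i (k i)%:~R).
Proof.
split=> [/(congr1 sval) /= e|[k uu']].
  have : lattice_orbit L u' u'.
    rewrite lattice_orbitE; exists (fun=> 0).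
    rewrite (_ : \row_i _ = 0) ?scaler0 ?row_mx0 ?addr0 //.
    by apply/rowP => i; rewrite !mxE.
  by rewrite -e lattice_orbitE.
apply: eq_exist; rewrite !lattice_orbitE; apply/seteqP; split=> w /= [k' e].
  exists (fun i => k' i - k i); rewrite e uu' -addrA row_mx0_scaleD.
  by congr (_ + row_mx _ (_ *: _)); apply/rowP => i; rewrite !mxE rmorphB /= addrC subrK.
exists (fun i => k i + k' i); rewrite e uu' -addrA row_mx0_scaleD.
by congr (_ + row_mx _ (_ *: _)); apply/rowP => i; rewrite !mxE rmorphD.
Qed.

Lemma qmap_qrepr (A : lattice_quot L) : qmap L (qrepr A) = A.
Proof.
case: A => A hA; rewrite /qrepr /qmap; case: cid => u /= e.
by apply: eq_exist; rewrite e.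
Qed.

Lemma qchart_map (s : qchart L) u : sheet s u ->
  @chart_map _ _ (quot_kmfd L) s (qmap L u) = tco u.
Proof.
move=> su /=; apply: xget_unique.
  by exists u => //; rewrite (ei (qch s)).
move=> _ [w [sw /= e] <-]; rewrite (ei (qch s)).
by rewrite (@sheet_inj _ _ _ _ s _ _ _ _ e) ?inE.
Qed.

Lemma quot_inj : inj_charts (quot_kmfd L).
Proof.
move=> s A B; rewrite !inE => -[u su <-] [w sw <-].
by rewrite (qchart_map su) (qchart_map sw) => /tco_inj ->.
Qed.

Lemma open_sheet (s : qchart L) : open (tco @` sheet s).
Proof.
have := @sheet_open _ _ _ _ s i0; congr open; apply/seteqP.
split=> [_ [u [_ su] <-]|_ [u su <-]]; exists u => //; split=> //.
exact: chart_dom_all.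
Qed.

(** The connection vanishes in the affine chart, so its connector is the second
    component of the coordinates. *)
Lemma splitting_affine i z : tube z -> @splitting R n M i z = 1%:M.
Proof.
move=> Tz; rewrite /splitting (_ : \matrix_(_, _) _ = 0) ?scalar_mx_block //.
apply/matrixP => a k; rewrite !mxE big1 // => b _.
by rewrite (ei i) conn0 ?mul0r.
Qed.

(** The affine coordinates turn Dombrowski's structure into the standard complex
    structure and the metric h + h, so a torification amounts to a map [E] from the
    tube over [Theta] onto the free orbits that is 4 pi-periodic and equivariant in the
    imaginary directions, injective modulo periods, a local diffeomorphism, and that
    pulls the tensors back correctly. *)
Section Uniformization.
Variables (N : kmfd R (n + n)) (Phi : torus R n -> N -> N) (E : 'rV[R]_(n + n) -> N).
Hypothesis iN : inj_charts N.
Hypothesis Phi0 : forall q, Phi 0 q = q.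
Hypothesis E_act : forall z t, tube z -> E (z + row_mx 0 (c *: t)) = Phi (tclass t) (E z).
Hypothesis E_inj : forall z z', tube z -> tube z' -> E z = E z' ->
  exists k : 'I_n -> int, z' = z + row_mx 0 (c *: \row_i (k i)%:~R).
Hypothesis E_free : forall z, tube z -> free_set Phi (E z).
Hypothesis E_surj : forall q, free_set Phi q -> exists2 z, tube z & E z = q.
Hypothesis E_fwd : forall j z, tube z -> chart_dom j (E z) -> exists W w,
  [/\ open W, W z, smooth_vec W w,
      forall z', W z' -> chart_dom j (E z') /\ chart_map j (E z') = w z' &
      let T := jac w z in
      block_mx (dmetric i0 (lsubmx z)) 0 0 (dmetric i0 (lsubmx z)) =
        T *m kmetric j (w z) *m T^T /\
      std_cplx R n *m T = T *m kcplx j (w z)].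
Hypothesis E_bwd : forall j z, tube z -> chart_dom j (E z) -> exists W l,
  [/\ open W, W (chart_map j (E z)), l (chart_map j (E z)) = z, smooth_vec W l &
      forall x, W x -> [/\ tube (l x), chart_dom j (E (l x)) & chart_map j (E (l x)) = x]].

Definition uniF (A : quot_kmfd L) : Defs.restrict (free_set Phi) :=
  exist _ (E (tco (qrepr A))) (E_free (tco_tube _)).

(** E is invariant under the periods, hence may be evaluated at any representative of
    the class instead of the one chosen by [qrepr]. *)
Lemma uniF_qmap u : sval (uniF (qmap L u)) = E (tco u).
Proof.
have /qmapP[k e] := qmap_qrepr (qmap L u).
by rewrite /= e E_act ?tclass_int ?Phi0 //; exact: tco_tube.
Qed.

Lemma uniF_inv_subproof (q : Defs.restrict (free_set Phi)) : exists u, E (tco u) = sval q.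
Proof.
by have [z /tco_surj[u <-] e] := E_surj (svalP q); exists u.
Qed.

Definition uniF_inv (q : Defs.restrict (free_set Phi)) : quot_kmfd L :=
  qmap L (projT1 (cid (uniF_inv_subproof q))).

Lemma uniF_invE (q : Defs.restrict (free_set Phi)) u : sval q = E (tco u) ->
  uniF_inv q = qmap L u.
Proof.
move=> e; rewrite /uniF_inv; case: cid => w /= ew; apply/qmapP.
by apply: E_inj; rewrite ?ew //; exact: tco_tube.
Qed.

Lemma uniF_rep (s : qchart L) (j : chart N) u : sheet s u -> chart_dom j (E (tco u)) ->
  exists W w,
  [/\ W (tco u), @local_rep R _ _ (quot_kmfd L) (Defs.restrict (free_set Phi)) uniF s j W w,
      smooth_vec W w & let T := jac w (tco u) in
      block_mx (dmetric i0 (lsubmx (tco u))) 0 0 (dmetric i0 (lsubmx (tco u))) =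
        T *m kmetric j (w (tco u)) *m T^T /\
      std_cplx R n *m T = T *m kcplx j (w (tco u))].
Proof.
move=> su ju; have [W [w [oW Wu sw hw hT]]] := E_fwd (tco_tube u) ju.
exists (W `&` tco @` sheet s), w; split=> //.
- split; first by apply: openI => //; exact: open_sheet.
  move=> x [Wx [v sv ex]] /=; exists (qmap L v); subst x.
  have := uniF_qmap v => /= ->; have [jv ev] := hw _ Wx; split=> //.
    by exists v.
  exact: qchart_map.
- by move=> l; apply: smooth_on_sub (sw l); exact: subIsetl.
Qed.

Lemma uniF_holo : holo_isometric uniF.
Proof.
split.
- apply: (local_rep_smooth quot_inj) => s j _ [u su <-]; rewrite [chart_dom _ _]/= => ju.
  have {}ju : @chart_dom _ _ N j (E (tco u)) by rewrite -uniF_qmap.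
  have [W [w [Wu rw sw _]]] := uniF_rep su ju.
  by exists W, w; split=> //; rewrite (qchart_map su).
- move=> s j _ [u su <-]; rewrite [chart_dom _ _]/= => ju.
  have {}ju : @chart_dom _ _ N j (E (tco u)) by rewrite -uniF_qmap.
  have [W [w [Wu rw sw [hT _]]]] := uniF_rep su ju.
  rewrite (qchart_map su) -(qchart_map su) (local_rep_dmap quot_inj rw) ?(qchart_map su) //.
  have [_ hw] := rw; have [A [sA eA jA e]] := hw _ Wu.
  have -> : qmap L u = A.
    apply: (quot_inj (i := s)); rewrite ?inE //; first by exists u.
    by rewrite (qchart_map su) -eA.
  rewrite e /= -hT /= splitting_affine; last exact: tco_tube.
  by rewrite mul1mx trmx1 mulmx1 (ei (qch s)).
- move=> s j _ [u su <-]; rewrite [chart_dom _ _]/= => ju.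
  have {}ju : @chart_dom _ _ N j (E (tco u)) by rewrite -uniF_qmap.
  have [W [w [Wu rw sw [_ hT]]]] := uniF_rep su ju.
  rewrite (qchart_map su) -(qchart_map su) (local_rep_dmap quot_inj rw) ?(qchart_map su) //.
  have [_ hw] := rw; have [A [sA eA jA e]] := hw _ Wu.
  have -> : qmap L u = A.
    apply: (quot_inj (i := s)); rewrite ?inE //; first by exists u.
    by rewrite (qchart_map su) -eA.
  rewrite e /= -hT splitting_affine; last exact: tco_tube.
  by rewrite mul1mx invmx1 mulmx1.
Qed.

Lemma restrict_inj (A : set N) : inj_charts (Defs.restrict A).
Proof.
move=> j [p Ap] [q Aq]; rewrite !inE /= => jp jq e.
by apply: eq_exist; apply: (iN (i := j)); rewrite ?inE.
Qed.

Lemma uniF_inv_smooth : smooth_map uniF_inv.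
Proof.
apply: (local_rep_smooth (@restrict_inj _)) => j s q jq [u su euq].
have eu : sval q = E (tco u).
  have [w ew] := uniF_inv_subproof q; rewrite -ew.
  have /esym := uniF_invE (esym ew); rewrite -euq => /qmapP[k ->].
  by rewrite E_act ?tclass_int ?Phi0 //; exact: tco_tube.
have ju : @chart_dom _ _ N j (E (tco u)) by rewrite -eu.
have [W [l [oW Wu lu sl hl]]] := E_bwd (tco_tube u) ju.
exists (W `&` l @^-1` (tco @` sheet s)), l; split.
- by rewrite /= eu; split=> //; rewrite /preimage /= lu; exists u.
- split.
    apply: open_inter_preim => //; last exact: open_sheet.
    by move=> x Wx; exact: smooth_vec_cont sl Wx.
  move=> x [Wx [v sv ev]]; have [Tl jl el] := hl x Wx.
  pose q' : Defs.restrict (free_set Phi) := exist _ (E (l x)) (E_free Tl).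
  have eq' : uniF_inv q' = qmap L v by apply: uniF_invE; rewrite /= ev.
  exists q'; rewrite eq'; split=> //; first by exists v.
  by rewrite (qchart_map sv).
- by move=> k; apply: smooth_on_sub (sl k); exact: subIsetl.
Qed.

Lemma uniformization : exists (L : set (tangent M)) (X : vframe M)
    (F : quot_kmfd L -> Defs.restrict (free_set Phi)),
  [/\ parallel_lattice L, generator L X, holo_isometric_diffeo F
    & forall a A, sval (F (lattice_action X a A)) = Phi a (sval (F A))].
Proof.
exists L, aframe, uniF; split.
- by exists aframe; exact: aframe_generator.
- exact: aframe_generator.
- split; first exact: uniF_holo.
  exists uniF_inv; split; last exact: uniF_inv_smooth.
    by move=> A; rewrite (uniF_invE (u := qrepr A)) // qmap_qrepr.
  move=> q; have [u eu] := uniF_inv_subproof q.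
  rewrite (uniF_invE (esym eu)); have := uniF_qmap u; rewrite eu.
  by case: q eu (uniF (qmap L u)) => q fq eu [q' fq'] /= qq'; exact: eq_exist.
- move=> a A; rewrite uniF_qmap tco_translation E_act; last exact: tco_tube.
  by rewrite /tclass reprK.
Qed.

End Uniformization.

End AffineChart.

(** * Dually flat structures in affine coordinates *)

Section DuallyFlatChart.
Variable R : realType.

(** All that the proof uses of the dually flat manifold besides its metric: global
    coordinates in which the connection is the ordinary derivative. *)
Record affine_chart n (M : dmfd R n) (i0 : chart M) (Theta : set 'rV[R]_n) : Prop :=
  AffineChart {
    ac_unique : forall i : chart M, i = i0;
    ac_dom : chart_dom i0 = setT;
    ac_inj : inj_charts M;
    ac_cod : chart_cod i0 = Theta;
    ac_open : open Theta;
    ac_convex : convex_rV Theta;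
    ac_conn : forall x a b k, Theta x -> dconn i0 x a b k = 0 }.

Section AnyDimension.
Variables (n : nat) (M : dmfd R n) (i0 : chart M) (Theta : set 'rV[R]_n).
Hypothesis aM : affine_chart i0 Theta.

Let oM : open (chart_cod i0). Proof. by rewrite (ac_cod aM); exact: ac_open aM. Qed.

Lemma affine_mconnected : Theta !=set0 -> mconnected M.
Proof.
move=> [x]; rewrite -(ac_cod aM) => -[p0 _ _].
apply: (mconnected_charts (p0 := p0) (ac_inj aM)) => [p|i|i].
- by exists i0; rewrite (ac_dom aM).
- by rewrite (ac_unique aM i) (ac_dom aM).
- by rewrite (ac_unique aM i) (ac_cod aM); exact: ac_convex aM.
Qed.

(** Christoffel symbols only transform trivially, the transition map being the
    identity. *)
Lemma affine_connection (G : christoffel M) :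
  (forall a b k, smooth_on Theta (fun x => G i0 x a b k)) -> is_connection G.
Proof.
move=> sG; split=> [i a b k|i j p _ _ a b k].
  by rewrite (ac_unique aM i) (ac_cod aM).
rewrite (ac_unique aM i) (ac_unique aM j) /=; set x := chart_map i0 p.
have Tx : Theta x by rewrite -(ac_cod aM); exists p; rewrite ?(ac_dom aM).
have jT y : Theta y -> jac (transition i0 i0) y = 1%:M.
  by apply: (jac_transition (@ac_unique _ _ _ _ aM) (ac_dom aM) (ac_inj aM) (ac_cod aM) (ac_open aM)).
rewrite jT // (bigD1 k) //= big1 ?addr0 => [|c ck]; last by rewrite mxE (negPf ck) mulr0.
rewrite mxE eqxx mulr1.
have -> : partial a (partial b (fun y => transition i0 i0 y 0 k)) x = 0.
  rewrite {1}/partial (derive_eq_on (g := fun=> (b == k)%:R) _ (ac_open aM) Tx).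
    exact: derive_cst.
  by move=> y; rewrite inE => /jT /matrixP/(_ b k); rewrite !mxE.
rewrite add0r (bigD1 a) //= (bigD1 b) //= !mxE !eqxx !mulr1 big1 ?addr0 => [|e eb].
  rewrite big1 ?addr0 // => c ca; rewrite big1 // => e _.
  by rewrite !mxE [a == c]eq_sym (negPf ca) mulr0 mul0r.
by rewrite !mxE [b == e]eq_sym (negPf eb) mulr0.
Qed.

(** The dual connection is supplied by its Christoffel symbols [G'] in the affine
    chart: as those of the connection vanish, duality says that G' is the derivative
    of the metric with one index raised. *)
Lemma affine_dually_flat (H : 'rV[R]_n -> 'M[R]_n)
    (G' : 'rV[R]_n -> 'I_n -> 'I_n -> 'I_n -> R) :
  (forall x, Theta x -> dmetric i0 x = H x) -> smooth_mx Theta H ->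
  (forall x, Theta x -> (H x)^T = H x) ->
  (forall x (v : 'rV[R]_n), Theta x -> v != 0 -> 0 < (v *m H x *m v^T) 0 0) ->
  (forall a b k, smooth_on Theta (fun x => G' x a b k)) ->
  (forall x a b c, Theta x ->
     partial a (fun y => H y b c) x = \sum_e H x b e * G' x a c e) ->
  (forall x a b k, Theta x -> G' x a b k = G' x b a k) ->
  (forall x a b c k, Theta x -> curvature G' x a b c k = 0) ->
  is_dually_flat M.
Proof.
move=> eH sH symH posH sG' dual tG' cG'; have oT := ac_open aM.
have eH' b c : {in Theta, (fun y => H y b c) =1 (fun y => dmetric i0 y b c)}.
  by move=> y; rewrite inE => Ty; rewrite eH.
split.
- exact: one_chart_manifold (ac_unique aM) (ac_dom aM) oM (ac_inj aM).
- split.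
  + move=> i b c; rewrite (ac_unique aM i) (ac_cod aM).
    by refine (smooth_on_eq oT _ (sH b c)); exact: eH'.
  + move=> i j p _ _ /=.
    rewrite (one_chart_dmap_id (ac_unique aM) (ac_dom aM) oM (ac_inj aM)); last first.
      by exists p; rewrite ?(ac_dom aM) // (ac_unique aM i).
    by rewrite mul1mx trmx1 mulmx1 (ac_unique aM i) (ac_unique aM j).
  + move=> i x; rewrite (ac_unique aM i) (ac_cod aM) => Tx; rewrite eH // symH //.
    by split=> // v v0; exact: posH.
- apply: affine_connection => a b k.
  refine (smooth_on_eq oT _ (smooth_on_cst 0)) => x; rewrite inE => Tx.
  by rewrite (ac_conn aM).
- move=> i x; rewrite (ac_unique aM i) (ac_cod aM) => Tx; split=> [a b k|a b c k].
    by rewrite /torsion !(ac_conn aM) ?subrr.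
  have z a' b' : partial a' (fun y => dconn i0 y b' c k) x = 0.
    rewrite /partial (derive_eq_on (g := fun=> 0) _ oT Tx); first exact: derive_cst.
    by move=> y; rewrite inE => Ty; rewrite (ac_conn aM).
  rewrite /curvature !z subr0 add0r big1 // => e _.
  by rewrite !(ac_conn aM _ _ _ Tx) !mul0r subrr.
- exists (fun _ => G'); split.
  + exact: affine_connection.
  + move=> i x; rewrite (ac_unique aM i) (ac_cod aM) => Tx a b c.
    rewrite [X in _ = X + _]big1 ?add0r => [|e _]; last by rewrite (ac_conn aM) ?mul0r.
    rewrite eH // -dual // /partial.
    by refine (derive_eq_on _ oT Tx _) => y Ty; rewrite eH'.
  + move=> i x; rewrite (ac_unique aM i) (ac_cod aM) => Tx; split=> [a b k|a b c k].
      by rewrite /torsion tG' ?subrr.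
    exact: cG'.
Qed.

End AnyDimension.

(** In dimension one every connection is flat. *)
Lemma affine_dually_flat1 (M : dmfd R 1) (i0 : chart M) (Theta : set 'rV[R]_1)
    (h : 'rV[R]_1 -> R) :
  affine_chart i0 Theta -> (forall x, Theta x -> dmetric i0 x = (h x)%:M) ->
  smooth_on Theta h -> (forall x, Theta x -> 0 < h x) -> is_dually_flat M.
Proof.
move=> aM eh sh h0; have oT := ac_open aM.
have hE b c : (fun y => ((h y)%:M : 'M[R]_1) b c) = h.
  by rewrite funeqE => y; rewrite !ord1 mxE eqxx.
have h0' x : Theta x -> h x != 0 by move=> /h0; rewrite lt0r => /andP[].
apply: (affine_dually_flat aM (H := fun x => (h x)%:M)
  (G' := fun x _ _ _ => partial 0 h x * (h x)^-1)) => //.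
- by move=> b c; rewrite hE.
- by move=> x _; rewrite tr_scalar_mx.
- move=> x v Tx v0; rewrite !mxE big_ord1 !mxE big_ord1 !mxE eqxx /=.
  rewrite mulrAC -expr2 mulr_gt0 ?h0 // exprn_even_gt0 //=.
  by apply: contra v0 => /eqP v00; apply/eqP/rowP => k; rewrite ord1 v00 mxE.
- move=> _ _ _; exact: smooth_onM oT (smooth_on_partial _ sh) (smooth_onV oT h0' sh).
- move=> x a b c Tx; rewrite hE big_ord1 !ord1 mxE eqxx mulr1n.
  by rewrite mulrC mulfVK // h0'.
- by move=> x a b c k Tx; rewrite /curvature !ord1 subrr add0r big1 // => e _; rewrite subrr.
Qed.

End DuallyFlatChart.

(** * The covariance metric of the multinomial families *)

Section Softmax.
Variables (R : realType) (n : nat).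
Implicit Types (x v : 'rV[R]_n) (i j k : 'I_n).

Definition partition_fun x : R := 1 + \sum_i expR (x 0 i).
Definition softmax x i : R := expR (x 0 i) / partition_fun x.

Lemma partition_fun_gt0 x : 0 < partition_fun x.
Proof. by rewrite ltr_pwDl // sumr_ge0 // => i _; exact: expR_ge0. Qed.

Lemma partition_fun_neq0 x : partition_fun x != 0.
Proof. by rewrite lt0r_neq0 ?partition_fun_gt0. Qed.

Lemma softmax_gt0 x i : 0 < softmax x i.
Proof. by rewrite divr_gt0 ?expR_gt0 ?partition_fun_gt0. Qed.

Lemma softmax_sum x : (partition_fun x)^-1 + \sum_i softmax x i = 1.
Proof.
rewrite /softmax -mulr_suml -{1}[_^-1]mul1r -mulrDl.
by rewrite divff ?partition_fun_neq0.
Qed.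

Lemma is_derive_exp_coord x a i :
  is_derive x (delta_mx 0 a) (fun y : 'rV[R]_n => expR (y 0 i)) (expR (x 0 i) * (i == a)%:R).
Proof.
have := is_derive_comp1 (is_derive_coord i x (delta_mx 0 a)) (is_derive_expR (x 0 i)).
by rewrite mxE eqxx.
Qed.

Lemma is_derive_partition_fun x a :
  is_derive x (delta_mx 0 a) partition_fun (expR (x 0 a)).
Proof.
have h : is_derive x (delta_mx 0 a) (fun y : 'rV[R]_n => \sum_i expR (y 0 i))
    (\sum_i expR (x 0 i) * (i == a)%:R).
  have := is_derive_sum (fun i => is_derive_exp_coord x a i).
  by congr (is_derive _ _ _ _); rewrite funeqE => y; rewrite fct_sumE.
rewrite (_ : partition_fun = cst 1 + (fun y => \sum_i expR (y 0 i))) //.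
apply: (is_derive_eq (is_deriveD (is_derive_cst (1 : R) x (delta_mx 0 a)) h)).
rewrite add0r (bigD1 a) //= eqxx mulr1 big1 ?addr0 // => i /negPf ->.
by rewrite mulr0.
Qed.

Lemma is_derive_softmax x a i : is_derive x (delta_mx 0 a) (softmax^~ i)
  (softmax x i * ((i == a)%:R - softmax x a)).
Proof.
have [d1 d2] := is_derive_partition_fun x a.
have hi : is_derive x (delta_mx 0 a) (fun y => (partition_fun y)^-1)
    (- (partition_fun x) ^- 2 * expR (x 0 a)).
  split; first by apply: derivableV => //; exact: partition_fun_neq0.
  by rewrite (@deriveV _ _ partition_fun) ?partition_fun_neq0 // d2.
apply: (is_derive_eq (is_deriveM (is_derive_exp_coord x a i) hi)).
rewrite /softmax /GRing.scale /=; have := partition_fun_neq0 x.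
by move: (partition_fun x) => s s0; field.
Qed.

Lemma smooth_partition_fun : smooth_on setT partition_fun.
Proof.
have oT : open [set: 'rV[R]_n] := openT.
refine (smooth_onD oT (smooth_on_cst 1) _); apply: smooth_on_sum => // i.
exact: (smooth_on_expR oT (@smooth_on_coord R n setT i)).
Qed.

Lemma smooth_softmax i : smooth_on setT (softmax^~ i).
Proof.
have oT : open [set: 'rV[R]_n] := openT.
refine (smooth_onM oT (smooth_on_expR oT (@smooth_on_coord R n setT i)) _).
by apply: (smooth_onV oT) smooth_partition_fun => x _; exact: partition_fun_neq0.
Qed.

Definition softmax_cov x : 'M[R]_n :=
  \matrix_(i, j) (softmax x i * ((i == j)%:R - softmax x j)).

(** The variance of a random variable with value v_i with probability p_i and 0 with
    the remaining probability, as a sum of squares around the mean. *)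
Lemma softmax_cov_pos x v : v != 0 -> 0 < (v *m softmax_cov x *m v^T) 0 0.
Proof.
move=> v0; pose m := \sum_i softmax x i * v 0 i.
have -> : (v *m softmax_cov x *m v^T) 0 0 =
    (partition_fun x)^-1 * m ^+ 2 + \sum_i softmax x i * (v 0 i - m) ^+ 2.
  have -> : \sum_i softmax x i * (v 0 i - m) ^+ 2 =
      \sum_i softmax x i * v 0 i ^+ 2 - 2 * m * m + m ^+ 2 * \sum_i softmax x i.
    have -> : 2 * m * m = \sum_i 2 * m * (softmax x i * v 0 i) by rewrite -mulr_sumr.
    rewrite [m ^+ 2 * _]mulr_sumr -sumrB -big_split /=; apply: eq_bigr => i _; ring.
  have -> : (v *m softmax_cov x *m v^T) 0 0 = \sum_i softmax x i * v 0 i ^+ 2 - m * m.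
    rewrite mxE /m mulr_suml -sumrB.
    under eq_bigr do rewrite !mxE mulr_suml.
    rewrite exchange_big /=; apply: eq_bigr => i _.
    under eq_bigr do rewrite !mxE.
    rewrite (eq_bigr (fun j => v 0 i * softmax x i * (i == j)%:R * v 0 j
        - v 0 i * softmax x i * (softmax x j * v 0 j))); last by move=> j _; ring.
    rewrite sumrB -mulr_sumr -/m; congr (_ - _); last by ring.
    rewrite (bigD1 i) //= eqxx big1 ?addr0 => [|j /negPf ji]; first by rewrite /=; ring.
    by rewrite eq_sym ji mulr0 mul0r.
  have -> : \sum_i softmax x i = 1 - (partition_fun x)^-1 by rewrite -(softmax_sum x); ring.
  by ring.
have s0 : 0 <= \sum_i softmax x i * (v 0 i - m) ^+ 2.
  by apply: sumr_ge0 => i _; rewrite mulr_ge0 ?sqr_ge0 // ltW ?softmax_gt0.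
have [m0|m0] := eqVneq m 0; last first.
  by rewrite ltr_pwDl // mulr_gt0 ?invr_gt0 ?partition_fun_gt0 // exprn_even_gt0.
rewrite m0 expr0n /= mulr0 add0r lt0r.
rewrite m0 in s0; rewrite s0 andbT; apply: contra v0 => /eqP s00.
apply/eqP/rowP => i; rewrite mxE.
have := psumr_eq0P (fun i _ => _) s00 => /(_ _ i isT) h.
have /eqP : softmax x i * (v 0 i - 0) ^+ 2 = 0.
  by apply: h => j; rewrite mulr_ge0 ?sqr_ge0 // ltW ?softmax_gt0.
by rewrite mulf_eq0 gt_eqF ?softmax_gt0 //= subr0 sqrf_eq0 => /eqP.
Qed.

Lemma sum_delta_mull (F : 'I_n -> R) k : \sum_e (e == k)%:R * F e = F k.
Proof.
rewrite (bigD1 k) //= eqxx mul1r big1 ?addr0 // => e /negPf ->.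
by rewrite mul0r.
Qed.

(** The Christoffel symbols, in the natural parameters, of the connection whose affine
    coordinates are the expectations p_i. *)
Definition softmax_dual x a b k : R :=
  (k == a)%:R * ((k == b)%:R - softmax x b) - softmax x a * (k == b)%:R.

Lemma partial_softmax_cov x a b c : partial a (fun y => softmax_cov y b c) x =
  \sum_e softmax_cov x b e * softmax_dual x a c e.
Proof.
have hb := is_derive_softmax x a b; have hc := is_derive_softmax x a c.
have hd : is_derive x (delta_mx 0 a) (fun y => softmax_cov y b c)
   (softmax x b * (0 - softmax x c * ((c == a)%:R - softmax x a)) +
    ((b == c)%:R - softmax x c) * (softmax x b * ((b == a)%:R - softmax x a))).
  rewrite (_ : (fun y => softmax_cov y b c) =
    (softmax^~ b) * (cst (b == c)%:R - softmax^~ c)); last first.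
    by rewrite funeqE => y; rewrite mxE.
  by apply: (is_derive_eq (is_deriveM hb (is_deriveB (is_derive_cst _ _ _) hc))).
rewrite /partial; have [_ ->] := hd.
rewrite (eq_bigr (fun e => (e == a)%:R * (softmax_cov x b e * ((e == c)%:R - softmax x c))
   - (e == c)%:R * (softmax_cov x b e * softmax x a))); last first.
  by move=> e _; rewrite /softmax_dual; ring.
rewrite sumrB !sum_delta_mull !mxE [a == c]eq_sym.
have [->|ca] := eqVneq c a; have [ba|ba] := eqVneq b a; rewrite ?ba ?eqxx ?(negPf ca) /=.
- by ring.
- by ring.
- by rewrite [a == c]eq_sym (negPf ca) /=; ring.
- by ring.
Qed.

Lemma softmax_dual_sym x a b k : softmax_dual x a b k = softmax_dual x b a k.
Proof. by rewrite /softmax_dual; ring. Qed.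

Lemma partial_softmax_dual x d a b k : partial d (fun y => softmax_dual y a b k) x =
  - (k == a)%:R * softmax_cov x b d - softmax_cov x a d * (k == b)%:R.
Proof.
have hb := is_derive_softmax x d b; have ha := is_derive_softmax x d a.
have hd : is_derive x (delta_mx 0 d) (fun y => softmax_dual y a b k)
   ((k == a)%:R * (0 - softmax x b * ((b == d)%:R - softmax x d)) -
    (k == b)%:R * (softmax x a * ((a == d)%:R - softmax x d))).
  rewrite (_ : (fun y => softmax_dual y a b k) =
    ((k == a)%:R \*: (cst (k == b)%:R - softmax^~ b)) - ((k == b)%:R \*: softmax^~ a)); last first.
    by rewrite funeqE => y; rewrite /softmax_dual [softmax y a * _]mulrC.
  by apply: (is_derive_eq (is_deriveB (is_deriveZ _ (is_deriveB (is_derive_cst _ _ _) hb)) (is_deriveZ _ ha))).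
by rewrite /partial; have [_ ->] := hd; rewrite !mxE; ring.
Qed.

(** Both quadratic terms of the curvature reduce to sums over Kronecker symbols; what
    remains cancels because (p_i - p_j) delta_ij = 0. *)
Lemma softmax_dual_flat x a b c k : curvature softmax_dual x a b c k = 0.
Proof.
rewrite /curvature !partial_softmax_dual.
have quad (d e : 'I_n) : \sum_f softmax_dual x d f k * softmax_dual x e c f =
    (k == d)%:R * softmax_dual x e c k - (k == d)%:R * (\sum_f softmax x f * softmax_dual x e c f)
    - softmax x d * softmax_dual x e c k.
  rewrite mulr_sumr (eq_bigr (fun f => (f == k)%:R * ((k == d)%:R * softmax_dual x e c f
     - softmax x d * softmax_dual x e c f) - (k == d)%:R * (softmax x f * softmax_dual x e c f))).
    by rewrite sumrB sum_delta_mull; ring.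
  by move=> f _; rewrite {1}/softmax_dual [k == f]eq_sym; ring.
have mean (e : 'I_n) : \sum_f softmax x f * softmax_dual x e c f =
    softmax x e * ((e == c)%:R - softmax x c) - softmax x e * softmax x c.
  rewrite (eq_bigr (fun f => (f == e)%:R * (softmax x f * ((f == c)%:R - softmax x c))
     - (f == c)%:R * (softmax x f * softmax x e))); last by move=> f _; rewrite /softmax_dual; ring.
  by rewrite sumrB !sum_delta_mull; ring.
rewrite sumrB !quad !mean /softmax_dual !mxE.
rewrite [c == a]eq_sym [c == b]eq_sym.
have sw (i j : 'I_n) : (softmax x i - softmax x j) * (i == j)%:R = 0.
  by have [->|ij] := eqVneq i j; rewrite /= ?subrr ?mul0r ?mulr0.
have [ka|ka] := eqVneq k a; [subst a|].
  have [kb|kb] := eqVneq k b; [by subst b; ring|].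
  by rewrite -[RHS]oppr0 -(sw b c) /=; ring.
have [kb|kb] := eqVneq k b; [subst b|].
  by rewrite -(sw a c) ?[a == k]eq_sym ?(negPf ka) /=; ring.
transitivity ((softmax x a * (a == b)%:R - softmax x b * (b == a)%:R) * (k == c)%:R); first by rewrite /=; ring.
by rewrite [b == a]eq_sym -mulrBl sw mul0r.
Qed.

Lemma affine_dually_flat_softmax (M : dmfd R n) (i0 : chart M) (N : R) : 0 < N ->
  affine_chart i0 setT -> (forall x, dmetric i0 x = N *: softmax_cov x) ->
  is_dually_flat M.
Proof.
move=> N0 aM eH; have oT : open [set: 'rV[R]_n] := openT.
have scov b c : smooth_on setT (fun x => softmax_cov x b c).
  refine (smooth_on_eq oT _ (smooth_onM oT (smooth_softmax b)
    (smooth_onB oT (smooth_on_cst (b == c)%:R) (smooth_softmax c)))).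
  by move=> x _; rewrite mxE.
apply: (affine_dually_flat aM (H := fun x => N *: softmax_cov x) (G' := softmax_dual)) => //.
- move=> b c; refine (smooth_on_eq oT _ (smooth_onM oT (smooth_on_cst N) (scov b c))).
  by move=> x _; rewrite [RHS]mxE.
- move=> x _; apply/matrixP => b c; rewrite !mxE [c == b]eq_sym.
  by have [->//|bc] := eqVneq b c; rewrite /=; ring.
- move=> x v _ v0; rewrite -scalemxAr -scalemxAl mxE mulr_gt0 //.
  exact: softmax_cov_pos.
- move=> a b k; refine (smooth_onB oT (smooth_onM oT (smooth_on_cst _)
    (smooth_onB oT (smooth_on_cst _) (smooth_softmax b)))
    (smooth_onM oT (smooth_softmax a) (smooth_on_cst _))).
- move=> x a b c _; under eq_bigr do rewrite mxE -mulrA.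
  rewrite -mulr_sumr -partial_softmax_cov /partial.
  rewrite (_ : (fun y => _) = N \*: (fun y => softmax_cov y b c)); last first.
    by rewrite funeqE => y; rewrite mxE.
  by rewrite deriveZ //; exact: smooth_on_der (scov b c) _.
- by move=> x a b k _; exact: softmax_dual_sym.
- by move=> x a b c k _; exact: softmax_dual_flat.
Qed.

End Softmax.

(** * Phases and the exponential coordinates *)

Section Phases.
Variable R : realType.
Local Notation C := (R[i]).
Local Notation phase := (@phase R).

Lemma Complex_eq (z w : C) : complex.Re z = complex.Re w -> complex.Im z = complex.Im w -> z = w.
Proof. by case: z w => a b [c d] /= -> ->. Qed.

Lemma nrm2_phase s : nrm2 (phase s) = 1.
Proof. by rewrite /nrm2 /= cos2Dsin2. Qed.

Lemma phase_neq0 s : phase s != 0.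
Proof. by rewrite -nrm2_eq0 nrm2_phase oner_eq0. Qed.

Lemma phaseD s t : phase (s + t) = phase s * phase t.
Proof.
apply: Complex_eq; rewrite ?ReM ?ImM /= mulrDr ?cosD ?sinD //.
by rewrite addrC.
Qed.

Lemma phase0 : phase 0 = 1.
Proof. by apply: Complex_eq; rewrite /= mulr0 ?cos0 ?sin0. Qed.

Lemma phaseN s : phase (- s) = (phase s)^-1.
Proof.
apply: (mulfI (phase_neq0 s)); rewrite mulfV ?phase_neq0 //.
by rewrite -phaseD subrr phase0.
Qed.

Lemma phase1 : phase 1 = 1.
Proof. by apply: Complex_eq; rewrite /= mulr1 mulr_natl ?cos2pi ?sin2pi. Qed.

Lemma phase_int (k : int) : phase k%:~R = 1.
Proof.
have nat_case n : phase n%:R = 1.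
  by elim: n => [|n IH]; rewrite ?phase0 // -natr1 phaseD IH phase1 mulr1.
by case: k => n; rewrite ?NegzE ?mulrNz ?phaseN -pmulrn nat_case ?invr1.
Qed.

(** Halving the angle turns [cos = 1] into a zero of the sine in the open interval
    from 0 to pi. *)
Lemma phase_eq1 s : phase s = 1 -> s \is a Num.int.
Proof.
pose f := s - (Num.floor s)%:~R; move=> ps.
have pf : phase f = 1 by rewrite /f phaseD ps mul1r -mulrNz phase_int.
have /andP[f0 f1] : 0 <= f < 1.
  by have := floor_itv s; rewrite intrD /f => /andP[? ?]; apply/andP; split; lra.
have [f00|fn0] := eqVneq f 0.
  by move/eqP: f00; rewrite subr_eq0 => /eqP ->; exact: intr_int.
have : 0 < sin (pi * f).
  apply: sin_gt0_pi; rewrite mulr_gt0 ?pi_gt0 ?lt0r ?fn0 //=.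
  by rewrite gtr_pMr ?pi_gt0.
have /(congr1 (@complex.Re R)) /= := pf.
rewrite (_ : 2 * pi * f = (pi * f) *+ 2) ?cos_mulr2n; last by rewrite -mulrA mulr_natl.
rewrite cos2sin2 => h s0; have : sin (pi * f) ^+ 2 = 0 by move: h; rewrite mulr2n; lra.
by move/eqP; rewrite sqrf_eq0 gt_eqF.
Qed.

(** The arc cosine gives the angle up to sign, which the imaginary part decides. *)
Lemma phase_surj (w : C) : nrm2 w = 1 -> exists s, w = phase s.
Proof.
case: w => a b; rewrite /nrm2 /= => h.
have a1 : -1 <= a <= 1 by apply/andP; split; nra.
have p0 : (pi : R) != 0 by rewrite gt_eqF ?pi_gt0.
have e (s : R) : 2 * pi * (s / (2 * pi)) = s by rewrite mulrC divfK // mulf_neq0 ?pnatr_eq0.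
have sb : sin (acos a) = `|b|.
  by rewrite sin_acos // -sqrtr_sqr; congr (Num.sqrt _); lra.
have [b0|b0] := leP 0 b.
  exists (acos a / (2 * pi)); apply: Complex_eq; rewrite /= e ?acosK ?in_itv //=.
  by rewrite sb ger0_norm.
exists (- acos a / (2 * pi)); apply: Complex_eq; rewrite /= e ?cosN ?acosK ?in_itv //=.
by rewrite sinN sb ltr0_norm // opprK.
Qed.

Lemma repr_tclass n (t : 'rV[R]_n) : repr (tclass t) - t \in @int_lattice R n.
Proof.
have : (\pi_(torus R n) (repr (tclass t)) = \pi_(torus R n) t)%qT by rewrite reprK.
by move/eqquotP; rewrite /= Quotient.equivE.
Qed.

Lemma phase_repr n (t : 'rV[R]_n) i : phase (repr (tclass t) 0 i) = phase (t 0 i).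
Proof.
have /forallP/(_ i) := repr_tclass t; rewrite !mxE => /intrP[k e].
have -> : repr (tclass t) 0 i = k%:~R + t 0 i by rewrite -e subrK.
by rewrite phaseD phase_int mul1r.
Qed.

Lemma torus_eq0 n (a : torus R n) : (forall i, phase (repr a 0 i) = 1) -> a = 0.
Proof.
move=> h; rewrite -[a]reprK; have -> : (0 : torus R n) = (\pi_(torus R n) 0)%qT by rewrite pi_zeror.
apply/eqquotP; rewrite /= Quotient.equivE subr0; apply/forallP => i.
exact: phase_eq1.
Qed.

Lemma phase_repr0 n i : phase (repr (0 : torus R n) 0 i) = 1.
Proof.
have -> : (0 : torus R n) = tclass 0 by rewrite /tclass pi_zeror.
by rewrite phase_repr mxE phase0.
Qed.

Lemma phase_reprD n (a b : torus R n) i :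
  phase (repr (a + b) 0 i) = phase (repr a 0 i) * phase (repr b 0 i).
Proof.
have -> : a + b = tclass (repr a + repr b) by rewrite /tclass pi_addr !reprK.
by rewrite phase_repr mxE phaseD.
Qed.

Lemma csmooth_phase d (U : set 'rV[R]_d) f : open U -> smooth_on U f ->
  csmooth U (fun x => phase (f x)).
Proof.
move=> oU sf; have s2 := smooth_onM oU (smooth_on_cst (2 * pi)) sf.
by split; [exact: smooth_on_cos oU s2|exact: smooth_on_sin oU s2].
Qed.

(** The exponential exp ((x + i y) / 2), written with the phase so that its period in
    the imaginary direction is that of the torus action. *)
Definition uexp (x y : R) : C := (expR (x / 2))%:C%C * phase (y / (4 * pi)).

Let pi4 : (4 * pi : R) != 0. Proof. by rewrite gt_eqF // mulr_gt0 ?pi_gt0. Qed.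

Lemma nrm2_real (r : R) : nrm2 r%:C%C = r ^+ 2.
Proof. by rewrite /nrm2 /= expr0n addr0. Qed.

Lemma nrm2_uexp x y : nrm2 (uexp x y) = expR x.
Proof.
rewrite /uexp nrm2M nrm2_phase mulr1 nrm2_real -expRM_natl; congr expR.
by field.
Qed.

Lemma uexp_neq0 x y : uexp x y != 0.
Proof. by rewrite -nrm2_eq0 nrm2_uexp gt_eqF ?expR_gt0. Qed.

Lemma uexp_shift x y t : uexp x (y + 4 * pi * t) = phase t * uexp x y.
Proof.
rewrite /uexp (_ : (y + 4 * pi * t) / (4 * pi) = y / (4 * pi) + t).
  by rewrite phaseD; ring.
by rewrite mulrDl [4 * pi * t]mulrC mulfK.
Qed.

Lemma uexp_inj x y x' y' : uexp x y = uexp x' y' ->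
  x = x' /\ exists k : int, y' = y + 4 * pi * k%:~R.
Proof.
move=> e; have xx : x = x' by have /(congr1 (@nrm2 R)) := e; rewrite !nrm2_uexp => /expR_inj.
split=> //; subst x'; move: e; rewrite /uexp => /mulfI.
rewrite -nrm2_eq0 nrm2_real sqrf_eq0 gt_eqF ?expR_gt0 // => /(_ isT) e.
have : phase (y' / (4 * pi) - y / (4 * pi)) = 1.
  by rewrite phaseD phaseN -e mulfV // phase_neq0.
move/phase_eq1/intrP => [k ek]; exists k; rewrite -ek.
by rewrite -mulrBl mulrC divfK // addrC subrK.
Qed.

Lemma uexp_surj w : w != 0 -> exists x y, uexp x y = w.
Proof.
move=> w0; have n0 : 0 < nrm2 w by exact: nrm2_gt0.
pose x := ln (nrm2 w).
have ex : expR (x / 2) != 0 by rewrite gt_eqF ?expR_gt0.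
have ec : (expR (x / 2))%:C%C != 0 :> C by rewrite -nrm2_eq0 nrm2_real sqrf_eq0.
have /phase_surj[s es] : nrm2 (((expR (x / 2))%:C%C)^-1 * w) = 1.
  apply: (mulfI (_ : nrm2 (expR (x / 2))%:C%C != 0)); first by rewrite nrm2_eq0.
  rewrite -nrm2M mulrA mulfV // mul1r mulr1 nrm2_real -expRM_natl.
  by rewrite (_ : 2%:R * (x / 2) = x) ?lnK //; field.
exists x, (4 * pi * s); rewrite /uexp [4 * pi * s]mulrC mulfK // -es mulrA mulfV //.
by rewrite mul1r.
Qed.

Lemma csmooth_uexp d (U : set 'rV[R]_d) f g : open U -> smooth_on U f -> smooth_on U g ->
  csmooth U (fun x => uexp (f x) (g x)).
Proof.
move=> oU sf sg.
have sx := csmooth_real (smooth_on_expR oU (smooth_onM oU sf (smooth_on_cst 2^-1))).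
have sy := csmooth_phase oU (smooth_onM oU sg (smooth_on_cst (4 * pi)^-1)).
exact: csmoothM oU sx sy.
Qed.

Lemma cderive_uexp d (x v : 'rV[R]_d) f g df dg : is_derive x v f df -> is_derive x v g dg ->
  cderive x v (fun z => uexp (f z) (g z)) (uexp (f x) (g x) * Complex (df / 2) (dg / 2)).
Proof.
move=> hf hg; have p0 : (pi : R) != 0 by rewrite gt_eqF ?pi_gt0.
have scal c (k : 'rV[R]_d -> R) dk : is_derive x v k dk -> is_derive x v (fun z => c * k z) (c * dk).
  exact: is_deriveZ.
have he : is_derive x v (fun z => expR (f z / 2)) (expR (f x / 2) * (2^-1 * df)).
  have := is_derive_comp1 (scal 2^-1 _ _ hf) (is_derive_expR _).
  by under eq_fun do rewrite mulrC; rewrite [2^-1 * f x]mulrC.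
have hs : is_derive x v (fun z => 2 * pi * (g z / (4 * pi))) (dg / 2).
  rewrite (_ : (fun z => _) = (fun z => 2^-1 * g z)); last first.
    by rewrite funeqE => z; move: (pi : R) p0 => P P0; field.
  by rewrite mulrC; exact: scal.
have hp : cderive x v (fun z => phase (g z / (4 * pi)))
    (phase (g x / (4 * pi)) * Complex 0 (dg / 2)).
  split.
    apply: (is_derive_eq (is_derive_comp1 hs (is_derive_cos _))).
    by rewrite ReM /= mulr0 sub0r mulNr.
  apply: (is_derive_eq (is_derive_comp1 hs (is_derive_sin _))).
  by rewrite ImM /= mulr0 addr0.
have := cderiveM (cderive_real he) hp; congr (cderive _ _ _ _).
rewrite /uexp; apply: Complex_eq; rewrite ?ReD ?ImD ?ReM ?ImM /=; ring.
Qed.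

(** A smooth branch of the logarithm near [uexp x0 y0], with values in the
    half-plane around it. *)
Definition ulog (y0 : R) (w0 w : C) : R * R :=
  (ln (nrm2 w), y0 + 2 * atan (complex.Im (w / w0) / complex.Re (w / w0))).

(** In the half-plane Re (w / w0) > 0 the argument of w / w0 is the arc tangent of its
    slope. *)
Lemma ulogK x0 y0 w : 0 < complex.Re (w / uexp x0 y0) ->
  uexp (ulog y0 (uexp x0 y0) w).1 (ulog y0 (uexp x0 y0) w).2 = w.
Proof.
set w0 := uexp x0 y0 => q0; rewrite /ulog /=.
have p0 : (pi : R) != 0 by rewrite gt_eqF ?pi_gt0.
have w00 : w0 != 0 by exact: uexp_neq0.
have ew : w = w / w0 * w0 by rewrite divfK.
move: q0 ew; move: (w / w0) => q; case: q => a b /= a0 ew.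
set t := b / a; have bE : b = t * a by rewrite /t divfK // gt_eqF.
have ct : 0 < cos (atan t).
  by apply: cos_gt0_pihalf; rewrite atan_gtNpi2 atan_ltpi2.
have st : sin (atan t) = t * cos (atan t).
  by rewrite -{2}[t]atanK /tan divfK // gt_eqF.
have c2 : cos (atan t) ^+ 2 * (1 + t ^+ 2) = 1.
  by rewrite -[RHS](cos2Dsin2 (atan t)) st; ring.
have nw : nrm2 w = a ^+ 2 * (1 + t ^+ 2) * expR x0.
  by rewrite {1}ew nrm2M nrm2_uexp /nrm2 /= bE; ring.
have er : expR (ln (nrm2 w) / 2) * cos (atan t) = a * expR (x0 / 2).
  apply: (@pexpIrn _ 2); rewrite ?nnegrE ?mulr_ge0 ?expR_ge0 ?ltW //.
  rewrite !exprMn -!expRM_natl.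
  rewrite (_ : 2%:R * (ln (nrm2 w) / 2) = ln (nrm2 w)); last by field.
  rewrite (_ : 2%:R * (x0 / 2) = x0); last by field.
  rewrite lnK; last first.
    by rewrite posrE nw !mulr_gt0 ?exprn_gt0 ?expR_gt0 // ltr_wpDr ?sqr_ge0.
  rewrite nw; transitivity (a ^+ 2 * expR x0 * (cos (atan t) ^+ 2 * (1 + t ^+ 2))); first by ring.
  by rewrite c2 mulr1.
rewrite /uexp.
have -> : (y0 + 2 * atan t) / (4 * pi) = y0 / (4 * pi) + atan t / (2 * pi).
  by move: (pi : R) p0 => P P0; field.
rewrite phaseD [RHS]ew /w0 /uexp.
have -> : phase (atan t / (2 * pi)) = Complex (cos (atan t)) (t * cos (atan t)).
  rewrite -st; have e : 2 * pi * (atan t / (2 * pi)) = atan t.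
    by rewrite mulrC divfK // mulf_neq0 ?pnatr_eq0.
  by apply: Complex_eq; rewrite /= e.
transitivity (phase (y0 / (4 * pi)) * ((expR (ln (nrm2 w) / 2) * cos (atan t))%:C%C * Complex 1 t)).
  by apply: Complex_eq; rewrite !(ReM, ImM) /=; ring.
by rewrite er bE; apply: Complex_eq; rewrite !(ReM, ImM) /=; ring.
Qed.

Lemma ulog0 x0 y0 : ulog y0 (uexp x0 y0) (uexp x0 y0) = (x0, y0).
Proof.
rewrite /ulog divff ?uexp_neq0 // nrm2_uexp expRK /= mul0r atan0.
by rewrite mulr0 addr0.
Qed.

Lemma smooth_ulog d (U : set 'rV[R]_d) f y0 w0 : open U -> csmooth U f ->
  (forall x, U x -> 0 < complex.Re (f x / w0)) ->
  smooth_on U (fun x => (ulog y0 w0 (f x)).1) /\ smooth_on U (fun x => (ulog y0 w0 (f x)).2).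
Proof.
move=> oU sf f0; have sq := csmoothM oU sf (csmooth_cst _ w0^-1).
split.
  apply: smooth_on_ln => //; last exact: smooth_nrm2.
  move=> x /f0; rewrite lt0r => /andP[h _]; apply: nrm2_gt0; apply: contra h => /eqP ->.
  by rewrite mul0r.
refine (smooth_onD oU (smooth_on_cst y0) (smooth_onM oU (smooth_on_cst 2) (smooth_on_atan oU _))).
apply: smooth_onM => //; first by case: sq.
apply: smooth_onV => //; last by case: sq.
by move=> x /f0; rewrite lt0r => /andP[].
Qed.

End Phases.

(** * Holomorphic maps in real coordinates *)

Section SublevelSets.
Variables (R : realType) (d : nat) (f : 'rV[R]_d -> R).
Hypothesis sf : smooth_on setT f.

Lemma open_smooth_lt c : open [set x | f x < c].
Proof.
rewrite (_ : mkset _ = setT `&` f @^-1` [set t | t < c]); last by rewrite setTI.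
apply: (@open_inter_preim _ _ setT f [set t | t < c] openT _ (open_lt (y := c))).
by move=> x _; exact: smooth_on_cont sf I.
Qed.

End SublevelSets.

Section HolomorphicMaps.
Variable R : realType.
Local Notation C := (R[i]).

Lemma realifyK n : cancel (@realify R n) (@complexify R n).
Proof.
move=> z; apply/rowP => k; rewrite mxE /realify row_mxKl row_mxKr !mxE.
exact: Complex_eq.
Qed.

Lemma complexifyK n : cancel (@complexify R n) (@realify R n).
Proof.
move=> x; rewrite -[RHS]hsubmxK; congr row_mx; by apply/rowP => k; rewrite !mxE.
Qed.

Lemma csmooth_complexify n (U : set 'rV[R]_(n + n)) k :
  csmooth U (fun x => complexify x 0 k).
Proof.
have o k' := @smooth_on_coord R (n + n) U k'.
split; first by rewrite (_ : (fun x => _) = (fun x : 'rV[R]_(n + n) => x 0 (lshift n k))) // funeqE => x; rewrite !mxE.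
by rewrite (_ : (fun x => _) = (fun x : 'rV[R]_(n + n) => x 0 (rshift n k))) // funeqE => x; rewrite !mxE.
Qed.

Lemma cderive_complexify n (x v : 'rV[R]_(n + n)) k :
  cderive x v (fun y => complexify y 0 k) (complexify v 0 k).
Proof.
split; rewrite !mxE /=.
  rewrite (_ : (fun y => _) = (fun y : 'rV[R]_(n + n) => y 0 (lshift n k))); first exact: is_derive_coord.
  by rewrite funeqE => y; rewrite !mxE.
rewrite (_ : (fun y => _) = (fun y : 'rV[R]_(n + n) => y 0 (rshift n k))); first exact: is_derive_coord.
by rewrite funeqE => y; rewrite !mxE.
Qed.

Lemma smooth_realify d n (U : set 'rV[R]_d) (g : 'rV[R]_d -> 'rV[C]_n) :
  (forall k, csmooth U (fun x => g x 0 k)) -> smooth_vec U (fun x => realify (g x)).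
Proof.
move=> sg l; case: (split_ordP l) => k ->.
  have [s _] := sg k; congr (smooth_on U _): s; rewrite funeqE => x.
  by rewrite row_mxEl mxE.
have [_ s] := sg k; congr (smooth_on U _): s; rewrite funeqE => x.
by rewrite row_mxEr mxE.
Qed.

Lemma jac_realify d n (g : 'rV[R]_d -> 'rV[C]_n) x : jac (fun y => realify (g y)) x =
  row_mx (\matrix_(a, k) complex.Re (cpartial a (fun y => g y 0 k) x))
         (\matrix_(a, k) complex.Im (cpartial a (fun y => g y 0 k) x)).
Proof.
apply/matrixP => a l; case: (split_ordP l) => k ->; rewrite ?row_mxEl ?row_mxEr !mxE.
  by congr partial; rewrite funeqE => y; rewrite row_mxEl mxE.
by congr partial; rewrite funeqE => y; rewrite row_mxEr mxE.
Qed.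

(** The Cauchy-Riemann equations determine the lower half of the Jacobian. *)
Lemma jac_holomorphic m n (g : 'rV[R]_(m + m) -> 'rV[C]_n) x :
  (forall a k, cpartial (rshift m a) (fun y => g y 0 k) x =
     Complex 0 1 * cpartial (lshift m a) (fun y => g y 0 k) x) ->
  jac (fun y => realify (g y)) x =
    block_mx (\matrix_(a, k) complex.Re (cpartial (lshift m a) (fun y => g y 0 k) x))
             (\matrix_(a, k) complex.Im (cpartial (lshift m a) (fun y => g y 0 k) x))
          (- (\matrix_(a, k) complex.Im (cpartial (lshift m a) (fun y => g y 0 k) x)))
             (\matrix_(a, k) complex.Re (cpartial (lshift m a) (fun y => g y 0 k) x)).
Proof.
move=> cr; rewrite jac_realify /block_mx; apply/matrixP => a l.
case: (split_ordP a) => b ->; case: (split_ordP l) => k ->.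
- by rewrite col_mxEu !row_mxEl !mxE.
- by rewrite col_mxEu !row_mxEr !mxE.
- by rewrite col_mxEd !row_mxEl 3!mxE cr ReM mul0r mul1r sub0r.
- by rewrite col_mxEd !row_mxEr 2!mxE cr ImM mul0r mul1r add0r.
Qed.

Lemma std_cplx_block m n (A B : 'M[R]_(m, n)) :
  std_cplx R m *m block_mx A B (- B) A = block_mx A B (- B) A *m std_cplx R n.
Proof.
rewrite /std_cplx !mulmx_block !mul0mx !mulmx0 !mul1mx !mulmx1 !mulNmx !mulmxN !mul1mx !mulmx1.
by rewrite !add0r !addr0.
Qed.

Lemma jac_std_cplx m n (g : 'rV[R]_(m + m) -> 'rV[C]_n) x :
  (forall a k, cpartial (rshift m a) (fun y => g y 0 k) x =
     Complex 0 1 * cpartial (lshift m a) (fun y => g y 0 k) x) ->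
  std_cplx R m *m jac (fun y => realify (g y)) x =
  jac (fun y => realify (g y)) x *m std_cplx R n.
Proof. by move=> cr; rewrite jac_holomorphic //; exact: std_cplx_block. Qed.

Lemma std_cplx_sqr n : std_cplx R n *m std_cplx R n = - 1%:M.
Proof.
rewrite /std_cplx mulmx_block !mul0mx !mulmx0 !mulmxN !mulNmx !mulmx1.
by rewrite !add0r !addr0 (scalar_mx_block n n) opp_block_mx oppr0.
Qed.

Lemma std_cplx_orth n : std_cplx R n *m (std_cplx R n)^T = 1%:M.
Proof.
rewrite /std_cplx tr_block_mx !trmx0 linearN /= !trmx1 mulmx_block.
by rewrite !mul0mx !mulmx0 !mulmx1 mulmxN mulNmx opprK mulmx1 !add0r !addr0 (scalar_mx_block n n).
Qed.

Lemma nijenhuis_cst d (J : 'M[R]_d) x a b k : nijenhuis (fun=> J) x a b k = 0.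
Proof.
have z c e f : partial c (fun _ : 'rV[R]_d => J e f) x = 0 by exact: derive_cst.
by rewrite /nijenhuis big1 // => c _; rewrite !z; ring.
Qed.

Lemma std_cplx_E n : [/\ forall i j, std_cplx R n (lshift n i) (lshift n j) = 0,
  forall i j, std_cplx R n (lshift n i) (rshift n j) = (i == j)%:R,
  forall i j, std_cplx R n (rshift n i) (lshift n j) = - (i == j)%:R &
  forall i j, std_cplx R n (rshift n i) (rshift n j) = 0].
Proof.
by split=> i j; rewrite /std_cplx ?block_mxEul ?block_mxEur ?block_mxEdl ?block_mxEdr !mxE.
Qed.

(** On a constant almost complex structure the conditions on a Kaehler structure
    reduce to the metric and to closedness of the two-form. *)
Lemma kaehler_std n (N : kmfd R (n + n)) :
  is_manifold N -> is_metric (@kmetric _ _ N) ->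
  (forall i x, chart_cod i x -> @kcplx _ _ N i x = std_cplx R n) ->
  (forall i : chart N, open (chart_cod i)) ->
  preserves_endo (@kcplx _ _ N) (@kcplx _ _ N) (fun p : N => p) ->
  (forall i x, chart_cod i x ->
     std_cplx R n *m @kmetric _ _ N i x *m (std_cplx R n)^T = kmetric i x) ->
  (forall i x, chart_cod i x -> forall a b k,
     let w b k y := (std_cplx R n *m @kmetric _ _ N i y) b k in
     partial a (w b k) x + partial b (w k a) x + partial k (w a b) x = 0) ->
  is_kaehler N.
Proof.
move=> mN gN JN oN eN hN wN.
have Jeq (i : chart N) a b : {in chart_cod i, (fun=> std_cplx R n a b) =1 (fun x => kcplx i x a b)}.
  by move=> x; rewrite inE => /JN ->.
split=> //.
- split=> //.
    move=> i a b; refine (smooth_on_eq (oN i) _ (smooth_on_cst (std_cplx R n a b))).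
    exact: Jeq.
  by move=> i x /JN ->; exact: std_cplx_sqr.
- by move=> i x ix; rewrite JN // hN.
- move=> i x ix a b k; split.
    rewrite -(nijenhuis_cst (std_cplx R n) x a b k) /nijenhuis.
    have pE c e f : partial c (fun y => kcplx i y e f) x = partial c (fun=> std_cplx R n e f) x.
      by refine (derive_eq_on (U := chart_cod i) _ (oN i) ix _) => y /Jeq ->.
    by apply: eq_bigr => c _; rewrite !pE JN.
  rewrite -(wN i x ix a b k) /=.
  have pE c e f : partial c (fun y => kform i y e f) x =
      partial c (fun y => (std_cplx R n *m kmetric i y) e f) x.
    refine (derive_eq_on (U := chart_cod i) _ (oN i) ix _) => y; rewrite inE => iy.
    by rewrite /kform JN.
  by rewrite !pE.
Qed.

End HolomorphicMaps.

(** A two-form on a surface is closed, as two of three indices always agree. *)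
Lemma std_cplx1_cyclic (R : realType) (D : 'I_(1 + 1) -> R) a b k :
  std_cplx R 1 b k * D a + std_cplx R 1 k a * D b + std_cplx R 1 a b * D k = 0.
Proof.
have [Ell Elr Erl Err] := std_cplx_E R 1.
case: (split_ordP a) => a' ->; case: (split_ordP b) => b' ->; case: (split_ordP k) => k' ->;
  rewrite (ord1 a') (ord1 b') (ord1 k') ?(Ell, Elr, Erl, Err) ?eqxx; ring.
Qed.

(** * Rotations of a disk or of the plane *)

(** The plane and the disk at once: N is the set mu |z|^2 < 1 with the metric
    al |dz|^2 / (1 - mu |z|^2)^2, seen through the coordinate cz; the plane is mu = 0,
    a disk is mu = 1. *)
Section RotationDomain.
Variable R : realType.
Local Notation C := (R[i]).
Variables (N : kmfd R (1 + 1)) (j0 : chart N) (cz : N -> C) (czi : C -> N) (mu al : R).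
Hypothesis mu0 : 0 <= mu.
Hypothesis al0 : 0 < al.
Hypothesis ej : forall j : chart N, j = j0.
Hypothesis dN : chart_dom j0 = setT.
Hypothesis cz_inj : injective cz.
Hypothesis cz_in : forall p, mu * nrm2 (cz p) < 1.
Hypothesis cziK : forall z, mu * nrm2 z < 1 -> cz (czi z) = z.
Hypothesis mapN : forall p, chart_map j0 p = realify (const_mx (cz p)).
Hypothesis metN : forall x, kmetric j0 x = (al / (1 - mu * \sum_k x 0 k ^+ 2) ^+ 2)%:M.
Hypothesis cplxN : forall x, kcplx j0 x = std_cplx R 1.

Let v2c (x : 'rV[R]_(1 + 1)) : C := complexify x 0 0.
Let c2v (z : C) : 'rV[R]_(1 + 1) := realify (const_mx z).

Lemma v2cK x : c2v (v2c x) = x.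
Proof.
by rewrite -[RHS]complexifyK; congr realify; apply/rowP => k; rewrite ord1 mxE.
Qed.

Lemma c2vK z : v2c (c2v z) = z.
Proof. by rewrite /v2c realifyK mxE. Qed.

Lemma sum_sqr_v2c (x : 'rV[R]_(1 + 1)) : \sum_k x 0 k ^+ 2 = nrm2 (v2c x).
Proof.
rewrite big_split_ord /= !big_ord1 /nrm2 /v2c !mxE /=.
by congr (_ ^+ 2 + _ ^+ 2).
Qed.

Definition rdom : set 'rV[R]_(1 + 1) := [set x | mu * nrm2 (v2c x) < 1].

Lemma rcod : chart_cod j0 = rdom.
Proof.
apply/seteqP; split=> [_ [p _ <-]|x Vx].
  by rewrite /rdom /= mapN -/(c2v _) c2vK; exact: cz_in.
by exists (czi (v2c x)); rewrite ?dN // mapN cziK // -/(c2v _) v2cK.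
Qed.

Lemma smooth_v2c U : csmooth U v2c.
Proof. exact: csmooth_complexify. Qed.

Lemma smooth_rnorm (U : set 'rV[R]_(1 + 1)) : open U -> smooth_on U (fun x => mu * nrm2 (v2c x)).
Proof.
by move=> oU; exact (smooth_onM oU (smooth_on_cst mu) (smooth_nrm2 oU (@smooth_v2c U))).
Qed.

Lemma open_rdom : open rdom.
Proof.
by apply: open_smooth_lt; apply: smooth_rnorm; exact: openT.
Qed.

Lemma convex_rdom : convex_rV rdom.
Proof.
move=> x y t; rewrite /rdom /= => Vx Vy /andP[t0 t1].
have e k : complexify (x + t *: (y - x)) 0 k =
    Complex (complex.Re (complexify x 0 k) + t * (complex.Re (complexify y 0 k) - complex.Re (complexify x 0 k)))
            (complex.Im (complexify x 0 k) + t * (complex.Im (complexify y 0 k) - complex.Im (complexify x 0 k))).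
  by apply: Complex_eq; rewrite !mxE.
move: Vx Vy; rewrite /v2c e /nrm2 /=; move: (complexify x 0 0) (complexify y 0 0) => [p q] [r s] /= Vx Vy.
have -> : mu * ((p + t * (r - p)) ^+ 2 + (q + t * (s - q)) ^+ 2) =
    (1 - t) * (mu * (p ^+ 2 + q ^+ 2)) + t * (mu * (r ^+ 2 + s ^+ 2))
    - mu * (t * (1 - t) * ((r - p) ^+ 2 + (s - q) ^+ 2)) by ring.
have h : 0 <= mu * (t * (1 - t) * ((r - p) ^+ 2 + (s - q) ^+ 2)).
  by rewrite mulr_ge0 // mulr_ge0 ?addr_ge0 ?sqr_ge0 // mulr_ge0 // subr_ge0.
have [->|tn] := eqVneq t 0; first by lra.
have tp : 0 < t by rewrite lt0r tn.
nra.
Qed.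

Lemma rinj : inj_charts N.
Proof.
move=> j p q _ _; rewrite (ej j) !mapN => /(congr1 v2c).
by rewrite -!/(c2v _) !c2vK; exact: cz_inj.
Qed.

Definition rho (x : 'rV[R]_(1 + 1)) : R := al / (1 - mu * nrm2 (v2c x)) ^+ 2.

Lemma metNE x : kmetric j0 x = (rho x)%:M.
Proof. by rewrite metN /rho sum_sqr_v2c. Qed.

Lemma rho_gt0 x : rdom x -> 0 < rho x.
Proof. by rewrite /rdom /= => Vx; rewrite divr_gt0 // exprn_gt0 // subr_gt0. Qed.

Lemma smooth_rho : smooth_on rdom rho.
Proof.
have oV := open_rdom.
have sd : smooth_on rdom (fun x => 1 - mu * nrm2 (v2c x)).
  exact: smooth_onB oV (smooth_on_cst 1) (smooth_rnorm oV).
refine (smooth_onM oV (smooth_on_cst al) (smooth_onV oV _ (smooth_onM oV sd sd))).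
by move=> x Vx; rewrite mulf_neq0 // subr_eq0 gt_eqF.
Qed.

Lemma rotation_kaehler : is_kaehler N /\ mconnected N.
Proof.
have oV := open_rdom; have oN : open (chart_cod j0) by rewrite rcod.
have idN := one_chart_dmap_id ej dN oN rinj.
split; last first.
  apply: (mconnected_charts (p0 := czi 0) rinj) => [p|j|j].
  - by exists j0; rewrite dN.
  - by rewrite (ej j) dN.
  - by rewrite (ej j) rcod; exact: convex_rdom.
apply: kaehler_std.
- exact: one_chart_manifold ej dN oN rinj.
- split.
  + move=> j a b; rewrite (ej j) rcod.
    refine (smooth_on_eq oV _ (smooth_onM oV smooth_rho (smooth_on_cst (a == b)%:R))).
    by move=> x _; rewrite metNE mxE mulr_natr.
  + move=> i j p _ _ /=; rewrite (ej i) (ej j) idN; last by exists p; rewrite ?dN.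
    by rewrite mul1mx trmx1 mulmx1.
  + move=> j x; rewrite (ej j) rcod => Vx; rewrite metNE tr_scalar_mx; split=> // v v0.
    rewrite mul_mx_scalar -scalemxAl mxE mulr_gt0 ?rho_gt0 //.
    rewrite mxE; under eq_bigr do rewrite mxE -expr2.
    rewrite lt0r sumr_ge0 ?andbT => [|k _]; last exact: sqr_ge0.
    apply: contra v0 => /eqP v00; apply/eqP/rowP => k; rewrite mxE.
    have h := psumr_eq0P (fun k _ => sqr_ge0 (v 0 k)) v00.
    by have /eqP := h k isT; rewrite sqrf_eq0 => /eqP.
- by move=> j x _; rewrite (ej j).
- by move=> j; rewrite (ej j).
- move=> i j p _ _ /=; rewrite (ej i) (ej j) idN; last by exists p; rewrite ?dN.
  by rewrite mulmx1 mul1mx !cplxN.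
- by move=> j x _; rewrite (ej j) metNE mul_mx_scalar -scalemxAl std_cplx_orth scalemx1.
- move=> j x; rewrite (ej j) rcod => Vx a b k /=.
  have pE c e f : partial c (fun y => (std_cplx R 1 *m kmetric j0 y) e f) x =
      std_cplx R 1 e f * partial c rho x.
    rewrite -[RHS]/(std_cplx R 1 e f *: 'D_(delta_mx 0 c) rho x).
    rewrite -deriveZ; last exact: smooth_on_der smooth_rho Vx.
    by congr partial; rewrite funeqE => y; rewrite metNE mul_mx_scalar mxE mulrC.
  by rewrite !pE; exact: (std_cplx1_cyclic (fun c => partial c rho x)).
Qed.

Variable Phi : torus R 1 -> N -> N.
Hypothesis PhiE : forall t p, cz (Phi t p) = phase (repr t 0 0) * cz p.

Lemma rotation_act0 p : Phi 0 p = p.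
Proof. by apply: cz_inj; rewrite PhiE phase_repr0 mul1r. Qed.

Lemma rotation_actD s t p : Phi (s + t) p = Phi s (Phi t p).
Proof. by apply: cz_inj; rewrite !PhiE phase_reprD mulrA. Qed.

Lemma rotation_freeP p : free_set Phi p <-> cz p != 0.
Proof.
split=> [fp|p0 t tp].
  apply/negP => /eqP p0.
  (* half a turn is not the identity of the circle, but fixes the origin *)
  have h : Phi (tclass (const_mx (2^-1))) p = p by apply: cz_inj; rewrite PhiE p0 mulr0.
  have := phase_repr (const_mx (2^-1) : 'rV[R]_1) 0.
  rewrite (fp _ h) phase_repr0 mxE => /(congr1 (@complex.Re R)) /=.
  rewrite mulrAC mulfV ?pnatr_eq0 // mul1r cospi => /eqP.
  by rewrite eq_sym -subr_eq0 -opprD oppr_eq0 -(natrD _ 1 1) pnatr_eq0.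
apply: torus_eq0 => i; rewrite ord1; apply: (mulIf p0).
by rewrite -PhiE tp mul1r.
Qed.

Lemma rotation_free_mopen : mopen (free_set Phi).
Proof.
have -> : free_set Phi = (fun p => nrm2 (cz p)) @^-1` [set r | r != 0].
  by apply/seteqP; split=> p; rewrite /= rotation_freeP -nrm2_eq0.
have oT : open [set: 'rV[R]_(1 + 1)] by exact: openT.
apply: (mopen_preim (g := fun _ x => nrm2 (v2c x))) (@open_neq0 R).
- by move=> j; rewrite (ej j) rcod; exact: open_rdom.
- by move=> j p _; rewrite (ej j) mapN -/(c2v _) c2vK.
- by move=> j x _; exact: smooth_on_cont (smooth_nrm2 oT (@smooth_v2c setT)) I.
Qed.

Lemma rotation_action : is_torus_action Phi.
Proof.
split; [exact: rotation_act0|exact: rotation_actD|].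
have iP : inj_charts (prod_mfd (euclid R 1) N).
  move=> [i j] [s p] [t q] _ _ /= /eq_row_mx[-> e]; congr pair.
  by apply: (rinj (i := j)) e; rewrite inE (ej j) dN.
apply: (local_rep_smooth iP) => [[i j] j' [t p] _ _].
pose w (x : 'rV[R]_(1 + (1 + 1))) := c2v (phase (lsubmx x 0 0) * v2c (rsubmx x)).
have oT : open [set: 'rV[R]_(1 + (1 + 1))] by exact: openT.
pose W := [set x : 'rV[R]_(1 + (1 + 1)) | rdom (rsubmx x)].
have sv : csmooth setT (fun x : 'rV[R]_(1 + (1 + 1)) => v2c (rsubmx x)).
  split; rewrite /v2c.
    rewrite (_ : (fun x => _) = (fun x : 'rV[R]_(1 + (1 + 1)) => x 0 (rshift 1 (lshift 1 0)))).
      exact: smooth_on_coord.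
    by rewrite funeqE => x; rewrite !mxE.
  rewrite (_ : (fun x => _) = (fun x : 'rV[R]_(1 + (1 + 1)) => x 0 (rshift 1 (rshift 1 0)))).
    exact: smooth_on_coord.
  by rewrite funeqE => x; rewrite !mxE.
have oW : open W.
  by apply: open_smooth_lt; exact: smooth_onM oT (smooth_on_cst mu) (smooth_nrm2 oT sv).
exists W, w; split.
- by rewrite /W /= row_mxKr (ej j) -rcod; exists p; rewrite ?dN.
- split=> // x Wx; exists (lsubmx x, czi (v2c (rsubmx x))); split=> /=.
  + by split=> //; rewrite (ej j) dN.
  + by rewrite (ej j) mapN cziK // -/(c2v _) v2cK hsubmxK.
  + by rewrite (ej j') dN.
  + by rewrite (ej j') mapN PhiE cziK // phase_repr.
- apply: smooth_realify => k.
  have sp : csmooth setT (fun x : 'rV[R]_(1 + (1 + 1)) => phase (lsubmx x 0 0)).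
    apply: csmooth_phase => //.
    rewrite (_ : (fun x => _) = (fun x : 'rV[R]_(1 + (1 + 1)) => x 0 (lshift (1 + 1) 0))).
      exact: smooth_on_coord.
    by rewrite funeqE => x; rewrite !mxE.
  rewrite (_ : (fun x => _) = (fun x : 'rV[R]_(1 + (1 + 1)) => phase (lsubmx x 0 0) * v2c (rsubmx x))).
    exact: (csmooth_sub (fun _ _ => I) (csmoothM oT sp sv)).
  by rewrite funeqE => x; rewrite mxE.
Qed.

(** By the Cauchy-Riemann equations the Jacobian is a rotation times the modulus of the
    derivative g. *)
Lemma jac_conformal (f : 'rV[R]_(1 + 1) -> C) (g : C) x (r : R) :
  cderive x (delta_mx 0 (lshift 1 0)) f g ->
  cderive x (delta_mx 0 (rshift 1 0)) f (Complex 0 1 * g) ->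
  let T := jac (fun y => c2v (f y)) x in
  T *m r%:M *m T^T = (r * nrm2 g)%:M /\ std_cplx R 1 *m T = T *m std_cplx R 1.
Proof.
move=> /cderive_cpartial dl /cderive_cpartial dr.
have fE k : (fun y => (const_mx (f y) : 'rV[C]_1) 0 k) = f by rewrite funeqE => y; rewrite mxE.
have cr (a k : 'I_1) : cpartial (rshift 1 a) (fun y => (const_mx (f y) : 'rV[C]_1) 0 k) x =
    Complex 0 1 * cpartial (lshift 1 a) (fun y => (const_mx (f y) : 'rV[C]_1) 0 k) x.
  by rewrite !fE !ord1 dl dr.
split; last exact: jac_std_cplx.
rewrite /c2v jac_holomorphic //.
have -> : (\matrix_(a, k) complex.Re (cpartial (lshift 1 a) (fun y => (const_mx (f y) : 'rV[C]_1) 0 k) x) : 'M[R]_1) = (complex.Re g)%:M.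
  by apply/matrixP => a k; rewrite mxE fE !ord1 dl mxE eqxx mulr1n.
have -> : (\matrix_(a, k) complex.Im (cpartial (lshift 1 a) (fun y => (const_mx (f y) : 'rV[C]_1) 0 k) x) : 'M[R]_1) = (complex.Im g)%:M.
  by apply/matrixP => a k; rewrite mxE fE !ord1 dl mxE eqxx mulr1n.
rewrite mul_mx_scalar -scalemxAl tr_block_mx mulmx_block !linearN /= !tr_scalar_mx.
have c : (complex.Im g)%:M *m (complex.Re g)%:M = (complex.Re g)%:M *m (complex.Im g)%:M :> 'M[R]_1.
  by rewrite -!scalar_mxM mulrC.
rewrite ?mulNmx ?mulmxN ?opprK c !addNr -!scalar_mxM -!raddfD /=.
rewrite [complex.Im g * _ + _]addrC -scalar_mx_block scale_scalar_mx.
by rewrite /nrm2 !expr2.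
Qed.

Lemma rotation_isometry t : holo_isometric (Phi t).
Proof.
pose s := repr t 0 0; pose w (x : 'rV[R]_(1 + 1)) := c2v (phase s * v2c x).
have sw : smooth_vec rdom w.
  apply: smooth_realify => k.
  rewrite (_ : (fun x => _) = (fun x => phase s * v2c x)).
    by apply: csmoothM => //; [exact: open_rdom|exact: csmooth_cst|exact: smooth_v2c].
  by rewrite funeqE => x; rewrite mxE.
have rw (i j : chart N) : local_rep (Phi t) i j rdom w.
  split; first exact: open_rdom.
  move=> x Vx; exists (czi (v2c x)); rewrite (ej i) (ej j) dN; split=> //.
    by rewrite mapN cziK // -/(c2v _) v2cK.
  by rewrite mapN PhiE cziK.
have Vp (i : chart N) p : rdom (chart_map i p) by rewrite (ej i) -rcod; exists p; rewrite ?dN.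
have cj x r : let T := jac w x in
    T *m r%:M *m T^T = r%:M /\ std_cplx R 1 *m T = T *m std_cplx R 1.
  have d v : cderive x v (fun y => phase s * v2c y) (phase s * v2c v).
    have := cderiveM (cderive_cst x v (phase s)) (cderive_complexify x v 0).
    by rewrite mulr0 addr0.
  have := @jac_conformal (fun y => phase s * v2c y) (phase s) x r.
  rewrite nrm2_phase mulr1; apply.
    have := d (delta_mx 0 (lshift 1 0)); congr (cderive _ _ _ _).
    rewrite -[RHS]mulr1; congr (_ * _); apply: Complex_eq; rewrite /v2c !mxE /= //.
  have := d (delta_mx 0 (rshift 1 0)); congr (cderive _ _ _ _).
  by rewrite mulrC; congr (_ * _); apply: Complex_eq; rewrite /v2c !mxE.
have rho_w x : rdom x -> rho (w x) = rho x.
  by move=> Vx; rewrite /rho /w c2vK nrm2M nrm2_phase mul1r.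
have wE (j : chart N) p : chart_map j (Phi t p) = w (chart_map j p).
  by rewrite (ej j) !mapN PhiE /w -/(c2v _) c2vK.
split.
- apply: (local_rep_smooth rinj) => i j p _ _; exists rdom, w; split=> //.
- move=> i j p _ _ /=; rewrite (local_rep_dmap rinj (rw i j)) // (ej i) (ej j).
  by rewrite wE !metNE rho_w //; case: (cj (chart_map j0 p) (rho (chart_map j0 p))) => ->.
- move=> i j p _ _ /=; rewrite (local_rep_dmap rinj (rw i j)) // (ej i) (ej j) !cplxN.
  by case: (cj (chart_map j0 p) 1).
Qed.

Variables (M : dmfd R 1) (i0 : chart M) (ka : R).
Hypothesis ka0 : 0 < ka.
Let Theta := [set x : 'rV[R]_1 | mu * (ka ^+ 2 * expR (x 0 0)) < 1].
Hypothesis aM : affine_chart i0 Theta.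
Hypothesis ThetaN0 : Theta !=set0.
Hypothesis metM : forall x, Theta x -> dmetric i0 x =
  (al * (ka ^+ 2 * expR (x 0 0)) / (4 * (1 - mu * (ka ^+ 2 * expR (x 0 0))) ^+ 2))%:M.

(** The uniformizing map is ka exp ((x + i y) / 2). Its derivative is half its value,
    which is where the factor 4 in the metric of M comes from. *)
Let kac : C := ka%:C%C.
Let kac0 : kac != 0. Proof. by rewrite -nrm2_eq0 nrm2_real sqrf_eq0 gt_eqF. Qed.
Let uz (z : 'rV[R]_(1 + 1)) : C := kac * uexp (z 0 (lshift 1 0)) (z 0 (rshift 1 0)).

Lemma nrm2_uz z : nrm2 (uz z) = ka ^+ 2 * expR (z 0 (lshift 1 0)).
Proof. by rewrite /uz nrm2M nrm2_real nrm2_uexp. Qed.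

Lemma tubeE z : tube Theta z <-> mu * nrm2 (uz z) < 1.
Proof. by rewrite nrm2_uz /tube /Theta /= mxE. Qed.

Lemma smooth_uz U : open U -> csmooth U uz.
Proof.
move=> oU; exact (csmoothM oU (csmooth_cst U kac) (csmooth_uexp oU
  (@smooth_on_coord R _ U (lshift 1 0)) (@smooth_on_coord R _ U (rshift 1 0)))).
Qed.

Lemma open_tube : open (tube Theta).
Proof.
have oT : open [set: 'rV[R]_(1 + 1)] by exact: openT.
rewrite (_ : tube Theta = [set z | mu * nrm2 (uz z) < 1]).
  by apply: open_smooth_lt; exact: smooth_onM oT (smooth_on_cst mu) (smooth_nrm2 oT (smooth_uz oT)).
by apply/seteqP; split=> z /tubeE.
Qed.

Lemma cderive_uz z v : cderive z v uz (uz z * (Complex 2^-1 0 * v2c v)).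
Proof.
have := cderiveM (cderive_cst z v kac)
  (cderive_uexp (is_derive_coord (lshift 1 0) z v) (is_derive_coord (rshift 1 0) z v)).
congr (cderive _ _ _ _); rewrite mulr0 addr0 /uz -!mulrA; congr (_ * (_ * _)).
by apply: Complex_eq; rewrite ?ReM ?ImM /v2c !mxE /=; ring.
Qed.

Lemma rotation_dually_flat : is_dually_flat M.
Proof.
pose h (x : 'rV[R]_1) := al * (ka ^+ 2 * expR (x 0 0)) / (4 * (1 - mu * (ka ^+ 2 * expR (x 0 0))) ^+ 2).
have oT : open Theta := ac_open aM.
have se : smooth_on Theta (fun x => ka ^+ 2 * expR (x 0 0)).
  exact: smooth_onM oT (smooth_on_cst _) (smooth_on_expR oT (@smooth_on_coord R _ Theta 0)).
have sd : smooth_on Theta (fun x => 1 - mu * (ka ^+ 2 * expR (x 0 0))).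
  exact: smooth_onB oT (smooth_on_cst 1) (smooth_onM oT (smooth_on_cst mu) se).
apply: (affine_dually_flat1 (h := h) aM) => [x /metM -> //||x Tx].
  refine (smooth_onM oT (smooth_onM oT (smooth_on_cst al) se)
    (smooth_onV oT _ (smooth_onM oT (smooth_on_cst 4) (smooth_onM oT sd sd)))).
  move=> x Tx; rewrite !mulf_neq0 ?pnatr_eq0 // subr_eq0 gt_eqF //.
rewrite /h divr_gt0 //; first by rewrite !mulr_gt0 ?exprn_gt0 ?expR_gt0.
by rewrite mulr_gt0 ?ltr0n // exprn_gt0 // subr_gt0.
Qed.

Lemma rotation_torification : torification Phi M.
Proof.
split.
- exact: rotation_kaehler.
- split; [exact: rotation_action| |exact: rotation_isometry].
  move=> t tall; have [x Tx] := ThetaN0; have := ka0.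
  pose z := row_mx x 0 : 'rV[R]_(1 + 1); have Vz : mu * nrm2 (uz z) < 1.
    by apply/tubeE; rewrite /tube /= row_mxKl.
  have : free_set Phi (czi (uz z)).
    by apply/rotation_freeP; rewrite cziK // mulf_neq0 // uexp_neq0.
  by move=> h _; apply: h.
- by split; [exact: rotation_dually_flat|exact: affine_mconnected aM ThetaN0].
- exact: rotation_free_mopen.
have pi4 : (4 * pi : R) != 0 by rewrite mulf_neq0 ?pnatr_eq0 // gt_eqF ?pi_gt0.
pose E z := czi (uz z).
have czE z : tube Theta z -> cz (E z) = uz z by move=> /tubeE; exact: cziK.
have tube_shift z (t : 'rV[R]_1) : tube Theta (z + row_mx 0 t) <-> tube Theta z.
  by rewrite /tube /= linearD /= row_mxKl addr0.
have uz_shift z (t : 'rV[R]_1) : uz (z + row_mx 0 ((4 * pi) *: t)) = phase (t 0 0) * uz z.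
  by rewrite /uz mxE row_mxEl mxE addr0 mxE row_mxEr mxE uexp_shift; ring.
apply: (uniformization (ac_unique aM) (ac_dom aM) (ac_inj aM) (ac_cod aM) (ac_open aM)
  (ac_conn aM) pi4 (E := E)).
- exact: rinj.
- exact: rotation_act0.
- move=> z t Tz; apply: cz_inj; rewrite PhiE phase_repr !czE ?tube_shift //.
- move=> z z' Tz Tz' /(congr1 cz); rewrite !czE // => /(mulfI kac0) /uexp_inj[el [k er]].
  exists (fun=> k); rewrite -[LHS]hsubmxK -[z in RHS]hsubmxK add_row_mx addr0.
  congr row_mx; apply/rowP => i; rewrite !mxE ord1 //.
- by move=> z Tz; apply/rotation_freeP; rewrite czE // mulf_neq0 // uexp_neq0.
- move=> q /rotation_freeP q0.
  have [x [y e]] : exists x y, uexp x y = kac^-1 * cz q.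
    by apply: uexp_surj; rewrite mulf_neq0 ?invr_eq0.
  have eu : uz (row_mx (const_mx x) (const_mx y)) = cz q.
    by rewrite /uz row_mxEl row_mxEr !mxE e mulrA mulfV // mul1r.
  have Tz : tube Theta (row_mx (const_mx x) (const_mx y)) by apply/tubeE; rewrite eu.
  by exists (row_mx (const_mx x) (const_mx y)) => //; apply: cz_inj; rewrite czE.
- move=> j z Tz _; exists (tube Theta), (fun z => c2v (uz z)); split=> //.
  + exact: open_tube.
  + apply: smooth_realify => k; rewrite (_ : (fun x => _) = uz).
      by apply: smooth_uz; exact: open_tube.
    by rewrite funeqE => x; rewrite mxE.
  + by move=> z' Tz'; rewrite (ej j) dN mapN czE.
  + rewrite (ej j) metNE cplxN.
    have [] := @jac_conformal uz (uz z * Complex 2^-1 0) z (rho (c2v (uz z))).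
    * have := cderive_uz z (delta_mx 0 (lshift 1 0)); congr (cderive _ _ _ _).
      congr (_ * _); rewrite -[RHS]mulr1; congr (_ * _).
      by apply: Complex_eq; rewrite /v2c !mxE.
    * have := cderive_uz z (delta_mx 0 (rshift 1 0)); congr (cderive _ _ _ _).
      rewrite [RHS]mulrCA; congr (_ * _).
      by apply: Complex_eq; rewrite !(ReM, ImM) /v2c !mxE /=; ring.
    cbv zeta => -> ->; split=> //.
    rewrite metM // mxE nrm2M nrm2_uz /rho c2vK nrm2_uz -scalar_mx_block; congr (_%:M).
    have -> : nrm2 (Complex 2^-1 0 : C) = 4^-1 by rewrite /nrm2 /=; field.
    rewrite invfM; ring.
- (* near a point the inverse is the branch of the logarithm centred at it *)
  move=> j z Tz _; rewrite (ej j); set w0 := uexp (z 0 (lshift 1 0)) (z 0 (rshift 1 0)).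
  have oT : open [set: 'rV[R]_(1 + 1)] by exact: openT.
  pose f x := v2c x * kac^-1.
  have sf U : open U -> csmooth U f.
    by move=> oU; apply: csmoothM => //; [exact: smooth_v2c|exact: csmooth_cst].
  pose W := rdom `&` (fun x => complex.Re (f x / w0)) @^-1` [set t | 0 < t].
  have oW : open W.
    apply: open_inter_preim; [exact: open_rdom| |exact: open_gt].
    move=> x _; have [s _] := csmoothM oT (sf _ oT) (csmooth_cst setT w0^-1).
    exact: smooth_on_cont s I.
  pose l x := row_mx (const_mx (ulog (z 0 (rshift 1 0)) w0 (f x)).1)
                     (const_mx (ulog (z 0 (rshift 1 0)) w0 (f x)).2) : 'rV[R]_(1 + 1).
  have eE : chart_map j0 (E z) = c2v (uz z) by rewrite mapN czE.
  have f0 : f (c2v (uz z)) = w0 by rewrite /f c2vK /uz mulrAC mulfV // mul1r.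
  exists W, l; rewrite eE; split=> //.
  + split; first by rewrite /rdom /= c2vK; apply/tubeE.
    by rewrite /preimage /= f0 divff ?uexp_neq0 // ltr01.
  + rewrite /l f0 ulog0 -[RHS]hsubmxK; congr row_mx; apply/rowP => i;
      by rewrite !mxE ord1.
  + have [s1 s2] : smooth_on W (fun x => (ulog (z 0 (rshift 1 0)) w0 (f x)).1) /\
        smooth_on W (fun x => (ulog (z 0 (rshift 1 0)) w0 (f x)).2).
      by apply: smooth_ulog => //; [exact: sf|move=> x []].
    move=> k; case: (split_ordP k) => i ->.
      by rewrite (_ : (fun x => _) = (fun x => (ulog (z 0 (rshift 1 0)) w0 (f x)).1)) // funeqE => x; rewrite row_mxEl mxE.
    by rewrite (_ : (fun x => _) = (fun x => (ulog (z 0 (rshift 1 0)) w0 (f x)).2)) // funeqE => x; rewrite row_mxEr mxE.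
  + move=> x [Vx fx].
    have eu : uz (l x) = v2c x.
      by rewrite /uz /l row_mxEl row_mxEr !mxE ulogK // /f mulrC divfK.
    have Tl : tube Theta (l x) by apply/tubeE; rewrite eu.
    by split=> //; rewrite ?dN // mapN czE // eu -/(c2v _) v2cK.
Qed.

End RotationDomain.

(** * Complex projective space *)

Section HermitianForm.
Variable R : realType.
Local Notation C := (R[i]).
Variable n : nat.
Implicit Types (Z V W : 'rV[C]_n) (a b : C).

Lemma cJD a b : conjc (a + b) = conjc a + conjc b.
Proof. exact: rmorphD. Qed.

Lemma cJN a : conjc (- a) = - conjc a.
Proof. exact: rmorphN. Qed.

Lemma cJM a b : conjc (a * b) = conjc a * conjc b.
Proof. exact: rmorphM. Qed.

Lemma cJV a : conjc a^-1 = (conjc a)^-1.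
Proof. exact: fmorphV. Qed.

Lemma hdotDl V V' W : hdot (V + V') W = hdot V W + hdot V' W.
Proof. by rewrite /hdot -big_split; apply: eq_bigr => k _; rewrite mxE mulrDl. Qed.

Lemma hdotZl a V W : hdot (a *: V) W = a * hdot V W.
Proof. by rewrite /hdot mulr_sumr; apply: eq_bigr => k _; rewrite mxE mulrA. Qed.

Lemma hdotC V W : hdot W V = conjc (hdot V W).
Proof.
rewrite /hdot rmorph_sum; apply: eq_bigr => k _.
by rewrite rmorphM /= conjcK mulrC.
Qed.

Lemma hdotDr V W W' : hdot V (W + W') = hdot V W + hdot V W'.
Proof. by rewrite hdotC hdotDl cJD -!hdotC. Qed.

Lemma hdotZr a V W : hdot V (a *: W) = conjc a * hdot V W.
Proof. by rewrite hdotC hdotZl cJM -hdotC. Qed.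

Definition nrm2v V : R := \sum_k nrm2 (V 0 k).

Lemma hdot_nrm2v V : hdot V V = (nrm2v V)%:C%C.
Proof. by rewrite /hdot rmorph_sum; apply: eq_bigr => k _; rewrite mulcJ. Qed.

Lemma nrm2v_ge0 V : 0 <= nrm2v V.
Proof. by apply: sumr_ge0 => k _; exact: nrm2_ge0. Qed.

Lemma nrm2v_eq0 V : (nrm2v V == 0) = (V == 0).
Proof.
apply/eqP/eqP => [h|->]; last first.
  by rewrite /nrm2v big1 // => k _; apply/eqP; rewrite nrm2_eq0 mxE.
apply/rowP => k; rewrite mxE; apply/eqP; rewrite -nrm2_eq0; apply/eqP.
exact: (psumr_eq0P (fun k _ => nrm2_ge0 (V 0 k)) h).
Qed.

Lemma nrm2v_gt0 V : V != 0 -> 0 < nrm2v V.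
Proof. by rewrite lt0r nrm2v_eq0 nrm2v_ge0 andbT. Qed.

Lemma nrm2vZ a V : nrm2v (a *: V) = nrm2 a * nrm2v V.
Proof. by rewrite /nrm2v mulr_sumr; apply: eq_bigr => k _; rewrite mxE nrm2M. Qed.

Lemma conjc_real (r : R) : conjc r%:C%C = r%:C%C :> C.
Proof. by apply: Complex_eq; rewrite /= ?oppr0. Qed.

(** From the nonnegative norm of |Z|^2 V - <V, Z> Z. *)
Lemma cauchy_schwarz V Z : nrm2 (hdot V Z) <= nrm2v V * nrm2v Z.
Proof.
have [->|Z0] := eqVneq Z 0.
  rewrite (_ : hdot V 0 = 0).
    by rewrite (eqP (_ : nrm2 0 == 0)) ?nrm2_eq0 // mulr_ge0 ?nrm2v_ge0.
  by rewrite -(scale0r V) hdotZr conjc0 mul0r.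
have z0 := nrm2v_gt0 Z0; set c := (nrm2v Z)%:C%C : C; set h := hdot V Z.
have := nrm2v_ge0 (c *: V + (- h) *: Z).
have -> : nrm2v (c *: V + (- h) *: Z) = nrm2v Z * (nrm2v V * nrm2v Z - nrm2 h).
  have : hdot (c *: V + (- h) *: Z) (c *: V + (- h) *: Z) =
      c * ((nrm2v V)%:C%C * c - (nrm2 h)%:C%C).
    rewrite !(hdotDl, hdotDr, hdotZl, hdotZr) hdot_nrm2v hdot_nrm2v.
    by rewrite (hdotC V Z) -/h cJN [conjc c]conjc_real -/c -mulcJ; ring.
  rewrite hdot_nrm2v => /(congr1 (@complex.Re R)) /= ->.
  by rewrite ?(ReM, ReD) /= ; ring.
by rewrite pmulr_rge0 // subr_ge0.
Qed.

(** The Fubini-Study form pulled back to the cone of nonzero vectors. Invariance under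
    scaling and the radial kernel make it independent of the affine chart, so that
    changes of chart, the torus action and the exponential map are all treated as
    lifts to the cone. *)
Definition cone_form Z V W : C :=
  (hdot Z Z * hdot V W - hdot V Z * hdot Z W) / hdot Z Z ^+ 2.

Lemma cone_formDl Z V V' W : cone_form Z (V + V') W = cone_form Z V W + cone_form Z V' W.
Proof. by rewrite /cone_form !hdotDl; ring. Qed.

Lemma cone_formZl Z a V W : cone_form Z (a *: V) W = a * cone_form Z V W.
Proof. by rewrite /cone_form !hdotZl; ring. Qed.

Lemma cone_formC Z V W : cone_form Z W V = conjc (cone_form Z V W).
Proof.
by rewrite /cone_form !expr2 !(cJM, cJV, cJD, cJN) -!hdotC; ring.
Qed.

Lemma cone_formDr Z V W W' : cone_form Z V (W + W') = cone_form Z V W + cone_form Z V W'.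
Proof. by rewrite /cone_form !hdotDr; ring. Qed.

Lemma cone_formZr Z a V W : cone_form Z V (a *: W) = conjc a * cone_form Z V W.
Proof. by rewrite /cone_form !hdotZr; ring. Qed.

(** The radial direction is in the kernel of the form. *)
Lemma cone_form_tangent Z V W a b : Z != 0 ->
  cone_form Z (V + a *: Z) (W + b *: Z) = cone_form Z V W.
Proof.
move=> Z0; rewrite cone_formDl cone_formZl !cone_formDr !cone_formZr.
have e1 U : cone_form Z U Z = 0 by rewrite /cone_form [hdot U Z * _]mulrC subrr mul0r.
have e2 U : cone_form Z Z U = 0 by rewrite /cone_form subrr mul0r.
by rewrite !e1 !e2; ring.
Qed.

Lemma cone_form_scale Z V W c : c != 0 ->
  cone_form (c *: Z) (c *: V) (c *: W) = cone_form Z V W.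
Proof.
move=> c0; have cc0 : conjc c != 0 by rewrite conjc_eq0.
have [e|h0] := eqVneq (hdot Z Z) 0.
  by rewrite /cone_form !hdotZl !hdotZr e !(mulr0, expr0n) !invr0 !mulr0.
by rewrite /cone_form !hdotZl !hdotZr; field; rewrite h0 c0 cc0.
Qed.

Lemma cone_form_pos Z V : Z != 0 -> (nrm2 (hdot V Z) < nrm2v V * nrm2v Z) ->
  0 < complex.Re (cone_form Z V V).
Proof.
move=> Z0 lt; rewrite /cone_form (hdotC V Z) mulcJ !hdot_nrm2v.
rewrite -!(rmorphM, rmorphXn, rmorphB, fmorphV) /=.
by rewrite divr_gt0 ?exprn_gt0 ?nrm2v_gt0 // subr_gt0 mulrC.
Qed.

End HermitianForm.

Section AffineCharts.
Variables (R : realType) (n : nat).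
Local Notation C := (R[i]).
Local Notation P := (proj_space R n).
Implicit Types (Z : 'rV[C]_n.+1) (z : 'rV[C]_n) (j : 'I_n.+1) (p q : P).

Definition affine j Z : 'rV[C]_n := \row_k (Z 0 (lift j k) / Z 0 j).

(** The affine coordinates of a chart with the j-th homogeneous coordinate [e] put
    back: [e = 1] for points, [e = 0] for tangent vectors. *)
Definition incl (e : C) j z : 'rV[C]_n.+1 :=
  \row_k (if unlift j k is Some l then z 0 l else e).

Lemma incl_j e j z : incl e j z 0 j = e.
Proof. by rewrite mxE unlift_none. Qed.

Lemma incl_lift e j z k : incl e j z 0 (lift j k) = z 0 k.
Proof. by rewrite mxE liftK. Qed.

Lemma incl_neq0 j z : incl 1 j z != 0.
Proof.
apply/eqP => /rowP/(_ j); rewrite incl_j mxE => /eqP; by rewrite oner_eq0.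
Qed.

Lemma affine_incl j z : affine j (incl 1 j z) = z.
Proof. by apply/rowP => k; rewrite mxE incl_j incl_lift divr1. Qed.

Lemma incl_affine j Z : Z 0 j != 0 -> incl 1 j (affine j Z) = (Z 0 j)^-1 *: Z.
Proof.
move=> Zj; apply/rowP => k; rewrite mxE [RHS]mxE.
case: unliftP => [l ->|->]; last by rewrite mulVf.
by rewrite mxE mulrC.
Qed.

Lemma affineZ j (l : C) Z : l != 0 -> affine j (l *: Z) = affine j Z.
Proof.
move=> l0; apply/rowP => k; rewrite !mxE.
by rewrite invfM mulrACA mulfV // mul1r.
Qed.

Lemma hdot_incl e e' j z w : hdot (incl e j z) (incl e' j w) = e * conjc e' + hdot z w.
Proof.
rewrite /hdot (bigD1_ord j) //= !incl_j; congr (_ + _).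
by apply: eq_bigr => k _; rewrite !incl_lift.
Qed.

(** Lines are handled through any spanning vector, as the representative [homog p] is
    chosen by the quotient. *)
Definition spans p Z := exists2 l : C, l != 0 & homog p = l *: Z.

Lemma spans_homog p : spans p (homog p).
Proof. by exists 1; rewrite ?oner_eq0 ?scale1r. Qed.

Lemma homog_neq0 p : homog p != 0.
Proof. exact: (valP (repr p)). Qed.

Lemma spans_pi (Z : nonzero R n) : spans (\pi_(P) Z)%qT (val Z).
Proof.
have /eqmodP : ((repr (\pi_(P) Z)) = Z %[mod P])%qT by rewrite reprK.
rewrite /= /same_line => /andP[/sub_rVP[l e] _]; exists l => //.
by apply: contraNneq (homog_neq0 (\pi_(P) Z)%qT) => l0; rewrite /homog e l0 scale0r.
Qed.

Lemma spans_eq p q Z : spans p Z -> spans q Z -> p = q.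
Proof.
move=> [l l0 pZ] [l' l0' qZ]; rewrite -[p]reprK -[q]reprK; apply/eqmodP.
rewrite /= /same_line; rewrite /homog in pZ qZ; rewrite pZ qZ.
apply/eqmxP; apply: (eqmx_trans (eqmx_scale _ l0)).
exact: eqmx_sym (eqmx_scale _ l0').
Qed.

Lemma spansZ p Z (l : C) : l != 0 -> spans p (l *: Z) <-> spans p Z.
Proof.
move=> l0; split=> -[m m0 e].
  by exists (m * l); rewrite ?mulf_neq0 // e scalerA.
by exists (m / l); rewrite ?mulf_neq0 ?invr_eq0 // e scalerA divfK.
Qed.

Lemma line_subproof : (const_mx 1 : 'rV[C]_n.+1) != 0.
Proof. by apply/eqP => /rowP/(_ ord0); rewrite !mxE => /eqP; rewrite oner_eq0. Qed.

Definition base_vector : nonzero R n :=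
  exist (fun z : 'rV[C]_n.+1 => z != 0) _ line_subproof.

Definition line Z : P := (\pi_(P) (insubd base_vector Z))%qT.

Lemma spans_line Z : Z != 0 -> spans (line Z) Z.
Proof.
move=> Z0; have := spans_pi (insubd base_vector Z).
by rewrite val_insubd Z0.
Qed.

Variable c : R.
Local Notation PC := (projective n c).

Lemma spans_dom p Z j : spans p Z -> @chart_dom _ _ PC j p <-> Z 0 j != 0.
Proof.
move=> [l l0 e]; rewrite /= e mxE; split; last by move=> ?; rewrite mulf_neq0.
by apply: contraNneq => ->; rewrite mulr0.
Qed.

Lemma spans_map p Z j : spans p Z -> @chart_map _ _ PC j p = realify (affine j Z).
Proof. by move=> [l l0 e]; rewrite /= -(affineZ j Z l0) -e. Qed.

Lemma proj_dom_spans (j : chart PC) (p : PC) : chart_dom j p ->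
  spans p (incl 1 j (complexify (chart_map j p))).
Proof.
move=> jp; rewrite (spans_map j (spans_homog p)) realifyK incl_affine //.
by apply/spansZ; [rewrite invr_eq0|exact: spans_homog].
Qed.

Lemma proj_inj : inj_charts PC.
Proof.
move=> j p q; rewrite !inE => jp jq e.
by apply: (spans_eq (proj_dom_spans jp)); rewrite e; exact: proj_dom_spans.
Qed.

Lemma proj_chart_point (j : chart PC) (x : 'rV[R]_(n + n)) : exists q : PC,
  [/\ chart_dom j q, chart_map j q = x & spans q (incl 1 j (complexify x))].
Proof.
have s := spans_line (incl_neq0 j (complexify x)).
exists (line (incl 1 j (complexify x))); split=> //.
  by apply/(spans_dom j s); rewrite incl_j oner_eq0.
by rewrite (spans_map j s) affine_incl complexifyK.
Qed.

Lemma proj_cod (j : chart PC) : chart_cod j = setT.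
Proof. by apply/seteqP; split=> // x _; have [q [jq e _]] := proj_chart_point j x; exists q. Qed.

Lemma proj_cover (p : PC) : exists j : chart PC, chart_dom j p.
Proof.
have [j h] : exists j, homog p 0 j != 0; last by exists j.
apply: contrapT => h; have /eqP := homog_neq0 p; apply; apply/rowP => j.
by rewrite mxE; apply/eqP; apply: contrapT => /negP hj; apply: h; exists j.
Qed.

(** The coordinate 1 of the point and 0 of the vectors turn the Hermitian products of
    the cone into the 1 + |z|^2, <v, w> and <v, z> of the affine formula. *)
Lemma fubini_study_cone j z v w : fubini_study c z v w =
  4 / c * complex.Re (cone_form (incl 1 j z) (incl 0 j v) (incl 0 j w)).
Proof.
by rewrite /fubini_study /cone_form !hdot_incl conjc1 conjc0 mul1r !mul0r !mulr0 !add0r.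
Qed.

Lemma complexifyP (a : R) (u v : 'rV[R]_(n + n)) :
  complexify (a *: u + v) = a%:C%C *: complexify u + complexify v :> 'rV[C]_n.
Proof.
apply/rowP => k; rewrite !mxE.
by apply: Complex_eq; rewrite ?(ReD, ImD, ReM, ImM) /= ?mul0r ?subr0 ?addr0.
Qed.

Lemma inclP j (a : C) (u v : 'rV[C]_n) : incl 0 j (a *: u + v) = a *: incl 0 j u + incl 0 j v.
Proof.
by apply/rowP => k; rewrite !mxE; case: unlift => [l|]; rewrite ?mxE // mulr0 addr0.
Qed.

(** A bilinear form is recovered from its matrix, as the metric is only given by its
    entries. *)
Lemma linear_sum_delta m (f : 'rV[R]_m -> R) (u : 'rV[R]_m) :
  (forall a v w, f (a *: v + w) = a * f v + f w) -> f u = \sum_k u 0 k * f (delta_mx 0 k).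
Proof.
move=> fl; have f0 : f 0 = 0 by have := fl (-1) 0 0; rewrite scaler0 addr0; lra.
rewrite {1}(row_sum_delta u); elim/big_rec2: _ => [//|k y v _ <-].
exact: fl.
Qed.

Lemma proj_metric_bilinear (j : chart PC) x (u v : 'rV[R]_(n + n)) :
  (u *m @kmetric _ _ PC j x *m v^T) 0 0 =
  fubini_study c (complexify x) (complexify u) (complexify v).
Proof.
rewrite (@linear_sum_delta _ (fun u => fubini_study c (complexify x) (complexify u) (complexify v))).
  rewrite mxE; under eq_bigr do rewrite mxE mulr_suml.
  rewrite exchange_big /=; apply: eq_bigr => k _.
  rewrite (@linear_sum_delta _ (fun v => fubini_study c (complexify x) (complexify (delta_mx 0 k)) (complexify v))).
    by rewrite mulr_sumr; apply: eq_bigr => l _; rewrite !mxE; ring.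
  move=> a v' w; rewrite !(fubini_study_cone j) complexifyP inclP cone_formDr cone_formZr.
  by rewrite conjc_real ReD ReM /= mul0r subr0; ring.
move=> a v' w; rewrite !(fubini_study_cone j) complexifyP inclP cone_formDl cone_formZl.
by rewrite ReD ReM /= mul0r subr0; ring.
Qed.

(** * Maps into projective space given by a lift to the cone *)

Section Lift.
Variables (d : nat) (U : set 'rV[R]_d) (Z : 'rV[R]_d -> 'rV[C]_n.+1).
Hypothesis oU : open U.
Hypothesis sZ : forall k, csmooth U (fun x => Z x 0 k).

Definition lift_dom j := U `&` [set x | Z x 0 j != 0].
Definition lift_map j x : 'rV[R]_(n + n) := realify (affine j (Z x)).
Definition dlift x a : 'rV[C]_n.+1 := \row_k cpartial a (fun y => Z y 0 k) x.

Lemma open_lift_dom j : open (lift_dom j).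
Proof. exact: csmooth_open_neq0. Qed.

Lemma smooth_lift_map j : smooth_vec (lift_dom j) (lift_map j).
Proof.
have sub : lift_dom j `<=` U by exact: subIsetl.
apply: smooth_realify => k; rewrite (_ : (fun x => _) = (fun x => Z x 0 (lift j k) * (Z x 0 j)^-1)).
  apply: csmoothM; [exact: open_lift_dom|exact: csmooth_sub sub (sZ _)|].
  apply: csmoothV; [exact: open_lift_dom|by move=> x []|exact: csmooth_sub sub (sZ _)].
by rewrite funeqE => x; rewrite mxE.
Qed.

Lemma lift_local_rep (M : premanifold R d) (f : M -> PC) (i : chart M) (j : chart PC) :
  (forall x, U x -> exists q : M, [/\ chart_dom i q, chart_map i q = x & spans (f q) (Z x)]) ->
  local_rep f i j (lift_dom j) (lift_map j).
Proof.
move=> h; split; first exact: open_lift_dom.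
move=> x [/h[q [iq qx fq]] Zj]; exists q; split=> //.
  exact/(spans_dom j fq).
exact: spans_map.
Qed.

Lemma cpartial_affine j x a k : lift_dom j x ->
  cpartial a (fun y => affine j (Z y) 0 k) x =
  (Z x 0 j)^-1 * dlift x a 0 (lift j k) - dlift x a 0 j / Z x 0 j ^+ 2 * Z x 0 (lift j k).
Proof.
move=> [Ux Zj]; apply: cderive_cpartial.
have := cderive_div Zj (csmooth_cderive a (sZ (lift j k)) Ux) (csmooth_cderive a (sZ j) Ux).
rewrite (_ : (fun y => affine j (Z y) 0 k) = (fun y => Z y 0 (lift j k) / Z y 0 j)).
  by congr (cderive _ _ _ _); rewrite !mxE; ring.
by rewrite funeqE => y; rewrite mxE.
Qed.

(** The derivative of the affine coordinates is, up to the factor Z_j and a radial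
    vector, the derivative of the lift, and the form of the cone ignores both. *)
Lemma lift_metric j x : lift_dom j x ->
  let T := jac (lift_map j) x in
  T *m @kmetric _ _ PC j (lift_map j x) *m T^T =
  \matrix_(a, b) (4 / c * complex.Re (cone_form (Z x) (dlift x a) (dlift x b))).
Proof.
move=> jx T; have [Ux Zj] := jx; apply/matrixP => a b.
have -> : (T *m @kmetric _ _ PC j (lift_map j x) *m T^T) a b =
    (row a T *m @kmetric _ _ PC j (lift_map j x) *m (row b T)^T) 0 0.
  rewrite !mxE; apply: eq_bigr => l _; rewrite !mxE; congr (_ * _).
  by apply: eq_bigr => k _; rewrite !mxE.
rewrite proj_metric_bilinear (fubini_study_cone j) [RHS]mxE; congr (_ * complex.Re _).
have Z0 : Z x != 0 by apply: contraNneq Zj => ->; rewrite mxE.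
have tE e : incl 0 j (complexify (row e T)) =
    (Z x 0 j)^-1 *: (dlift x e + (- (dlift x e 0 j / Z x 0 j)) *: Z x).
  have cT : complexify (row e T) = \row_k cpartial e (fun y => affine j (Z y) 0 k) x.
    apply/rowP => k; rewrite [LHS]mxE [RHS]mxE; apply: Complex_eq => /=.
      by rewrite 2!mxE /T /lift_map jac_realify row_mxEl mxE.
    by rewrite 2!mxE /T /lift_map jac_realify row_mxEr mxE.
  apply/rowP => k; rewrite cT mxE [RHS]mxE [in RHS]mxE.
  case: unliftP => [l ->|->].
    by rewrite mxE cpartial_affine // [(_ *: Z x) _ _]mxE; field.
  by rewrite [(_ *: Z x) _ _]mxE; field.
rewrite !tE /lift_map realifyK incl_affine // cone_form_scale ?invr_eq0 //.
exact: cone_form_tangent.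
Qed.

End Lift.

Lemma lift_endo m (U : set 'rV[R]_(m + m)) (Z : 'rV[R]_(m + m) -> 'rV[C]_n.+1) j x :
  open U -> (forall k, csmooth U (fun x => Z x 0 k)) ->
  (forall a, dlift Z x (rshift m a) = Complex 0 1 *: dlift Z x (lshift m a)) ->
  lift_dom U Z j x ->
  std_cplx R m *m jac (lift_map Z j) x = jac (lift_map Z j) x *m std_cplx R n.
Proof.
move=> oU sZ cr jx; apply: jac_std_cplx => a k.
rewrite !(cpartial_affine _ _ _ jx) // cr.
have e l : (Complex 0 1 *: dlift Z x (lshift m a)) 0 l = Complex 0 1 * dlift Z x (lshift m a) 0 l.
  by rewrite mxE.
by rewrite !e; ring.
Qed.

End AffineCharts.

(** * The Kaehler structure of projective space *)

Section ProjectiveKaehler.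
Variables (R : realType) (n : nat) (c : R).
Hypothesis c0 : 0 < c.
Local Notation C := (R[i]).
Local Notation PC := (projective n c).
Implicit Types (j : chart PC) (x : 'rV[R]_(n + n)) (a b : 'I_(n + n)).

Let oT : open [set: 'rV[R]_(n + n)] := openT.

Definition chart_lift j x : 'rV[C]_n.+1 := incl 1 j (complexify x).
Definition cbase a : 'rV[C]_n := complexify (delta_mx 0 a).

Lemma csmooth_chart_lift U j k : csmooth U (fun x => chart_lift j x 0 k).
Proof.
case: (unliftP j k) => [l ->|->].
  rewrite (_ : (fun x => _) = (fun x : 'rV[R]_(n + n) => complexify x 0 l)).
    exact: csmooth_complexify.
  by rewrite funeqE => x; rewrite /chart_lift incl_lift.
rewrite (_ : (fun x => _) = (fun=> 1)); first exact: csmooth_cst.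
by rewrite funeqE => x; rewrite /chart_lift incl_j.
Qed.

Lemma cderive_chart_lift j x v k :
  cderive x v (fun y => chart_lift j y 0 k) (incl 0 j (complexify v) 0 k).
Proof.
case: (unliftP j k) => [l ->|->].
  rewrite incl_lift (_ : (fun x => _) = (fun x : 'rV[R]_(n + n) => complexify x 0 l)).
    exact: cderive_complexify.
  by rewrite funeqE => y; rewrite /chart_lift incl_lift.
rewrite incl_j (_ : (fun x => _) = (fun=> 1)); first exact: cderive_cst.
by rewrite funeqE => y; rewrite /chart_lift incl_j.
Qed.

Lemma dlift_chart j x a : dlift (chart_lift j) x a = incl 0 j (cbase a).
Proof. by apply/rowP => k; rewrite mxE; apply: cderive_cpartial; exact: cderive_chart_lift. Qed.

Lemma cbase_rshift (l : 'I_n) : cbase (rshift n l) = Complex 0 1 *: cbase (lshift n l).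
Proof.
apply/rowP => k; rewrite !mxE.
rewrite !eq_shift; apply: Complex_eq; rewrite ?ReM ?ImM /=; ring.
Qed.

Lemma inclZ j (e : C) (z : 'rV[C]_n) : incl 0 j (e *: z) = e *: incl 0 j z.
Proof. by apply/rowP => k; rewrite !mxE; case: unlift => [l|]; rewrite ?mxE ?mulr0. Qed.

Lemma chart_lift_cr j x (l : 'I_n) :
  dlift (chart_lift j) x (rshift n l) = Complex 0 1 *: dlift (chart_lift j) x (lshift n l).
Proof. by rewrite !dlift_chart cbase_rshift inclZ. Qed.

Lemma chart_lift_rep i j :
  local_rep (fun p : PC => p) i j (lift_dom setT (chart_lift i) j) (lift_map (chart_lift i) j).
Proof.
apply: lift_local_rep => //; first by move=> k; exact: csmooth_chart_lift.
by move=> x _; have [q [iq qx s]] := proj_chart_point i x; exists q.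
Qed.

Lemma chart_lift_dom i j (p : PC) : chart_dom i p -> chart_dom j p ->
  lift_dom setT (chart_lift i) j (chart_map i p).
Proof.
by move=> ip jp; split=> //; apply/(spans_dom c j (proj_dom_spans ip)).
Qed.

Lemma chart_lift_map i j (p : PC) : chart_dom i p ->
  chart_map j p = lift_map (chart_lift i) j (chart_map i p).
Proof. by move=> ip; exact: (spans_map c j (proj_dom_spans ip)). Qed.

Lemma proj_smooth_id : smooth_map (fun p : PC => p).
Proof.
apply: (local_rep_smooth (@proj_inj _ _ c)) => i j p ip jp.
exists (lift_dom setT (chart_lift i) j), (lift_map (chart_lift i) j); split.
- exact: chart_lift_dom.
- exact: chart_lift_rep.
- by apply: smooth_lift_map => // k; exact: csmooth_chart_lift.
Qed.

Lemma csmooth_hdot m d (U : set 'rV[R]_d) (V W : 'rV[R]_d -> 'rV[C]_m) : open U ->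
  (forall k, csmooth U (fun y => V y 0 k)) -> (forall k, csmooth U (fun y => W y 0 k)) ->
  csmooth U (fun y => hdot (V y) (W y)).
Proof.
move=> oU sV sW.
exact (csmooth_sum _ _ oU (fun k => csmoothM oU (sV k) (csmooth_conj oU (sW k)))).
Qed.

Lemma metric_coneE j x a b : @kmetric _ _ PC j x a b =
  4 / c * complex.Re (cone_form (chart_lift j x) (incl 0 j (cbase a)) (incl 0 j (cbase b))).
Proof. by rewrite mxE (fubini_study_cone c j). Qed.

Lemma smooth_proj_metric j : smooth_mx setT (@kmetric _ _ PC j).
Proof.
move=> a b; pose Z := chart_lift j.
have sZ k : csmooth setT (fun x => Z x 0 k) by exact: csmooth_chart_lift.
have sc (V : 'rV[C]_n.+1) k : csmooth [set: 'rV[R]_(n + n)] (fun=> V 0 k) by exact: csmooth_cst.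
have sZZ := csmooth_hdot oT sZ sZ.
have sV := csmooth_hdot oT (sc (incl 0 j (cbase a))) sZ.
have sW := csmooth_hdot oT sZ (sc (incl 0 j (cbase b))).
have sN := csmoothD oT (csmoothM oT sZZ
    (csmooth_cst setT (hdot (incl 0 j (cbase a)) (incl 0 j (cbase b)))))
  (csmoothM oT (csmooth_cst setT (-1)) (csmoothM oT sV sW)).
have d0 y : setT y -> hdot (Z y) (Z y) * hdot (Z y) (Z y) != 0.
  move=> _; rewrite mulf_neq0 // hdot_nrm2v -nrm2_eq0 nrm2_real expf_neq0 //;
    by rewrite nrm2v_eq0 incl_neq0.
have s : csmooth setT (fun y => cone_form (Z y) (incl 0 j (cbase a)) (incl 0 j (cbase b))).
  refine (csmooth_eq oT _ (csmoothM oT sN (csmoothV oT d0 (csmoothM oT sZZ sZZ)))).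
  by move=> y _; rewrite /cone_form mulN1r expr2.
have [s1 _] := s.
refine (smooth_on_eq oT _ (smooth_onM oT (smooth_on_cst (4 / c)) s1)).
by move=> x _; rewrite metric_coneE.
Qed.

Lemma proj_metric_cone j x : @kmetric _ _ PC j x = \matrix_(a, b) (4 / c *
  complex.Re (cone_form (chart_lift j x) (dlift (chart_lift j) x a) (dlift (chart_lift j) x b))).
Proof. by apply/matrixP => a b; rewrite metric_coneE mxE !dlift_chart. Qed.

(** Cauchy-Schwarz is strict here, because the vector of the cone over v has a vanishing
    coordinate where the one over z has the coordinate 1. *)
Lemma fubini_pos z v : v != 0 -> 0 < fubini_study c (z : 'rV[C]_n) v v.
Proof.
move=> v0; rewrite (fubini_study_cone c ord0) mulr_gt0 ?divr_gt0 ?ltr0n //.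
apply: cone_form_pos; first exact: incl_neq0.
have nE (e : C) w : nrm2v (incl e (ord0 : 'I_n.+1) w) = nrm2 e + nrm2v w.
  have : (nrm2v (incl e (ord0 : 'I_n.+1) w))%:C%C = (nrm2 e + nrm2v w)%:C%C :> C.
    by rewrite -hdot_nrm2v hdot_incl mulcJ hdot_nrm2v -rmorphD.
  by case.
rewrite hdot_incl mul0r add0r !nE (le_lt_trans (cauchy_schwarz v z)) //.
have n00 : nrm2 (0 : C) = 0 by apply/eqP; rewrite nrm2_eq0.
have n01 : nrm2 (1 : C) = 1 by rewrite /nrm2 /= expr1n expr0n addr0.
by rewrite n00 n01 add0r mulrDr mulr1 ltrDr nrm2v_gt0.
Qed.

Lemma complexify_eq0 x : (complexify x == 0 :> 'rV[C]_n) = (x == 0).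
Proof.
apply/eqP/eqP => [h|->]; last first.
  by apply/rowP => k; rewrite !mxE; exact: Complex_eq.
rewrite -[x]complexifyK h; apply/rowP => k; case: (split_ordP k) => l ->;
  by rewrite ?row_mxEl ?row_mxEr !mxE.
Qed.

Lemma proj_is_metric : is_metric (@kmetric _ _ PC).
Proof.
split.
- by move=> j a b; rewrite proj_cod; exact: smooth_proj_metric.
- move=> i j p ip jp; cbv zeta; have Wp := chart_lift_dom ip jp.
  rewrite (local_rep_dmap (@proj_inj _ _ c) (chart_lift_rep i j) Wp).
  rewrite (chart_lift_map j ip).
  have -> := @lift_metric R n c _ setT (chart_lift i) (csmooth_chart_lift setT i) j _ Wp.
  exact: proj_metric_cone.
- move=> j x _; split=> [|v v0].
    apply/matrixP => a b; rewrite mxE !metric_coneE cone_formC.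
    by case: (cone_form _ _ _).
  by rewrite proj_metric_bilinear; apply: fubini_pos; rewrite complexify_eq0.
Qed.

Lemma complexify_std v : complexify (v *m std_cplx R n) = Complex 0 1 *: complexify v :> 'rV[C]_n.
Proof.
rewrite -{1}[v]hsubmxK mul_row_block !mulmx0 mulmxN !mulmx1 add0r addr0.
apply/rowP => k; rewrite mxE row_mxKl row_mxKr !mxE.
by apply: Complex_eq; rewrite ?ReM ?ImM /=; ring.
Qed.

Lemma complexify_row_std a : complexify (row a (std_cplx R n)) = Complex 0 1 *: cbase a.
Proof. by rewrite rowE complexify_std. Qed.

Lemma row_form m (A G B : 'M[R]_m) (a b : 'I_m) :
  (A *m G *m B^T) a b = (row a A *m G *m (row b B)^T) 0 0.
Proof.
rewrite !mxE; apply: eq_bigr => l _; rewrite !mxE; congr (_ * _).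
by apply: eq_bigr => k _; rewrite !mxE.
Qed.

Lemma proj_metric_hermitian j x :
  std_cplx R n *m @kmetric _ _ PC j x *m (std_cplx R n)^T = kmetric j x.
Proof.
apply/matrixP => a b; rewrite row_form proj_metric_bilinear !complexify_row_std.
rewrite mxE !(fubini_study_cone c j) !inclZ cone_formZl cone_formZr; congr (_ * _).
rewrite mulrA (_ : Complex 0 1 * conjc (Complex 0 1) = 1 :> C) ?mul1r //.
by apply: Complex_eq; rewrite ?ReM ?ImM /=; ring.
Qed.

Let hz a x := hdot (cbase a) (complexify x).
Let sq x : R := 1 + nrm2v (complexify x : 'rV[C]_n).
Let ga a b := hdot (cbase a) (cbase b).

Lemma sq_gt0 x : 0 < sq x.
Proof. by rewrite ltr_pwDl ?nrm2v_ge0. Qed.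

(** Written with the products <d_a, z>, whose derivatives are the constants <d_a, d_b>,
    so that closedness becomes an identity between rational functions. *)
Lemma proj_form j x a b : (std_cplx R n *m @kmetric _ _ PC j x) a b =
  - (4 / c) * ((sq x * complex.Im (ga a b) - complex.Im (hz a x) * complex.Re (hz b x)
     + complex.Re (hz a x) * complex.Im (hz b x)) * (sq x * sq x)^-1).
Proof.
have -> : (std_cplx R n *m @kmetric _ _ PC j x) a b =
    (std_cplx R n *m @kmetric _ _ PC j x *m (1%:M)^T) a b by rewrite trmx1 mulmx1.
rewrite row_form proj_metric_bilinear complexify_row_std rowE mulmx1.
rewrite -/(cbase b) /fubini_study !hdotZl (hdotC (cbase b) (complexify x)) -/(hz a x) -/(hz b x) -/(ga a b).
have -> : 1 + hdot (complexify x) (complexify x) = (sq x)%:C%C :> C.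
  by rewrite hdot_nrm2v /sq rmorphD.
rewrite expr2 -rmorphM -fmorphV /=.
move: (sq x * sq x)^-1 => q; move: (hz a x) (hz b x) (ga a b) => [u1 u2] [w1 w2] [g1 g2].
by rewrite !(ReM, ImM, ReD, ImD) /=; ring.
Qed.

Lemma is_derive_hz x v a : cderive x v (hz a) (hdot (cbase a) (complexify v)).
Proof.
apply: cderive_sum => k.
have dc : cderive x v (fun y => conjc (complexify y 0 k : C)) (conjc (complexify v 0 k)).
  have [d1 d2] := cderive_complexify x v k; split.
    rewrite (_ : complex.Re _ = complex.Re (complexify v 0 k)); last by case: (complexify v 0 k).
    rewrite (_ : (fun y => _) = (fun y => complex.Re (complexify y 0 k))) //.
    by rewrite funeqE => y; case: (complexify y 0 k).
  rewrite (_ : complex.Im _ = - complex.Im (complexify v 0 k)); last by case: (complexify v 0 k).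
  rewrite (_ : (fun y => _) = (fun y => - complex.Im (complexify y 0 k))); first exact: is_deriveN.
  by rewrite funeqE => y; case: (complexify y 0 k).
have := cderiveM (cderive_cst x v (cbase a 0 k)) dc.
by rewrite mulr0 addr0.
Qed.

Lemma is_derive_sq x a : is_derive x (delta_mx 0 a) sq (2 * complex.Re (hz a x)).
Proof.
have h k : is_derive x (delta_mx 0 a) (fun y => nrm2 (complexify y 0 k))
    (2 * complex.Re (cbase a 0 k * conjc (complexify x 0 k))).
  have [d1 d2] := cderive_complexify x (delta_mx 0 a) k.
  apply: (is_derive_eq (is_deriveD (is_deriveM d1 d1) (is_deriveM d2 d2))).
  rewrite /GRing.scale /= -/(cbase a); move: (cbase a 0 k) (complexify x 0 k) => [p q] [r s] /=.
  by ring.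
have hs := is_derive_sum h.
apply: (is_derive_eq (_ : is_derive x (delta_mx 0 a) sq (0 + \sum_k 2 * complex.Re (cbase a 0 k * conjc (complexify x 0 k))))).
  rewrite (_ : sq = cst 1 + (\sum_k (fun y => nrm2 (complexify y 0 k : C)))).
    exact: is_deriveD.
  by rewrite funeqE => y; rewrite /sq /nrm2v fctE fct_sumE.
rewrite add0r -mulr_sumr; congr (_ * _); rewrite /hz /hdot.
by elim/big_rec2: _ => // k y1 y2 _ ->; rewrite ReD.
Qed.

Lemma partial_proj_form j x a b k :
  partial k (fun y => (std_cplx R n *m @kmetric _ _ PC j y) a b) x =
  - (4 / c) * ((2 * complex.Re (hz k x) * complex.Im (ga a b)
     - (complex.Im (ga a k) * complex.Re (hz b x) + complex.Im (hz a x) * complex.Re (ga b k))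
     + (complex.Re (ga a k) * complex.Im (hz b x) + complex.Re (hz a x) * complex.Im (ga b k)))
      / (sq x * sq x)
     - 4 * complex.Re (hz k x) * (sq x * complex.Im (ga a b) - complex.Im (hz a x) * complex.Re (hz b x)
        + complex.Re (hz a x) * complex.Im (hz b x)) / (sq x * sq x * sq x)).
Proof.
have [dra dia] := is_derive_hz x (delta_mx 0 k) a; rewrite -/(cbase k) -/(ga a k) in dra dia.
have [drb dib] := is_derive_hz x (delta_mx 0 k) b; rewrite -/(cbase k) -/(ga b k) in drb dib.
have ds := is_derive_sq x k; have s0 : sq x != 0 by rewrite gt_eqF ?sq_gt0.
have dn := is_deriveD (is_deriveB (is_deriveM ds (is_derive_cst (complex.Im (ga a b)) _ _))
   (is_deriveM dia drb)) (is_deriveM dra dib).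
have di : is_derive x (delta_mx 0 k) (fun y => (sq y * sq y)^-1)
    (- (sq x * sq x) ^- 2 * (2 * (sq x * (2 * complex.Re (hz k x))))).
  have [e1 e2] := is_deriveM ds ds; split.
    by apply: derivableV => //; rewrite mulf_neq0.
  rewrite (@deriveV _ _ (fun y => sq y * sq y)) ?mulf_neq0 // e2 /GRing.scale /=.
  by ring.
have [_ e] := is_deriveZ (- (4 / c)) (is_deriveM dn di).
rewrite (_ : (fun y => _) = (- (4 / c)) \*: (((sq * cst (complex.Im (ga a b))
    - (fun y => complex.Im (hz a y)) * (fun y => complex.Re (hz b y)))
    + (fun y => complex.Re (hz a y)) * (fun y => complex.Im (hz b y)))
    * (fun y => (sq y * sq y)^-1))); last first.
  by rewrite funeqE => y; rewrite proj_form.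
rewrite /partial e /GRing.scale /= !fctE; field.
by rewrite s0 gt_eqF.
Qed.

Lemma gaC a b : complex.Re (ga b a) = complex.Re (ga a b) /\
  complex.Im (ga b a) = - complex.Im (ga a b).
Proof. by rewrite /ga (hdotC (cbase a)); case: (hdot _ _). Qed.

Lemma proj_closed j x a b k :
  let w b k y := (std_cplx R n *m @kmetric _ _ PC j y) b k in
  partial a (w b k) x + partial b (w k a) x + partial k (w a b) x = 0.
Proof.
cbv zeta; rewrite !partial_proj_form.
have [ab1 ab2] := gaC a b; have [bk1 bk2] := gaC b k; have [ka1 ka2] := gaC k a.
rewrite ab1 ab2 bk1 bk2 ka1 ka2.
have s0 : sq x != 0 by rewrite gt_eqF ?sq_gt0.
move: (sq x) s0 (hz a x) (hz b x) (hz k x) (ga a b) (ga b k) (ga k a) => s s0 [a1 a2] [b1 b2] [k1 k2] [p1 p2] [q1 q2] [r1 r2] /=.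
by field; rewrite s0 gt_eqF.
Qed.

(** The minors of two vectors vanish together exactly when they span the same line, so
    the normalized sum of their squares separates lines. *)
Definition minors (Q Z : 'rV[C]_n.+1) : R :=
  (\sum_k \sum_l nrm2 (Z 0 k * Q 0 l - Z 0 l * Q 0 k)) / nrm2v Z.

Lemma minorsZ Q Z (e : C) : e != 0 -> minors Q (e *: Z) = minors Q Z.
Proof.
move=> e0; have n0 : nrm2 e != 0 by rewrite nrm2_eq0.
rewrite /minors nrm2vZ (eq_bigr (fun k => nrm2 e * \sum_l nrm2 (Z 0 k * Q 0 l - Z 0 l * Q 0 k))).
  by rewrite -mulr_sumr invfM mulrACA mulfV // mul1r.
move=> k _; rewrite mulr_sumr; apply: eq_bigr => l _.
by rewrite !mxE -nrm2M; congr nrm2; ring.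
Qed.

Lemma minors_self Q : minors Q Q = 0.
Proof.
rewrite /minors big1 ?mul0r // => k _; apply: big1 => l _.
by apply/eqP; rewrite nrm2_eq0 mulrC subrr.
Qed.

Lemma minors_gt0 (p q : PC) : p <> q -> 0 < minors (homog q) (homog p).
Proof.
move=> pq; have Z0 := homog_neq0 p; have [k qk] := proj_cover q.
have m0 i l : 0 <= nrm2 (homog p 0 i * homog q 0 l - homog p 0 l * homog q 0 i) by exact: nrm2_ge0.
rewrite divr_gt0 ?nrm2v_gt0 // lt0r sumr_ge0 ?andbT => [|? _]; last exact: sumr_ge0.
apply/negP => /eqP h; apply: pq.
have e l : homog p 0 l = homog p 0 k / homog q 0 k * homog q 0 l.
  have h1 := psumr_eq0P (fun k _ => sumr_ge0 _ (fun l _ => m0 k l)) h (i := k) isT.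
  have /eqP := psumr_eq0P (fun l _ => m0 k l) h1 (i := l) isT.
  rewrite nrm2_eq0 subr_eq0 => /eqP e; apply: (mulIf qk).
  by rewrite -e mulrAC divfK.
have ep : homog p = (homog p 0 k / homog q 0 k) *: homog q.
  by apply/rowP => l; rewrite mxE -e.
apply: (spans_eq (spans_homog p)); rewrite ep; apply/spansZ; last exact: spans_homog.
by apply: contraNneq Z0 => z; rewrite ep z scale0r.
Qed.

Lemma proj_hausdorff (p q : PC) : p <> q -> exists U V : set PC,
  [/\ mopen U, mopen V, U p, V q & U `&` V = set0].
Proof.
move=> pq; have mpq := minors_gt0 pq.
have [U [V [oU oV Uq Vp UV]]] : exists U V : set PC,
    [/\ mopen U, mopen V, U q, V p & U `&` V = set0]; last first.
  by exists V, U; split=> //; rewrite setIC.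
apply: (separated_by_function (f := fun p : PC => minors (homog q) (homog p))
    (g := fun j x => minors (homog q) (chart_lift j x))).
- by move=> j; rewrite proj_cod.
- move=> j r jr; have [l l0 ->] := proj_dom_spans jr; exact: minorsZ.
- move=> j x _; have sZ k := @csmooth_chart_lift setT j k.
  have s1 : smooth_on setT (fun x => \sum_k \sum_l
      nrm2 (chart_lift j x 0 k * homog q 0 l - chart_lift j x 0 l * homog q 0 k)).
    apply: smooth_on_sum => // k; apply: smooth_on_sum => // l; apply: smooth_nrm2 => //.
    refine (csmooth_eq oT _ (csmoothD oT (csmoothM oT (sZ k) (csmooth_cst _ (homog q 0 l)))
      (csmoothM oT (csmooth_cst _ (- homog q 0 k)) (sZ l)))).
    by move=> y _; ring.
  have s2 : smooth_on setT (fun x => nrm2v (chart_lift j x)).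
    by apply: smooth_on_sum => // k; exact: smooth_nrm2.
  refine (smooth_on_cont (smooth_onM oT s1 (smooth_onV oT _ s2)) (_ : setT x)) => //.
  by move=> y _; rewrite nrm2v_eq0 incl_neq0.
- by rewrite minors_self.
Qed.

Lemma proj_kaehler : is_kaehler PC /\ mconnected PC.
Proof.
split; last first.
  have s := spans_line (line_subproof R n).
  apply: (mconnected_charts (p0 := line (const_mx 1) : PC) (@proj_inj _ _ c)).
  - exact: proj_cover.
  - by move=> j; apply/(spans_dom c j s); rewrite mxE oner_eq0.
  - by move=> j; rewrite proj_cod.
apply: kaehler_std.
- split.
  + exact: proj_cover.
  + exact: proj_inj.
  + exact: proj_smooth_id.
  + exact: proj_hausdorff.
  + apply: (second_countable (ch := fun k : nat => inord k : chart PC)).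
    * exact: proj_inj.
    * by move=> p; have [j jp] := proj_cover p; exists j; rewrite inord_val.
    * exact: proj_smooth_id.
- exact: proj_is_metric.
- by [].
- by move=> j; rewrite proj_cod.
- move=> i j p ip jp /=; have Wp := chart_lift_dom ip jp.
  rewrite (local_rep_dmap (@proj_inj _ _ c) (chart_lift_rep i j) Wp).
  apply: (lift_endo (U := setT)) Wp => //; first by move=> k; exact: csmooth_chart_lift.
  exact: chart_lift_cr.
- by move=> j x _; exact: proj_metric_hermitian.
- by move=> j x _ a b k; exact: proj_closed.
Qed.

End ProjectiveKaehler.

(** * The torus action on projective space *)

Section ProjectiveAction.
Variables (R : realType) (n : nat) (c : R).
Hypothesis c0 : 0 < c.
Local Notation C := (R[i]).
Local Notation PC := (projective n c).
Local Notation Phi := (@projective_action R n c).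
Implicit Types (t s : 'rV[R]_n) (Z V : 'rV[C]_n.+1).

Let oT m : open [set: 'rV[R]_m] := openT.

Lemma rotate_lift t Z (l : 'I_n) :
  rotate t Z 0 (lift ord_max l) = phase (t 0 l) * Z 0 (lift ord_max l).
Proof. by rewrite mxE liftK. Qed.

Lemma rotate_max t Z : rotate t Z 0 ord_max = Z 0 ord_max.
Proof. by rewrite mxE unlift_none. Qed.

Lemma rotateP (Z W : 'rV[C]_n.+1) : (forall l : 'I_n, Z 0 (lift ord_max l) = W 0 (lift ord_max l)) ->
  Z 0 ord_max = W 0 ord_max -> Z = W.
Proof. by move=> h hm; apply/rowP => k; case: (unliftP ord_max k) => [l ->|->]. Qed.

Lemma eq_rotate t s Z : (forall l, phase (t 0 l) = phase (s 0 l)) -> rotate t Z = rotate s Z.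
Proof. by move=> h; apply: rotateP => [l|]; rewrite ?rotate_lift ?rotate_max ?h. Qed.

Lemma rotate_comp t s Z : rotate (t + s) Z = rotate t (rotate s Z).
Proof.
by apply: rotateP => [l|]; rewrite ?rotate_lift ?rotate_max // mxE phaseD mulrA.
Qed.

Lemma rotateZ t (a : C) Z : rotate t (a *: Z) = a *: rotate t Z.
Proof.
by apply: rotateP => [l|]; rewrite [RHS]mxE ?rotate_lift ?rotate_max ?mxE // mulrCA.
Qed.

Lemma hdot_rotate t V (W : 'rV[C]_n.+1) : hdot (rotate t V) (rotate t W) = hdot V W.
Proof.
rewrite /hdot !(bigD1_ord ord_max) //= !rotate_max; congr (_ + _).
apply: eq_bigr => l _; rewrite !rotate_lift cJM mulrACA mulcJ nrm2_phase.
by rewrite rmorph1 mul1r.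
Qed.

Lemma spans_act a (p : PC) Z : spans p Z -> spans (Phi a p) (rotate (repr a) Z).
Proof.
move=> [l l0 e].
have := spans_pi (exist (fun z : 'rV[C]_n.+1 => z != 0) _ (rotate_neq0 (repr a) (repr p))).
rewrite [X in spans _ X](_ : _ = rotate (repr a) (homog p)) // e rotateZ.
by move/(spansZ _ _ l0).
Qed.

Lemma projective_act0 p : Phi 0 p = p.
Proof.
apply: (spans_eq (spans_act 0 (spans_homog p))).
rewrite (_ : rotate _ _ = homog p); first exact: spans_homog.
by apply: rotateP => [l|]; rewrite ?rotate_lift ?rotate_max // phase_repr0 mul1r.
Qed.

Lemma projective_actD a b p : Phi (a + b) p = Phi a (Phi b p).
Proof.
apply: (spans_eq (spans_act (a + b) (spans_homog p))).
have := spans_act a (spans_act b (spans_homog p)).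
by rewrite -rotate_comp; congr spans; apply: eq_rotate => l; rewrite phase_reprD mxE phaseD.
Qed.

Lemma prod_euclid_inj m k (M : premanifold R k) : inj_charts M ->
  inj_charts (prod_mfd (euclid R m) M).
Proof.
move=> iM [i j] [s p] [t q]; rewrite !inE /= => -[_ jp] [_ jq] /eq_row_mx[-> e].
by congr pair; apply: (iM j) e; rewrite inE.
Qed.

Lemma csmooth_rotate d (U : set 'rV[R]_d) (tt : 'rV[R]_d -> 'rV[R]_n) (Z : 'rV[R]_d -> 'rV[C]_n.+1) :
  open U -> (forall l, smooth_on U (fun y => tt y 0 l)) -> (forall k, csmooth U (fun y => Z y 0 k)) ->
  forall k, csmooth U (fun y => rotate (tt y) (Z y) 0 k).
Proof.
move=> oU st sZ k; case: (unliftP ord_max k) => [l ->|->].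
  refine (csmooth_eq oU _ (csmoothM oU (csmooth_phase oU (st l)) (sZ (lift ord_max l)))).
  by move=> y _; rewrite rotate_lift.
by refine (csmooth_eq oU _ (sZ ord_max)) => y _; rewrite rotate_max.
Qed.

Lemma projective_is_action : is_torus_action Phi.
Proof.
split; [exact: projective_act0|exact: projective_actD|].
apply: (local_rep_smooth (prod_euclid_inj (@proj_inj _ _ c))) => -[i0 i] j [t p] [_ ip] jp.
pose Z (y : 'rV[R]_(n + (n + n))) := rotate (lsubmx y) (chart_lift i (rsubmx y)).
have sZ k : csmooth setT (fun y => Z y 0 k).
  apply: csmooth_rotate => // [l|{}k].
    rewrite (_ : (fun y => _) = (fun y : 'rV[R]_(n + (n + n)) => y 0 (lshift (n + n) l))).
      exact: smooth_on_coord.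
    by rewrite funeqE => y; rewrite mxE.
  case: (unliftP i k) => [l ->|->].
    split.
      rewrite (_ : (fun y => _) = (fun y : 'rV[R]_(n + (n + n)) => y 0 (rshift n (lshift n l)))).
        exact: smooth_on_coord.
      by rewrite funeqE => y; rewrite /chart_lift incl_lift !mxE.
    rewrite (_ : (fun y => _) = (fun y : 'rV[R]_(n + (n + n)) => y 0 (rshift n (rshift n l)))).
      exact: smooth_on_coord.
    by rewrite funeqE => y; rewrite /chart_lift incl_lift !mxE.
  rewrite (_ : (fun y => _) = fun=> 1); first exact: csmooth_cst.
  by rewrite funeqE => y; rewrite /chart_lift incl_j.
have hrep y : setT y -> exists q : prod_mfd (euclid R n) PC,
    [/\ @chart_dom R _ (prod_mfd (euclid R n) PC) (i0, i) q,
      @chart_map R _ (prod_mfd (euclid R n) PC) (i0, i) q = y & spans (Phi (tclass q.1) q.2) (Z y)].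
  move=> _; have [q [iq qx sq]] := proj_chart_point i (rsubmx y).
  exists (lsubmx y, q); split=> //; first by rewrite -[RHS]hsubmxK -qx.
  have := spans_act (tclass (lsubmx y)) sq; congr spans.
  by apply: eq_rotate => l; exact: phase_repr.
exists (lift_dom setT Z j), (lift_map Z j); split.
- split=> //; have sp := spans_act (tclass t) (proj_dom_spans ip).
  have /(spans_dom c j sp) := jp; rewrite /Z /= row_mxKl row_mxKr.
  by rewrite (eq_rotate (s := t)) // => l; exact: phase_repr.
- exact: lift_local_rep.
- exact: smooth_lift_map.
Qed.

Lemma cpartial_scale d (a : C) (f : 'rV[R]_d -> C) x l df :
  cderive x (delta_mx 0 l) f df -> cderive x (delta_mx 0 l) (fun y => a * f y) (a * df).
Proof.
by move=> h; have := cderiveM (cderive_cst x (delta_mx 0 l) a) h; rewrite mulr0 addr0.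
Qed.

(** The lift of a rotation to the cone is unitary and complex linear. *)
Lemma projective_isometry a : holo_isometric (Phi a).
Proof.
pose s := repr a; pose Z (i : chart PC) x := rotate s (chart_lift i x).
have sZ i k : csmooth setT (fun y => Z i y 0 k).
  apply: csmooth_rotate => // [l|{}k]; first exact: smooth_on_cst.
  exact: csmooth_chart_lift.
have dZ i x b : dlift (Z i) x b = rotate s (incl 0 i (cbase R b)).
  apply: rotateP => [l|]; rewrite mxE ?rotate_lift ?rotate_max; apply: cderive_cpartial.
    rewrite (_ : (fun y => _) = (fun y => phase (s 0 l) * chart_lift i y 0 (lift ord_max l))).
      by apply: cpartial_scale; exact: cderive_chart_lift.
    by rewrite funeqE => y; rewrite rotate_lift.
  rewrite (_ : (fun y => _) = (fun y => chart_lift i y 0 ord_max)); first exact: cderive_chart_lift.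
  by rewrite funeqE => y; rewrite rotate_max.
have rep i j : local_rep (Phi a) i j (lift_dom setT (Z i) j) (lift_map (Z i) j).
  apply: lift_local_rep => // x _; have [q [iq qx sq]] := proj_chart_point i x.
  by exists q; split=> //; exact: spans_act.
have dom (i j : chart PC) (p : PC) : chart_dom i p -> chart_dom j (Phi a p) ->
    lift_dom setT (Z i) j (chart_map i p).
  by move=> ip jp; split=> //; apply/(spans_dom c j (spans_act a (proj_dom_spans ip))).
have mapE (i j : chart PC) (p : PC) : chart_dom i p ->
    chart_map j (Phi a p) = lift_map (Z i) j (chart_map i p).
  by move=> ip; exact: (spans_map c j (spans_act a (proj_dom_spans ip))).
split.
- apply: (local_rep_smooth (@proj_inj _ _ c)) => i j p ip jp.
  exists (lift_dom setT (Z i) j), (lift_map (Z i) j); split; [exact: dom|exact: rep|].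
  exact: smooth_lift_map.
- move=> i j p ip jp; cbv zeta; have Wp := dom i j p ip jp.
  rewrite (local_rep_dmap (@proj_inj _ _ c) (rep i j) Wp) (mapE i j p ip).
  have -> := @lift_metric R n c _ setT (Z i) (sZ i) j _ Wp.
  rewrite proj_metric_cone; apply/matrixP => b e; rewrite !mxE !dZ !dlift_chart.
  by rewrite /cone_form !hdot_rotate.
- move=> i j p ip jp; cbv zeta; have Wp := dom i j p ip jp.
  rewrite (local_rep_dmap (@proj_inj _ _ c) (rep i j) Wp).
  apply: (lift_endo (U := setT)) Wp => // b.
  by rewrite !dZ cbase_rshift inclZ rotateZ.
Qed.

Lemma phase_half : phase (2^-1) = -1 :> C.
Proof.
have e : 2 * pi * 2^-1 = pi :> R by rewrite mulrAC mulfV ?pnatr_eq0 // mul1r.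
by apply: Complex_eq; rewrite /= e ?cospi ?sinpi ?oppr0.
Qed.

Lemma phase_half_neq1 (t : 'rV[R]_n) l : t 0 l = 2^-1 -> tclass t <> 0.
Proof.
move=> tl e; have := phase_repr t l; rewrite e phase_repr0 tl phase_half => /eqP.
rewrite -subr_eq0 opprK -(natrD _ 1 1) => /eqP/(congr1 (@complex.Re R)) /= /eqP.
by rewrite -(natrD _ 1 1) pnatr_eq0.
Qed.

Hypothesis n0 : (0 < n)%N.

(** A circle turning one vanishing coordinate fixes the point, and so does the diagonal
    circle when the last coordinate vanishes. *)
Lemma projective_freeP p Z : spans p Z -> free_set Phi p <-> forall k, Z 0 k != 0.
Proof.
move=> pZ; have [m m0 hm] := pZ; split=> [fp k|Z0 a ap].
  apply/negP => /eqP Zk; case: (unliftP ord_max k) Zk => [l ->|->] Zk.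
    pose t : 'rV[R]_n := \row_i (if i == l then 2^-1 else 0).
    apply: (@phase_half_neq1 t l); first by rewrite mxE eqxx.
    apply: fp; apply: (spans_eq (spans_act (tclass t) pZ)).
    rewrite (_ : rotate _ _ = Z) //; apply: rotateP => [i|]; rewrite ?rotate_max // rotate_lift.
    rewrite phase_repr mxE; have [->|_] := eqVneq i l; first by rewrite Zk mulr0.
    by rewrite phase0 mul1r.
  (* turning all coordinates but the vanishing one by - 1 rescales the vector *)
  pose t : 'rV[R]_n := const_mx 2^-1.
  apply: (@phase_half_neq1 t (Ordinal n0)); first by rewrite mxE.
  apply: fp; apply: (spans_eq (spans_act (tclass t) pZ)).
  rewrite (_ : rotate _ _ = -1 *: Z); first by apply/spansZ; rewrite ?oppr_eq0 ?oner_eq0.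
  apply: rotateP => [i|]; rewrite [RHS]mxE ?rotate_max ?Zk ?mulr0 // rotate_lift.
  by rewrite phase_repr mxE phase_half.
have := spans_act a pZ; rewrite ap => -[l l0 hl].
have e : m *: Z = l *: rotate (repr a) Z by rewrite -hm -hl.
have ml : m = l.
  by have /rowP/(_ ord_max) := e; rewrite !mxE unlift_none => /(mulIf (Z0 _)).
apply: torus_eq0 => i; have /rowP/(_ (lift ord_max i)) := e.
rewrite mxE [RHS]mxE rotate_lift ml => /(mulfI l0); rewrite -{1}[Z _ _]mul1r.
by move=> /(mulIf (Z0 _)).
Qed.

Lemma projective_free_mopen : mopen (free_set Phi).
Proof.
move=> j; rewrite (_ : _ @` _ = [set x | forall k, chart_lift j x 0 k != 0]).
  rewrite openE => x hx.
  refine (@filter_forall _ _ (fun k y => is_true (chart_lift j y 0 k != 0)) (nbhs x) _ _) => k.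
  have oU := csmooth_open_neq0 openT (csmooth_chart_lift (setT : set 'rV[R]_(n + n)) j k).
  have : nbhs x (setT `&` [set y | chart_lift j y 0 k != 0]).
    by apply: open_nbhs_nbhs; split=> //; split=> //; exact: hx.
  by apply: filterS => y [].
apply/seteqP; split=> [_ [p [jp fp] <-]|x hx].
  exact/(projective_freeP (proj_dom_spans jp)).
have [q [jq qx sq]] := proj_chart_point j x; exists q => //; split=> //.
exact/(projective_freeP sq).
Qed.

Lemma projective_effective : effective Phi.
Proof.
move=> a aall; have s := spans_line (line_subproof R n).
have : free_set Phi (line (const_mx 1) : PC).
  by apply/(projective_freeP s) => k; rewrite mxE oner_eq0.
by apply; exact: aall.
Qed.

(** * Exponential coordinates on projective space *)

(** In these coordinates of the tangent bundle of the natural parameters, the point is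
    [exp z_1 : ... : exp z_n : 1] with the exponents halved. *)
Definition exp_lift (z : 'rV[R]_(n + n)) : 'rV[C]_n.+1 :=
  incl 1 ord_max (\row_l uexp (z 0 (lshift n l)) (z 0 (rshift n l))).

Lemma exp_lift_lift z l : exp_lift z 0 (lift ord_max l) = uexp (z 0 (lshift n l)) (z 0 (rshift n l)).
Proof. by rewrite /exp_lift incl_lift mxE. Qed.

Lemma exp_lift_max z : exp_lift z 0 ord_max = 1.
Proof. exact: incl_j. Qed.

Lemma exp_lift_neq0 z k : exp_lift z 0 k != 0.
Proof.
case: (unliftP ord_max k) => [l ->|->]; first by rewrite exp_lift_lift uexp_neq0.
by rewrite exp_lift_max oner_eq0.
Qed.

Lemma csmooth_exp_lift k : csmooth setT (fun z => exp_lift z 0 k).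
Proof.
case: (unliftP ord_max k) => [l ->|->].
  rewrite (_ : (fun z => _) = (fun z : 'rV[R]_(n + n) => uexp (z 0 (lshift n l)) (z 0 (rshift n l)))).
    refine (csmooth_uexp openT (@smooth_on_coord R _ setT (lshift n l)) (@smooth_on_coord R _ setT (rshift n l))).
  by rewrite funeqE => z; rewrite exp_lift_lift.
rewrite (_ : (fun z => _) = fun=> 1); first exact: csmooth_cst.
by rewrite funeqE => z; rewrite exp_lift_max.
Qed.

(** The derivative of the l-th exponential is half itself; the halves are kept apart, as
    they turn the 4 / c of the metric into 1 / c. *)
Definition exp_tangent (z : 'rV[R]_(n + n)) (l : 'I_n) : 'rV[C]_n.+1 :=
  incl 0 ord_max (uexp (z 0 (lshift n l)) (z 0 (rshift n l)) *: delta_mx 0 l).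

Lemma dlift_exp (z v : 'rV[R]_(n + n)) (k : 'I_n.+1) : cderive z v (fun y => exp_lift y 0 k)
  (incl 0 ord_max (\row_l (uexp (z 0 (lshift n l)) (z 0 (rshift n l)) *
     Complex (v 0 (lshift n l) / 2) (v 0 (rshift n l) / 2))) 0 k).
Proof.
case: (unliftP ord_max k) => [l ->|->].
  rewrite incl_lift mxE.
  rewrite (_ : (fun z => _) = (fun z : 'rV[R]_(n + n) => uexp (z 0 (lshift n l)) (z 0 (rshift n l)))).
    exact: cderive_uexp (is_derive_coord _ _ _) (is_derive_coord _ _ _).
  by rewrite funeqE => y; rewrite exp_lift_lift.
rewrite incl_j (_ : (fun z => _) = fun=> 1); first exact: cderive_cst.
by rewrite funeqE => y; rewrite exp_lift_max.
Qed.

Lemma dlift_expl z l : dlift exp_lift z (lshift n l) = Complex 2^-1 0 *: exp_tangent z l.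
Proof.
apply: rotateP => [k|]; rewrite mxE [RHS]mxE; rewrite (cderive_cpartial (dlift_exp z _ _)).
  rewrite !incl_lift !mxE !eq_shift eq_sym /=.
  by have [->|kl] := eqVneq l k; apply: Complex_eq; rewrite !(ReM, ImM) /=; ring.
by rewrite !incl_j mulr0.
Qed.

Lemma dlift_expr z l : dlift exp_lift z (rshift n l) = Complex 0 2^-1 *: exp_tangent z l.
Proof.
apply: rotateP => [k|]; rewrite mxE [RHS]mxE; rewrite (cderive_cpartial (dlift_exp z _ _)).
  rewrite !incl_lift !mxE !eq_shift eq_sym /=.
  by have [->|kl] := eqVneq l k; apply: Complex_eq; rewrite !(ReM, ImM) /=; ring.
by rewrite !incl_j mulr0.
Qed.

Lemma hdot_delta (l : 'I_n) (w : 'rV[C]_n) : hdot (delta_mx 0 l) w = conjc (w 0 l).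
Proof.
rewrite /hdot (bigD1 l) //= big1 ?addr0 => [|k /negPf kl]; last by rewrite mxE kl andbF mul0r.
by rewrite mxE !eqxx mul1r.
Qed.

(** On the exponential image |Z|^2 is the partition function, so the normalized products
    of the form are the probabilities. *)
Lemma exp_cone_form z l m : cone_form (exp_lift z) (exp_tangent z l) (exp_tangent z m) =
  (softmax_cov (lsubmx z) l m)%:C%C.
Proof.
set S := partition_fun (lsubmx z).
have hZZ : hdot (exp_lift z) (exp_lift z) = S%:C%C.
  rewrite /exp_lift hdot_incl conjc1 mul1r /S /partition_fun rmorphD rmorph1 rmorph_sum; congr (_ + _).
  by apply: eq_bigr => k _; rewrite mxE mulcJ nrm2_uexp mxE.
have hVZ k : hdot (exp_tangent z k) (exp_lift z) = (expR (lsubmx z 0 k))%:C%C.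
  rewrite /exp_tangent /exp_lift hdot_incl mul0r add0r hdotZl hdot_delta mxE mulcJ nrm2_uexp.
  by rewrite mxE.
have hVV : hdot (exp_tangent z l) (exp_tangent z m) = (expR (lsubmx z 0 l) * (l == m)%:R)%:C%C.
  rewrite /exp_tangent hdot_incl mul0r add0r hdotZl hdot_delta !mxE eqxx /= eq_sym.
  have [->|_] := eqVneq m l; first by rewrite !mulr1 mulcJ nrm2_uexp.
  by rewrite mulr0 conjc0 !mulr0 rmorph0.
move: (hVZ l) (hVZ m) hZZ hVV; move: (exp_lift z) (exp_tangent z l) (exp_tangent z m) => Z V W.
move=> hV hW hZ hVW; rewrite /cone_form (hdotC W Z) hV hW hZ hVW conjc_real.
rewrite [softmax_cov _ _ _]mxE /softmax -/S; move: (expR _) (expR _) => a b.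
rewrite -!rmorphM -rmorphB -rmorphXn -fmorphV -rmorphM; congr (_%:C%C); have S0 : S != 0 by exact: partition_fun_neq0.
by field.
Qed.

Definition exp_point (z : 'rV[R]_(n + n)) : PC := line (exp_lift z).

Lemma spans_exp_point z : spans (exp_point z) (exp_lift z).
Proof. by apply: spans_line; exact: incl_neq0. Qed.

Lemma exp_lift_surj Z : (forall k, Z 0 k != 0) -> exists z, exp_lift z = (Z 0 ord_max)^-1 *: Z.
Proof.
move=> Z0; have [x hx] := choice (fun l : 'I_n => uexp_surj (mulf_neq0 (Z0 (lift ord_max l)) (invr_neq0 (Z0 ord_max)))).
have [y hy] := choice hx.
exists (row_mx (\row_l x l) (\row_l y l)); apply: rotateP => [l|]; rewrite [RHS]mxE.
  by rewrite exp_lift_lift row_mxEl row_mxEr !mxE hy mulrC.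
by rewrite exp_lift_max mulVf.
Qed.

(** Near a point, the quotient by the last coordinate followed by a branch of the
    logarithm in every coordinate is a smooth inverse. *)
Lemma exp_point_bwd (j : chart PC) (z : 'rV[R]_(n + n)) : chart_dom j (exp_point z) -> exists (W : set 'rV[R]_(n + n)) (l : 'rV[R]_(n + n) -> 'rV[R]_(n + n)),
  [/\ open W, W (chart_map j (exp_point z)), l (chart_map j (exp_point z)) = z, smooth_vec W l &
      forall x, W x -> [/\ tube setT (l x), chart_dom j (exp_point (l x)) & chart_map j (exp_point (l x)) = x]].
Proof.
move=> jz; pose Y := chart_lift j; pose w0 l := uexp (z 0 (lshift n l)) (z 0 (rshift n l)).
pose W0 := setT `&` [set x : 'rV[R]_(n + n) | Y x 0 ord_max != 0].
have sY k U : csmooth U (fun x => Y x 0 k) by exact: csmooth_chart_lift.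
have oW0 : open W0 := csmooth_open_neq0 openT (sY ord_max setT).
pose q l x := Y x 0 (lift ord_max l) * (Y x 0 ord_max)^-1.
have sq l : csmooth W0 (q l).
  by apply: (csmoothM oW0 (sY _ W0) (csmoothV oW0 _ (sY _ W0))) => x [].
pose W := W0 `&` [set x | forall l, 0 < complex.Re (q l x / w0 l)].
have oW : open W.
  rewrite openE => x [W0x hx]; apply: filterI; first exact: open_nbhs_nbhs.
  refine (@filter_forall _ _ (fun l y => is_true (0 < complex.Re (q l y / w0 l))) (nbhs x) _ _) => l.
  have [s1 _] := csmoothM oW0 (sq l) (csmooth_cst W0 (w0 l)^-1).
  have oA : open [set r : R | 0 < r] by exact: open_gt.
  have := open_inter_preim oW0 (fun x W0x => smooth_on_cont s1 W0x) oA.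
  move=> oI; have : nbhs x (W0 `&` (fun x => complex.Re (q l x / w0 l)) @^-1` [set r | 0 < r]).
    by apply: open_nbhs_nbhs; split=> //; split=> //; exact: hx.
  by apply: filterS => y [].
pose u l x := ulog (z 0 (rshift n l)) (w0 l) (q l x).
pose ell x : 'rV[R]_(n + n) := row_mx (\row_l (u l x).1) (\row_l (u l x).2).
have ez := spans_map c j (spans_exp_point z).
have Zj : exp_lift z 0 j != 0 by apply/(spans_dom c j (spans_exp_point z)).
have Yz : Y (chart_map j (exp_point z)) = (exp_lift z 0 j)^-1 *: exp_lift z.
  by rewrite /Y /chart_lift ez realifyK incl_affine.
have qz l : q l (chart_map j (exp_point z)) = w0 l.
  have YE k : Y (chart_map j (exp_point z)) 0 k = (exp_lift z 0 j)^-1 * exp_lift z 0 k.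
    by rewrite Yz mxE.
  by rewrite /q !YE exp_lift_lift exp_lift_max mulr1 invrK mulrAC mulVf // mul1r.
exists W, ell; split=> //.
- split; first by split=> //=; rewrite Yz mxE exp_lift_max mulr1 invr_eq0.
  by move=> l; rewrite qz divff ?uexp_neq0 // ltr01.
- rewrite -[RHS]hsubmxK; congr row_mx; apply/rowP => l; rewrite !mxE /u qz;
    by rewrite ulog0.
- have su l : smooth_on W (fun x => (u l x).1) /\ smooth_on W (fun x => (u l x).2).
    apply: smooth_ulog => //; first by apply: csmooth_sub (sq l); exact: subIsetl.
    by move=> x [_]; exact.
  move=> k; case: (split_ordP k) => l ->.
    rewrite (_ : (fun x => _) = (fun x => (u l x).1)); first by case: (su l).
    by rewrite funeqE => x; rewrite row_mxEl mxE.
  rewrite (_ : (fun x => _) = (fun x => (u l x).2)); first by case: (su l).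
  by rewrite funeqE => x; rewrite row_mxEr mxE.
- move=> x [[_ Y0] hx]; have e : exp_lift (ell x) = (Y x 0 ord_max)^-1 *: Y x.
    apply: rotateP => [l|]; rewrite [RHS]mxE.
      have := @ulogK R (z 0 (lshift n l)) (z 0 (rshift n l)) (q l x) (hx l).
      rewrite -/(w0 l) -/(u l x) exp_lift_lift row_mxEl row_mxEr.
      by rewrite [X in uexp X _ = _ -> _]/= => hu; rewrite [X in uexp X _]mxE [X in uexp _ X]mxE hu /q mulrC.
    by rewrite exp_lift_max mulVf.
  have Yi0 : (Y x 0 ord_max)^-1 != 0 by rewrite invr_eq0.
  split=> //.
    apply/(spans_dom c j (spans_exp_point _)); rewrite e mxE mulf_neq0 //.
    by rewrite /Y /chart_lift incl_j oner_eq0.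
  rewrite (spans_map c j (spans_exp_point _)) e affineZ // /Y /chart_lift affine_incl.
  exact: complexifyK.
Qed.

Lemma projective_torification (M : dmfd R n) (i0 : chart M) :
  affine_chart i0 setT -> (forall x, dmetric i0 x = c^-1 *: softmax_cov x) ->
  torification Phi M.
Proof.
move=> aM metM.
have pi4 : (4 * pi : R) != 0 by rewrite mulf_neq0 ?pnatr_eq0 // gt_eqF ?pi_gt0.
split.
- exact: proj_kaehler.
- split; [exact: projective_is_action|exact: projective_effective|exact: projective_isometry].
- split; last by apply: (affine_mconnected aM); exists 0.
  by apply: (affine_dually_flat_softmax (N := c^-1)) aM metM; rewrite invr_gt0.
- exact: projective_free_mopen.
apply: (uniformization (ac_unique aM) (ac_dom aM) (ac_inj aM) (ac_cod aM) (ac_open aM)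
  (ac_conn aM) pi4 (E := exp_point)).
- exact: proj_inj.
- exact: projective_act0.
- move=> z t _; apply: (spans_eq (spans_exp_point _)).
  have := spans_act (tclass t) (spans_exp_point z); congr spans.
  apply: rotateP => [l|]; rewrite ?rotate_lift ?rotate_max ?exp_lift_max // !exp_lift_lift.
  by rewrite phase_repr mxE row_mxEl mxE addr0 [in RHS]mxE row_mxEr mxE uexp_shift.
- move=> z z' _ _ e; have := spans_exp_point z'; rewrite -e => -[m m0 hm].
  have [l l0 hl] := spans_exp_point z.
  have ee : l *: exp_lift z = m *: exp_lift z' by rewrite -hl -hm.
  have lm : l = m.
    by have /rowP/(_ ord_max) := ee; rewrite mxE [RHS]mxE !exp_lift_max !mulr1.
  have h k : z 0 (lshift n k) = z' 0 (lshift n k) /\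
      exists i : int, z' 0 (rshift n k) = z 0 (rshift n k) + 4 * pi * i%:~R.
    apply: uexp_inj; rewrite -!exp_lift_lift; apply: (mulfI l0).
    by have /rowP/(_ (lift ord_max k)) := ee; rewrite mxE [in RHS]mxE -lm.
  have [i hi] := choice (fun k => proj2 (h k)); exists i.
  rewrite -[LHS]hsubmxK -[z in RHS]hsubmxK add_row_mx addr0; congr row_mx.
    by apply/rowP => k; rewrite !mxE; case: (h k).
  by apply/rowP => k; rewrite !mxE hi.
- by move=> z _; apply/(projective_freeP (spans_exp_point z)) => k; exact: exp_lift_neq0.
- move=> q /(projective_freeP (spans_homog q)) q0; have [z ez] := exp_lift_surj q0.
  exists z => //; apply: (spans_eq (spans_exp_point z)); rewrite ez.
  by apply/spansZ; [rewrite invr_eq0|exact: spans_homog].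
- move=> j z _ jz; exists (lift_dom setT exp_lift j), (lift_map exp_lift j).
  have Wz : lift_dom setT exp_lift j z by split=> //; exact: exp_lift_neq0.
  split=> //.
  + by apply: open_lift_dom => //; exact: csmooth_exp_lift.
  + by apply: smooth_lift_map => //; exact: csmooth_exp_lift.
  + move=> z' [_ Zj]; split; first by apply/(spans_dom c j (spans_exp_point z')).
    exact: (spans_map c j (spans_exp_point z')).
  cbv zeta; split.
    have -> := @lift_metric R n c _ setT exp_lift csmooth_exp_lift j _ Wz.
    have c00 : c != 0 by rewrite gt_eqF.
    rewrite metM; apply/matrixP => a b; rewrite [RHS]mxE.
    have eS k l : (c^-1 *: softmax_cov (lsubmx z)) k l = c^-1 * softmax_cov (lsubmx z) k l.
      by rewrite mxE.
    case: (split_ordP a) => k ->; case: (split_ordP b) => l ->;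
      rewrite ?block_mxEul ?block_mxEur ?block_mxEdl ?block_mxEdr ?dlift_expl ?dlift_expr
        cone_formZl cone_formZr exp_cone_form !(ReM, ImM) ?eS.
    - move: (softmax_cov _ _ _) => g; rewrite /=; by field.
    - rewrite mxE; move: (softmax_cov _ _ _) => g; rewrite /=; by field.
    - rewrite mxE; move: (softmax_cov _ _ _) => g; rewrite /=; by field.
    - move: (softmax_cov _ _ _) => g; rewrite /=; by field.
  apply: (lift_endo (U := setT)) Wz => //; first exact: csmooth_exp_lift.
  move=> l; rewrite dlift_expl dlift_expr scalerA; congr (_ *: _).
  by apply: Complex_eq; rewrite !(ReM, ImM) /=; ring.
- by move=> j z _; exact: exp_point_bwd.
Qed.

End ProjectiveAction.

(** * Exponential families as affine charts *)

Section Integrals.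
Variables (R : realType) (d : measure_display) (T : measurableType d).
Variable mu : {measure set T -> \bar R}.
Implicit Types (f g : T -> R) (s t : R).

(** Integrals are total functions, so linearity needs integrability along with the
    value. *)
Definition has_int f s := mu.-integrable setT (EFin \o f) /\ Rintegral mu setT f = s.

Lemma has_int_eq f g s t : has_int f s -> (forall x, g x = f x) -> t = s -> has_int g t.
Proof. by move=> [fi fs] gf ->; rewrite (_ : g = f) // funeqE. Qed.

Lemma has_intD f g s t : has_int f s -> has_int g t -> has_int (fun x => f x + g x) (s + t).
Proof.
move=> [fi fs] [gi gs]; split; last by rewrite RintegralD // fs gs.
rewrite (_ : EFin \o _ = (EFin \o f) \+ (EFin \o g))%E; first exact: integrableD.
by rewrite funeqE => x; rewrite /= EFinD.
Qed.

Lemma has_intZ k f s : has_int f s -> has_int (fun x => k * f x) (k * s).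
Proof.
move=> [fi fs]; split; last by rewrite RintegralZl // fs.
rewrite (_ : EFin \o _ = fun x => k%:E * (EFin \o f) x)%E; first exact: integrableZl.
by rewrite funeqE => x; rewrite /= EFinM.
Qed.

Lemma has_int0 : has_int (fun=> 0) 0.
Proof.
split; last by rewrite /Rintegral integral0.
exact: integrable0.
Qed.

Lemma has_int_sum (I : Type) (r : seq I) (F : I -> T -> R) (S : I -> R) :
  (forall i, has_int (F i) (S i)) -> has_int (fun x => \sum_(i <- r) F i x) (\sum_(i <- r) S i).
Proof.
move=> h; elim: r => [|i r IH].
  by apply: has_int_eq has_int0 _ _ => [x|]; rewrite big_nil.
by apply: has_int_eq (has_intD (h i) IH) _ _ => [x|]; rewrite big_cons.
Qed.

End Integrals.

Section ExponentialDensity.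
Variables (R : realType) (T : Type) (n : nat).
Variables (C : T -> R) (F : T -> 'rV[R]_n) (psi : 'rV[R]_n -> R).

Definition exp_exponent (t : 'rV[R]_n) x := C x + (\sum_i t 0 i * F x 0 i) - psi t.
Definition exp_density (t : 'rV[R]_n) x := expR (exp_exponent t x).

Lemma is_derive_exponent x t a (m : R) :
  is_derive t (delta_mx 0 a) psi m ->
  is_derive t (delta_mx 0 a) (exp_exponent^~ x) (F x 0 a - m).
Proof.
move=> dpsi; have h : is_derive t (delta_mx 0 a) (fun y : 'rV[R]_n => \sum_i y 0 i * F x 0 i)
    (\sum_i (i == a)%:R * F x 0 i).
  have hi i : is_derive t (delta_mx 0 a) (fun y : 'rV[R]_n => y 0 i * F x 0 i)
      ((i == a)%:R * F x 0 i).
    apply: (is_derive_eq (is_deriveM (is_derive_coord i t (delta_mx 0 a))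
      (is_derive_cst (F x 0 i) t (delta_mx 0 a)))).
    by rewrite mxE eqxx /= scaler0 add0r /GRing.scale /= mulrC.
  have := is_derive_sum hi.
  by congr (is_derive _ _ _ _); rewrite funeqE => y; rewrite fct_sumE.
rewrite (_ : exp_exponent^~ x =
  cst (C x) + (fun y : 'rV[R]_n => \sum_i y 0 i * F x 0 i) - psi) //.
apply: (is_derive_eq (is_deriveB (is_deriveD (is_derive_cst (C x) t (delta_mx 0 a)) h) dpsi)).
by rewrite add0r sum_delta_mull.
Qed.

End ExponentialDensity.

Section ExponentialFamily.
Variables (R : realType) (d : measure_display) (T : measurableType d).
Variable mu : {measure set T -> \bar R}.
Variables (n : nat) (P : Type) (A : set P).
Variables (density : P -> T -> R) (theta : P -> 'rV[R]_n).
Variables (C : T -> R) (F : T -> 'rV[R]_n) (psi : 'rV[R]_n -> R).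
Variables (Theta : set 'rV[R]_n) (N : R).

Local Notation exponent := (exp_exponent C F psi).
Local Notation p := (exp_density C F psi).
Hypothesis densityE : forall a, A a -> density a =1 p (theta a).
Hypothesis thetaA : theta @` A = Theta.
Hypotheses (oTheta : open Theta) (cTheta : convex_rV Theta).
Hypothesis N0 : N != 0.
Hypothesis F0 : exists x, F x = 0.
Hypothesis F1 : forall i, exists x, F x = N *: delta_mx 0 i.

Local Notation M := (stat_mfd mu A density theta).

(** The outcome with F = 0 recovers psi, the ones with F proportional to a basis
    vector then recover the natural parameters. *)
Lemma natural_parameter_inj a b : A a -> A b -> density a = density b -> theta a = theta b.
Proof.
move=> Aa Ab ab; have e x : exponent (theta a) x = exponent (theta b) x.
  by apply: (@expR_inj R); have := congr1 (@^~ x) ab; rewrite densityE // densityE.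
have [x0 Fx0] := F0.
have psiE : psi (theta a) = psi (theta b).
  have := e x0; rewrite /exp_exponent Fx0; do 2![rewrite big1 => [|i _]; last by rewrite mxE mulr0].
  by rewrite addr0 => /addrI /oppr_inj.
apply/rowP => i; have [x Fx] := F1 i; have := e x.
have sE (t : 'rV[R]_n) : \sum_j t 0 j * F x 0 j = t 0 i * N.
  rewrite Fx (bigD1 i) //= big1 ?addr0 => [|j /negPf ji]; first by rewrite !mxE !eqxx mulr1.
  by rewrite !mxE ji andbF !mulr0.
by rewrite /exp_exponent !sE psiE => /addIr /addrI /(mulIf N0).
Qed.

Lemma family_chart_map (f : M) a : A a -> density a = sval f -> chart_map (tt : chart M) f = theta a.
Proof.
move=> Aa af; apply: xget_unique; first by exists a.
by move=> _ [b [Ab bf] <-]; apply: natural_parameter_inj; rewrite // af -bf.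
Qed.

(** The density is a function of its natural parameter. *)
Lemma family_inj_charts : inj_charts M.
Proof.
move=> [] f g _ _; have [a Aa af] := svalP f; have [b Ab bg] := svalP g.
rewrite (family_chart_map Aa af) (family_chart_map Ab bg) => ab.
apply: (eq_sig_hprop (fun _ => @Prop_irrelevance _)); rewrite -af -bg funeqE => x.
by rewrite (densityE Aa) (densityE Ab) ab.
Qed.

Lemma family_chart_cod : chart_cod (tt : chart M) = Theta.
Proof.
rewrite -thetaA; apply/seteqP; split=> [_ [f _ <-]|_ [a Aa <-]].
  have [a Aa af] := svalP f; exists a => //; exact/esym/family_chart_map.
have fA : (density @` A) (density a) by exists a.
by exists (exist _ (density a) fA) => //; exact: family_chart_map.
Qed.

Lemma pdensE t x : Theta t -> pdens A density theta t x = p t x.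
Proof.
rewrite -thetaA => -[a Aa <-]; have fA : (density @` A) (density a) by exists a.
rewrite -(@family_chart_map (exist _ (density a) fA) _ Aa erefl) /pdens in_chartE //.
  by rewrite (@family_chart_map (exist _ (density a) fA) _ Aa erefl) /= densityE.
exact: family_inj_charts.
Qed.

Lemma loglikE x t : Theta t -> loglik A density theta x t = exponent t x.
Proof. by move=> Tt; rewrite /loglik pdensE // expRK. Qed.

Variables (mean : 'rV[R]_n -> 'I_n -> R) (cov : 'rV[R]_n -> 'M[R]_n).
Hypothesis dpsi : forall t a, Theta t -> is_derive t (delta_mx 0 a) psi (mean t a).
Hypothesis dmean : forall t a b, Theta t ->
  is_derive t (delta_mx 0 a) (mean^~ b) (cov t a b).
Hypothesis E_mean : forall t a, Theta t ->
  has_int mu (fun x => p t x * (F x 0 a - mean t a)) 0.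
Hypothesis E_cov : forall t a b, Theta t ->
  has_int mu (fun x => p t x * ((F x 0 a - mean t a) * (F x 0 b - mean t b))) (cov t a b).

Lemma partial_loglik x t a : Theta t ->
  partial a (loglik A density theta x) t = F x 0 a - mean t a.
Proof.
move=> Tt; rewrite /partial (@derive_eq_on _ _ Theta _ (exponent^~ x)) //.
  by case: (is_derive_exponent C F x (dpsi a Tt)).
by move=> y; rewrite inE => Ty; exact: loglikE.
Qed.

Lemma partial2_loglik x t a b : Theta t ->
  partial a (partial b (loglik A density theta x)) t = - cov t a b.
Proof.
move=> Tt; rewrite {1}/partial (@derive_eq_on _ _ Theta _ (cst (F x 0 b) - mean^~ b)) //.
  have [d1 d2] := dmean a b Tt.
  by case: (is_deriveB (is_derive_cst (F x 0 b) t (delta_mx 0 a)) (dmean a b Tt)) => _ ->; rewrite sub0r.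
by move=> y; rewrite inE => Ty; exact: partial_loglik.
Qed.

Lemma fisher_cov t : Theta t -> fisher mu A density theta t = cov t.
Proof.
move=> Tt; apply/matrixP => a b; rewrite mxE -(proj2 (E_cov a b Tt)) /expectation_at.
by congr Rintegral; rewrite funeqE => x; rewrite pdensE // !partial_loglik.
Qed.

(** In the natural parameters the second derivatives of the log-likelihood are
    constant along the sample space, so that the exponential connection pairs a
    constant with a score, whose mean is 0. *)
Lemma exp_christoffel1_eq0 t a b c : Theta t -> exp_christoffel1 mu A density theta t a b c = 0.
Proof.
move=> Tt; have [_] := has_intZ (- cov t a b) (E_mean c Tt); rewrite mulr0 => <-.
rewrite /exp_christoffel1 /expectation_at.
congr Rintegral; rewrite funeqE => x; rewrite pdensE // partial2_loglik // partial_loglik //.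
by rewrite mulrCA.
Qed.

Lemma affine_chart_family : affine_chart (tt : chart M) Theta.
Proof.
split=> //; [by case|exact: family_inj_charts|exact: family_chart_cod|].
move=> t a b k Tt; rewrite /= big1 // => c _.
by rewrite exp_christoffel1_eq0 // mul0r.
Qed.

End ExponentialFamily.

(** * Families on a finite sample space *)

Section FiniteFamily.
Variable R : realType.

Lemma counting_set1 d (T : measurableType d) (x : T) : counting_measure R T [set x] = 1%E.
Proof.
by rewrite /counting_measure /= /counting asboolT ?finite_set1 // fset_set1 finmap.cardfs1.
Qed.

(** A function on a finite set is a combination of indicators of points. *)
Lemma has_int_finite (T : pointedType) (s : seq T) (f : T -> R) : uniq s -> (forall x, x \in s) ->
  has_int (counting_measure R (discrete_space T)) f (\sum_(x <- s) f x).
Proof.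
move=> us ss; set mu := counting_measure R _.
have h1 (y : discrete_space T) : has_int mu (\1_[set y]) 1.
  have i1 : (\int[mu]_x (\1_[set y] x)%:E)%E = 1%E.
    by rewrite integral_indic // setIT counting_set1.
  split; last by rewrite /Rintegral i1.
  apply/integrableP; split; first exact: measurable_funS measurableT _ _.
  under eq_integral do rewrite gee0_abs ?lee_fin //.
  by rewrite i1 ltry.
apply: has_int_eq (has_int_sum s (fun y => has_intZ (f y) (h1 y))) _ _ => [x|]; last first.
  by apply: eq_bigr => y _; rewrite mulr1.
rewrite (bigD1_seq x) //= indicE mem_set // mulr1 big1 ?addr0 // => y yx.
by rewrite indicE memNset ?mulr0 //= => /esym/eqP; rewrite (negPf yx).
Qed.

Lemma is_derive_big d (I : Type) (r : seq I) (x v : 'rV[R]_d) (h : I -> 'rV[R]_d -> R) dh :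
  (forall i, is_derive x v (h i) (dh i)) ->
  is_derive x v (fun y => \sum_(i <- r) h i y) (\sum_(i <- r) dh i).
Proof.
move=> hd; elim: r => [|i r IH].
  rewrite (_ : (fun y => _) = cst 0) ?big_nil; first exact: is_derive_cst.
  by rewrite funeqE => y; rewrite big_nil.
rewrite (_ : (fun y => _) = h i + (fun y => \sum_(i <- r) h i y)) ?big_cons.
  exact: is_deriveD.
by rewrite funeqE => y; rewrite big_cons.
Qed.

Variables (T : pointedType) (s : seq T) (us : uniq s) (ss : forall x, x \in s).
Variables (n : nat) (P : Type) (A : set P).
Variables (density : P -> T -> R) (theta : P -> 'rV[R]_n).
Variables (C : T -> R) (F : T -> 'rV[R]_n) (N : R).
Local Notation psi := (fun t : 'rV[R]_n => N * ln (partition_fun t)).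
Hypothesis densityE : forall a, A a -> density a =1 exp_density C F psi (theta a).
Hypothesis density1 : forall a, A a -> \sum_(x <- s) density a x = 1.
Hypothesis theta_surj : forall t, exists2 a, A a & theta a = t.
Hypothesis N0 : N != 0.
Hypothesis F0 : exists x, F x = 0.
Hypothesis F1 : forall i, exists x, F x = N *: delta_mx 0 i.
Local Notation mu := (counting_measure R (discrete_space T)).
Local Notation M := (stat_mfd mu A density theta).
Local Notation mean := (fun (t : 'rV[R]_n) a => N * softmax t a).

Let dpsi t a : is_derive t (delta_mx 0 a) psi (mean t a).
Proof.
have := is_derive_comp1 (is_derive_partition_fun t a) (is_derive1_ln (partition_fun_gt0 t)).
move=> /(is_deriveZ N); congr is_derive; rewrite /GRing.scale /= /softmax mulrC.
by rewrite [_^-1 * _]mulrC mulrC.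
Qed.

Let dmean t a b : is_derive t (delta_mx 0 a) (mean^~ b) ((N *: softmax_cov t) a b).
Proof.
have := is_deriveZ N (is_derive_softmax t a b); congr is_derive; rewrite /GRing.scale /= !mxE.
have [->|ab] := eqVneq a b; rewrite ?eqxx //.
by rewrite /=; ring.
Qed.

Local Notation p := (exp_density C F psi).

Let dp t x a : is_derive t (delta_mx 0 a) (p^~ x) (p t x * (F x 0 a - mean t a)).
Proof.
exact: is_derive_comp1 (is_derive_exponent C F x (dpsi t a)) (is_derive_expR _).
Qed.

Let sum1 t : \sum_(x <- s) p t x = 1.
Proof. by have [a Aa <-] := theta_surj t; rewrite -(density1 Aa); apply: eq_bigr => x _; rewrite densityE. Qed.

(** Differentiating the normalization once and twice gives the first two moments. *)
Let sum_score t a : \sum_(x <- s) p t x * (F x 0 a - mean t a) = 0.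
Proof.
have := is_derive_big s (fun x => dp t x a).
have -> : (fun y => \sum_(x <- s) p y x) = cst 1 by rewrite funeqE => y; rewrite sum1.
by move=> [_ <-]; case: (is_derive_cst (1 : R) t (delta_mx 0 a)).
Qed.

Let sum_cov t a b : \sum_(x <- s) p t x * ((F x 0 a - mean t a) * (F x 0 b - mean t b)) =
  (N *: softmax_cov t) a b.
Proof.
have h x : is_derive t (delta_mx 0 a) (fun y => p y x * (F x 0 b - mean y b))
    (p t x * ((F x 0 a - mean t a) * (F x 0 b - mean t b)) - p t x * (N *: softmax_cov t) a b).
  have hB : is_derive t (delta_mx 0 a) (fun y => F x 0 b - mean y b) (- (N *: softmax_cov t) a b).
    apply: (is_derive_eq (is_deriveB (is_derive_cst (F x 0 b) t (delta_mx 0 a)) (dmean t a b))).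
    by rewrite sub0r.
  apply: (is_derive_eq (is_deriveM (dp t x a) hB)); move: ((N *: softmax_cov t) a b) => c.
  by rewrite /GRing.scale /= mulrN addrC mulrCA (mulrC (F x 0 b - _)).
have := is_derive_big s h.
have -> : (fun y => \sum_(x <- s) p y x * (F x 0 b - mean y b)) = cst 0.
  by rewrite funeqE => y; rewrite sum_score.
move=> [_ ]; case: (is_derive_cst (0 : R) t (delta_mx 0 a)) => _ -> /esym.
by rewrite sumrB -mulr_suml sum1 mul1r => /eqP; rewrite subr_eq0 => /eqP.
Qed.

Let thetaA : theta @` A = setT.
Proof. by apply/seteqP; split=> // t _; have [a Aa at_] := theta_surj t; exists a. Qed.

Let E_mean t a : setT t -> has_int mu (fun x => p t x * (F x 0 a - mean t a)) 0.
Proof. by move=> _; rewrite -(sum_score t a); exact: has_int_finite. Qed.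

Let E_cov t a b : setT t ->
  has_int mu (fun x => p t x * ((F x 0 a - mean t a) * (F x 0 b - mean t b))) ((N *: softmax_cov t) a b).
Proof. by move=> _; rewrite -sum_cov; exact: has_int_finite. Qed.

Lemma finite_family : affine_chart (tt : chart M) setT /\
  forall t, dmetric (tt : chart M) t = N *: softmax_cov t.
Proof.
have oT : open [set: 'rV[R]_n] := openT.
split.
  by apply: (affine_chart_family (mu := mu) densityE thetaA oT _ N0 F0 F1
    (fun t a _ => dpsi t a) (fun t a b _ => dmean t a b)) => //.
by move=> t; exact: (fisher_cov (mu := mu) densityE thetaA oT N0 F0 F1
  (fun t a _ => dpsi t a) E_cov (I : setT t)).
Qed.

End FiniteFamily.

(** * The simplex of probability vectors in logarithmic coordinates *)

Section Simplex.
Variables (R : realType) (n : nat).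
Implicit Types (w : 'I_n.+1 -> R) (t : 'rV[R]_n) (k : 'I_n.+1 -> nat).

Definition simplex : set ('I_n.+1 -> R) := [set w | (forall i, 0 < w i) /\ \sum_i w i = 1].

Definition logit w : 'rV[R]_n := \row_i ln (w (lift ord_max i) / w ord_max).

Definition softmax_point t (i : 'I_n.+1) : R :=
  if unlift ord_max i is Some l then softmax t l else (partition_fun t)^-1.

Lemma sum_lift_max (V : zmodType) (f : 'I_n.+1 -> V) :
  \sum_i f i = f ord_max + \sum_(l < n) f (lift ord_max l).
Proof. by rewrite (bigD1_ord ord_max). Qed.

Lemma softmax_pointP t : simplex (softmax_point t) /\ logit (softmax_point t) = t.
Proof.
have pm : softmax_point t ord_max = (partition_fun t)^-1 by rewrite /softmax_point unlift_none.
have pl l : softmax_point t (lift ord_max l) = softmax t l by rewrite /softmax_point liftK.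
split; [split|].
- move=> i; case: (unliftP ord_max i) => [l ->|->]; rewrite ?pl ?softmax_gt0 //.
  by rewrite pm invr_gt0 partition_fun_gt0.
- by rewrite sum_lift_max pm (eq_bigr _ (fun l _ => pl l)) softmax_sum.
- apply/rowP => l; rewrite mxE pm pl invrK /softmax divfK ?partition_fun_neq0 //.
  exact: expRK.
Qed.

Lemma partition_fun_logit w : simplex w -> partition_fun (logit w) = (w ord_max)^-1.
Proof.
move=> [w0 w1]; have wm : w ord_max != 0 by rewrite gt_eqF.
rewrite /partition_fun (eq_bigr (fun l => w (lift ord_max l) / w ord_max)) => [|l _].
  rewrite -mulr_suml -[X in X + _](divff wm) -mulrDl -sum_lift_max w1.
  exact: mul1r.
by rewrite mxE lnK // posrE divr_gt0.
Qed.

(** The exponential form of all the families on finite sets: dividing by the last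
    probability turns each factor into an exponential of a natural parameter, and the
    last probability is the inverse of the partition function. *)
Lemma simplex_monomial w k (N : nat) : simplex w -> (\sum_i k i)%N = N ->
  \prod_i w i ^+ k i = expR ((\sum_l logit w 0 l * (k (lift ord_max l))%:R)
    - N%:R * ln (partition_fun (logit w))).
Proof.
move=> sw kN; have [w0 _] := sw; rewrite partition_fun_logit // lnV ?posrE // mulrN opprK -kN.
rewrite (eq_bigr (fun i => expR (ln (w i) * (k i)%:R))) => [|i _]; last first.
  by rewrite mulrC expRM_natl lnK // posrE.
rewrite -expR_sum natr_sum mulr_suml !sum_lift_max addrCA addrC mulrC; congr expR.
rewrite [LHS]addrC; congr (_ + _); rewrite -big_split /=; apply: eq_bigr => l _.
by rewrite mxE ln_div ?posrE //; ring.
Qed.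

End Simplex.

(** * Categorical, binomial and multinomial distributions *)

Section FiniteFamilies.
Variable R : realType.

Lemma expR_lnD (a b : R) : 0 < a -> expR (ln a + b) = a * expR b.
Proof. by move=> a0; rewrite expRD lnK. Qed.

Lemma categorical_affine n :
  affine_chart (tt : chart (categorical_mfd R n)) setT /\
  forall t, dmetric (tt : chart (categorical_mfd R n)) t = 1%:R *: softmax_cov t.
Proof.
pose F (x : 'I_n.+1) : 'rV[R]_n := \row_l (lift ord_max l == x)%:R.
apply: (@finite_family R ('I_n.+1 : pointedType) (index_enum 'I_n.+1) (index_enum_uniq _)
  (@mem_index_enum _) n _ (@simplex R n) _ _ (fun=> 0) F).
- move=> p sp x; have e1 : (\sum_(i < n.+1) (i == x))%N = 1%N.
    by rewrite (bigD1 x) //= eqxx big1 // => i /negPf ->.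
  have := simplex_monomial sp e1; rewrite (bigD1 x) //= eqxx big1 ?mulr1; last first.
    by move=> i /negPf ->.
  rewrite expr1 => ->; rewrite /exp_density /exp_exponent add0r -/(logit p).
  have -> : \sum_i logit p 0 i * F x 0 i = \sum_l logit p 0 l * (lift ord_max l == x)%:R.
    by apply: eq_bigr => l _; rewrite [F _ _ _]mxE.
  by [].
- by move=> p [].
- by move=> t; have [st lt] := softmax_pointP t; exists (softmax_point t).
- exact: oner_neq0.
- by exists ord_max; apply/rowP => l; rewrite !mxE eq_sym (negPf (neq_lift _ _)).
- move=> l; exists (lift ord_max l); apply/rowP => k; rewrite !mxE eqxx mul1r.
  by rewrite (inj_eq (@lift_inj _ _)).
Qed.

(** The case of two outcomes: q and 1 - q are the probability vector, k and n - k the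
    exponents. *)
Lemma binomial_affine n : (0 < n)%N ->
  affine_chart (tt : chart (binomial_mfd R n)) setT /\
  forall t, dmetric (tt : chart (binomial_mfd R n)) t = n%:R *: softmax_cov t.
Proof.
move=> n0; pose F (k : 'I_n.+1) : 'rV[R]_1 := const_mx k%:R.
pose w (q : R) (i : 'I_2) := if i == ord_max then 1 - q else q.
have wl (q : R) l : w q (lift ord_max l) = q by rewrite /w eq_sym (negPf (neq_lift _ _)).
have wm (q : R) : w q ord_max = 1 - q by rewrite /w eqxx.
have sw (q : R) : 0 < q < 1 -> simplex (w q).
  move=> /andP[q0 q1]; split; last by rewrite sum_lift_max wm big_ord1 wl subrK.
  by move=> i; rewrite /w; case: ifP => _; rewrite ?subr_gt0.
have lw (q : R) : const_mx (ln (q / (1 - q))) = logit (w q).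
  by apply/rowP => l; rewrite !mxE wl wm.
apply: (@finite_family R ('I_n.+1 : pointedType) (index_enum 'I_n.+1) (index_enum_uniq _)
  (@mem_index_enum _) 1 _ [set q : R | 0 < q < 1] _ _
  (fun k => ln 'C(n, k)%:R) F).
- move=> q q01 k; rewrite /exp_density /exp_exponent lw -addrA expR_lnD; last first.
    by rewrite ltr0n bin_gt0 -ltnS.
  pose e (i : 'I_2) := if i == ord_max then (n - k)%N else nat_of_ord k.
  have el l : e (lift ord_max l) = k by rewrite /e eq_sym (negPf (neq_lift _ _)).
  have em : e ord_max = (n - k)%N by rewrite /e eqxx.
  have en : (\sum_i e i)%N = n by rewrite (bigD1_ord ord_max) //= big_ord1 el em subnK // -ltnS.
  have := simplex_monomial (sw q q01) en.
  rewrite (bigD1_ord ord_max) //= !big_ord1 el em wl wm [F k _ _]mxE => <-.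
  by rewrite /binomial_pmf mulr_natl mulrC.
- move=> q _; have := exprDn (1 - q) q n; rewrite subrK expr1n => ->.
  by apply: eq_bigr => k _; rewrite /binomial_pmf mulrC.
- move=> t; exists (softmax t 0).
    have [[p0 p1] _] := softmax_pointP t; rewrite /= softmax_gt0 /=.
    have := softmax_sum t; rewrite big_ord1 => <-.
    by rewrite ltrDr invr_gt0 partition_fun_gt0.
  rewrite lw -[RHS](proj2 (softmax_pointP t)); congr logit; rewrite funeqE => i.
  case: (unliftP ord_max i) => [l ->|->]; rewrite ?wl ?wm /softmax_point ?liftK ?unlift_none.
    by rewrite ord1.
  by rewrite -[in LHS](softmax_sum t) big_ord1 addrK.
- by rewrite pnatr_eq0 -lt0n.
- by exists ord0; apply/rowP => l; rewrite !mxE.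
- move=> l; exists ord_max; apply/rowP => k.
  by rewrite !mxE !ord1 eqxx mulr1.
Qed.

Lemma coef_prod_exp (I : Type) (s : seq I) (w : I -> R) n k : (k <= n)%N ->
  (\prod_(i <- s) \poly_(j < n.+1) (w i ^+ j / j`!%:R))`_k = (\sum_(i <- s) w i) ^+ k / k`!%:R.
Proof.
elim: s k => [|i s IH] k kn.
  by rewrite !big_nil coefC; case: k kn => [|k] kn; rewrite ?expr0 ?divr1 // exprS !mul0r.
have f0 m : m`!%:R != 0 :> R by rewrite pnatr_eq0 -lt0n fact_gt0.
rewrite !big_cons coefMr exprDn mulr_suml; apply: eq_bigr => j _.
have jk : (j <= k)%N by rewrite -ltnS.
rewrite IH; last exact: leq_trans kn.
rewrite coef_poly ltnS (leq_trans (leq_subr _ _) kn) -mulr_natr.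
have b0 : 'C(k, j)%:R != 0 :> R by rewrite pnatr_eq0 -lt0n bin_gt0.
have := bin_fact jk => /(congr1 (fun m => m%:R : R)); rewrite !natrM => <-.
by field; rewrite b0 !f0.
Qed.

(** Both sides are the coefficient of X^n in a product of truncated exponentials. *)
Lemma multinomial_sum m n (w : 'I_m.+1 -> R) :
  \sum_(k : outcomes m n) n`!%:R / \prod_i (val k i)`!%:R * \prod_i w i ^+ val k i =
  (\sum_i w i) ^+ n.
Proof.
have f0 j : j`!%:R != 0 :> R by rewrite pnatr_eq0 -lt0n fact_gt0.
have := coef_prod_exp (index_enum 'I_m.+1) w (leqnn n).
move=> /(congr1 ( *%R n`!%:R)); rewrite [RHS]mulrC divfK // => <-.
under [in RHS]eq_bigr do rewrite poly_def.
rewrite bigA_distr_bigA /= coef_sum mulr_sumr.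
have coefE (f : {ffun 'I_m.+1 -> 'I_n.+1}) :
    (\prod_i ((w i ^+ f i / (f i)`!%:R) *: 'X^(f i)) : {poly R})`_n =
    if (\sum_i (f i : nat))%N == n then \prod_i (w i ^+ f i / (f i)`!%:R) else 0.
  under eq_bigr do rewrite -mul_polyC.
  rewrite big_split /= -rmorph_prod -expr_sum coefCM coefXn eq_sym.
  by case: ifP; rewrite ?mulr1 ?mulr0.
under [in RHS]eq_bigr do rewrite coefE.
rewrite (bigID (fun f : {ffun 'I_m.+1 -> 'I_n.+1} => (\sum_i (f i : nat))%N == n)) /=.
rewrite [X in _ + X]big1 => [|f /negPf ->]; last by rewrite mulr0.
rewrite addr0 (reindex (val : outcomes m n -> _)) /=; last first.
  exists (fun f => insubd (point : outcomes m n) f) => [k _|f]; first exact: valKd.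
  by rewrite inE => fn; exact: insubdK.
apply: eq_big => [k|k _]; first by rewrite (valP k).
rewrite (valP k) -mulrA; congr (_ * _).
by rewrite -prodfV -big_split /=; apply: eq_bigr => i _; rewrite mulrC.
Qed.

Lemma multinomial_affine m n : (0 < n)%N ->
  affine_chart (tt : chart (multinomial_mfd R m n)) setT /\
  forall t, dmetric (tt : chart (multinomial_mfd R m n)) t = n%:R *: softmax_cov t.
Proof.
move=> n0; pose F (k : outcomes m n) : 'rV[R]_m := \row_l (val k (lift ord_max l))%:R.
have lw (w : 'I_m.+1 -> R) : simplex w ->
    \row_i ln (w (lift ord_max i) / (1 - \sum_j w (lift ord_max j))) = logit w.
  by move=> [_ w1]; apply/rowP => i; rewrite !mxE -w1 sum_lift_max addrK.
have oP (j : 'I_m.+1) :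
    (\sum_i ([ffun i : 'I_m.+1 => if i == j then @ord_max n else ord0] i : nat))%N == n.
  rewrite (bigD1 j) //= big1 ?addn0 ?ffunE ?eqxx // => i /negPf ij.
  by rewrite ffunE ij.
pose o j : outcomes m n := exist
  (fun k : {ffun 'I_m.+1 -> 'I_n.+1} => (\sum_i (k i : nat))%N == n) _ (oP j).
have fact0 (k : outcomes m n) : 0 < n`!%:R / \prod_i (val k i)`!%:R :> R.
  by rewrite divr_gt0 ?prodr_gt0 // => *; rewrite ltr0n fact_gt0.
apply: (@finite_family R (outcomes m n : pointedType) (index_enum (outcomes m n))
  (index_enum_uniq _) (@mem_index_enum _) m _ (@simplex R m) _ _
  (fun k : outcomes m n => ln (n`!%:R / \prod_i (val k i)`!%:R)) F).
- move=> w sw k; rewrite /exp_density /exp_exponent (lw w sw) -addrA expR_lnD //.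
  congr (_ * _); rewrite (@simplex_monomial R m w (fun i => val k i) n sw) //.
    have -> // : \sum_i logit w 0 i * F k 0 i =
        \sum_l logit w 0 l * (val k (lift ord_max l))%:R.
    by apply: eq_bigr => l _; rewrite [F _ _ _]mxE.
  exact/eqP/(valP k).
- by move=> w [_ w1]; rewrite multinomial_sum w1 expr1n.
- by move=> t; have [st lt] := softmax_pointP t; exists (softmax_point t); rewrite ?lw.
- by rewrite pnatr_eq0 -lt0n.
- by exists (o ord_max); apply/rowP => l; rewrite !mxE ffunE eq_sym (negPf (neq_lift _ _)).
- move=> j; exists (o (lift ord_max j)); apply/rowP => l; rewrite !mxE ffunE eqxx.
  by rewrite (inj_eq (@lift_inj _ _)); case: ifP; rewrite ?mulr1 ?mulr0.
Qed.

End FiniteFamilies.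

(** * Poisson and negative binomial distributions *)

Section CountableFamily.
Variable R : realType.
Implicit Types (f q : nat -> R) (s m : R).
Local Notation mu := (counting_measure R nat).

Lemma has_int_series f s : (forall k, 0 <= f k) -> series f @ \oo --> s -> has_int mu f s.
Proof.
move=> f0 fs; have e : (\int[mu]_k (f k)%:E)%E = s%:E.
  rewrite ge0_integral_count => [|k]; last by rewrite lee_fin.
  rewrite (_ : (fun n => _) = EFin \o series f); last first.
    by rewrite funeqE => n /=; rewrite /series /= sumEFin.
  by apply/cvg_lim => //; apply: cvg_EFin => //; exact: nearW.
split; last by rewrite /Rintegral e.
apply/integrableP; split; first by [].
under eq_integral do rewrite gee0_abs ?lee_fin //.
by rewrite e ltry.
Qed.

Lemma cvg_series_shift f s : f 0%N = 0 -> series (fun k => f k.+1) @ \oo --> s ->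
  series f @ \oo --> s.
Proof.
move=> f0 h; rewrite -(cvg_shiftS (series f)) /=.
rewrite (_ : (fun n => _) = series (fun k => f k.+1)) // funeqE => n.
by rewrite /series /= big_nat_recl // f0 add0r.
Qed.

Lemma cvg_series_scale c f g s : (forall k, g k = c * f k) -> series f @ \oo --> s ->
  series g @ \oo --> c * s.
Proof.
move=> gf h; rewrite (_ : series g = fun n => c * series f n); first exact: cvgMr.
by rewrite funeqE => n; rewrite /series /= mulr_sumr; apply: eq_bigr => k _.
Qed.

(** Mean and variance from the first two factorial moments, which are computed
    by moving the factors k and k - 1 into the weights. *)
Lemma moments q q1 q2 m w : (forall k, 0 <= q k) ->
  series q @ \oo --> (1 : R) -> series q1 @ \oo --> (1 : R) -> series q2 @ \oo --> (1 : R) ->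
  (forall k, k.+1%:R * q k.+1 = m * q1 k) ->
  (forall k, k.+2%:R * k.+1%:R * q k.+2 = w * q2 k) ->
  has_int mu (fun k => q k * (k%:R - m)) 0 /\
  has_int mu (fun k => q k * ((k%:R - m) * (k%:R - m))) (w + m - m ^+ 2).
Proof.
move=> q0 h0 h1 h2 r1 r2.
have i0 := has_int_series q0 h0.
have i1 : has_int mu (fun k => k%:R * q k) m.
  apply: has_int_series => [k|]; first by rewrite mulr_ge0.
  apply: cvg_series_shift; first by rewrite mul0r.
  by rewrite -[X in _ --> X]mulr1; exact: cvg_series_scale h1.
have i2 : has_int mu (fun k => k%:R * k.-1%:R * q k) w.
  apply: has_int_series => [k|]; first by rewrite !mulr_ge0.
  apply: cvg_series_shift; first by rewrite !mul0r.
  apply: cvg_series_shift; first by rewrite mulr0 mul0r.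
  by rewrite -[X in _ --> X]mulr1; exact: cvg_series_scale h2.
split.
  apply: has_int_eq (has_intD i1 (has_intZ (- m) i0)) _ _ => [k|]; by ring.
apply: has_int_eq (has_intD i2 (has_intD (has_intZ (1 - m *+ 2) i1) (has_intZ (m ^+ 2) i0))) _ _.
  by case=> [|k]; rewrite /= -?natr1; ring.
by ring.
Qed.

Variables (P : Type) (A : set P) (density : P -> nat -> R) (theta : P -> 'rV[R]_1).
Variables (C : nat -> R) (psi mean var : 'rV[R]_1 -> R) (Theta : set 'rV[R]_1).
Local Notation F := (fun k : nat => const_mx k%:R : 'rV[R]_1).
Local Notation p := (exp_density C F psi).
Local Notation M := (stat_mfd mu A density theta).
Hypothesis densityE : forall a, A a -> density a =1 p (theta a).
Hypothesis thetaA : theta @` A = Theta.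
Hypotheses (oTheta : open Theta) (cTheta : convex_rV Theta).
Hypothesis dpsi : forall t a, Theta t -> is_derive t (delta_mx 0 a) psi (mean t).
Hypothesis dmean : forall t a, Theta t -> is_derive t (delta_mx 0 a) mean (var t).
Hypothesis E_mean : forall t, Theta t -> has_int mu (fun k => p t k * (k%:R - mean t)) 0.
Hypothesis E_var : forall t, Theta t ->
  has_int mu (fun k => p t k * ((k%:R - mean t) * (k%:R - mean t))) (var t).

Lemma counting_family : affine_chart (tt : chart M) Theta /\
  forall t, Theta t -> dmetric (tt : chart M) t = (var t)%:M.
Proof.
have cE t (a b : 'I_1) : ((var t)%:M : 'M[R]_1) a b = var t by rewrite !ord1 mxE eqxx.
have F0 : exists k, F k = 0 by exists 0%N; apply/rowP => i; rewrite !mxE.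
have F1 i : exists k, F k = 1 *: delta_mx 0 i.
  by exists 1%N; apply/rowP => j; rewrite !ord1 !mxE eqxx mulr1.
have dm t (a b : 'I_1) : Theta t ->
    is_derive t (delta_mx 0 a) (fun y => mean y) (((var t)%:M : 'M[R]_1) a b).
  by move=> Tt; rewrite cE; exact: dmean.
have Em t (a : 'I_1) : Theta t -> has_int mu (fun k => p t k * (F k 0 a - mean t)) 0.
  by move=> Tt; apply: has_int_eq (E_mean Tt) _ _ => // k; rewrite mxE.
have Ev t (a b : 'I_1) : Theta t ->
    has_int mu (fun k => p t k * ((F k 0 a - mean t) * (F k 0 b - mean t)))
      (((var t)%:M : 'M[R]_1) a b).
  by move=> Tt; apply: has_int_eq (E_var Tt) _ _ => // k; rewrite !mxE.
split.
  exact: (@affine_chart_family R _ nat mu 1 P A density theta C F psi Theta 1 densityE thetaA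
    oTheta cTheta (oner_neq0 R) F0 F1 (fun t _ => mean t) (fun t => (var t)%:M) dpsi dm Em).
by move=> t; exact: (@fisher_cov R _ nat mu 1 P A density theta C F psi Theta 1 densityE thetaA
  oTheta (oner_neq0 R) F0 F1 (fun t _ => mean t) (fun t => (var t)%:M) dpsi Ev).
Qed.

End CountableFamily.

Section Poisson.
Variable R : realType.

Lemma poisson_pmfE (l : R) k : 0 < l -> poisson_pmf l k = l ^+ k * k`!%:R^-1 * expR (- l).
Proof. by move=> l0; rewrite /poisson_pmf l0. Qed.

Lemma poisson_sum (l : R) : 0 < l -> series (poisson_pmf l) @ \oo --> (1 : R).
Proof.
move=> l0; have h : series (exp_coeff l) @ \oo --> expR l by exact: is_cvg_series_exp_coeff.
have := @cvg_series_scale R (expR (- l)) _ (poisson_pmf l) _ _ h.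
rewrite -expRD addNr expR0; apply => k.
by rewrite poisson_pmfE // /exp_coeff mulrC.
Qed.

Lemma poisson_shift (l : R) k : 0 < l -> k.+1%:R * poisson_pmf l k.+1 = l * poisson_pmf l k.
Proof.
move=> l0; rewrite !poisson_pmfE // factS natrM exprS.
have k0 : k.+1%:R != 0 :> R by rewrite pnatr_eq0.
have f0 : k`!%:R != 0 :> R by rewrite pnatr_eq0 -lt0n fact_gt0.
by move: (expR _) => e; field; rewrite f0 addrC natr1 k0.
Qed.

Lemma poisson_affine : affine_chart (tt : chart (poisson_mfd R)) setT /\
  forall t, dmetric (tt : chart (poisson_mfd R)) t = (expR (t 0 0))%:M.
Proof.
pose psi (t : 'rV[R]_1) := expR (t 0 0).
pose C (k : nat) : R := - ln k`!%:R.
pose F (k : nat) : 'rV[R]_1 := const_mx k%:R.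
have dE (l : R) : 0 < l -> poisson_pmf l =1 exp_density C F psi (const_mx (ln l)).
  move=> l0 k; rewrite poisson_pmfE // /exp_density /exp_exponent big_ord1 /psi !mxE lnK ?posrE //.
  have f0 : 0 < k`!%:R :> R by rewrite ltr0n fact_gt0.
  rewrite /C 2!expRD (expRN (ln _)) lnK ?posrE // [ln l * _]mulrC expRM_natl lnK ?posrE //.
  by rewrite [_^-1 * _]mulrC.
have tE (t : 'rV[R]_1) : t = const_mx (ln (expR (t 0 0))).
  by apply/rowP => i; rewrite ord1 mxE expRK.
have h (t : 'rV[R]_1) := moments (fun k => poisson_pmf_ge0 (expR (t 0 0)) k)
  (poisson_sum (expR_gt0 (t 0 0))) (poisson_sum (expR_gt0 (t 0 0)))
  (poisson_sum (expR_gt0 (t 0 0))) (fun k => poisson_shift k (expR_gt0 (t 0 0))) (w := expR (t 0 0) ^+ 2).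
have {}h t : has_int (counting_measure R nat) (fun k => exp_density C F psi t k * (k%:R - psi t)) 0 /\
    has_int (counting_measure R nat)
      (fun k => exp_density C F psi t k * ((k%:R - psi t) * (k%:R - psi t))) (psi t).
  have [k|h1 h2] := h t.
    rewrite mulrAC poisson_shift ?expR_gt0 // -mulrA [poisson_pmf _ _ * _]mulrC.
    by rewrite poisson_shift ?expR_gt0 // mulrA -expr2.
  split; [apply: has_int_eq h1 _ _ => // k|apply: has_int_eq h2 _ _ => [k|]];
    rewrite ?dE ?expR_gt0 -?tE //.
  by rewrite addrAC subrr add0r.
have [] := @counting_family R R [set l : R | 0 < l] (fun l k => poisson_pmf l k)
  (fun l => const_mx (ln l)) C psi psi psi setT dE.
- apply/seteqP; split=> // t _; exists (expR (t 0 0)); [exact: expR_gt0|by rewrite -tE].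
- exact: openT.
- by [].
- move=> t a _; have := is_derive_exp_coord t a 0.
  by rewrite ord1 eqxx mulr1.
- move=> t a _; have := is_derive_exp_coord t a 0.
  by rewrite ord1 eqxx mulr1.
- by move=> t _; case: (h t).
- by move=> t _; case: (h t).
by move=> h1 h2; split=> // t; exact: h2.
Qed.

End Poisson.

Section NegativeBinomial.
Variable R : realType.

Definition nb_pmf (s : nat) (q : R) k : R := 'C(k + s, s)%:R * (1 - q) ^+ k * q ^+ s.+1.

Lemma nb_pmf_ge0 s q k : 0 < q < 1 -> 0 <= nb_pmf s q k.
Proof.
by move=> /andP[q0 q1]; rewrite !mulr_ge0 // exprn_ge0 // ?subr_ge0 ltW.
Qed.

(** The factor k turns the weights of index s into those of index s + 1, which are
    again a probability distribution. *)
Lemma nb_shift s q k : 0 < q -> k.+1%:R * nb_pmf s q k.+1 = s.+1%:R * ((1 - q) / q) * nb_pmf s.+1 q k.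
Proof.
move=> q0; have q00 : q != 0 by rewrite gt_eqF.
have : (k.+1 * 'C(k.+1 + s, s) = s.+1 * 'C(k + s.+1, s.+1))%N.
  rewrite -[in LHS]bin_sub ?leq_addl // addnK -[in RHS]bin_sub ?leq_addl // addnK.
  by rewrite addSnnS mul_bin_left addKn.
move=> /(congr1 (fun m => m%:R : R)); rewrite !natrM => e.
rewrite /nb_pmf (mulrA k.+1%:R) (mulrA k.+1%:R) e [_ ^+ k.+1]exprS [q ^+ s.+2]exprS.
by move: ((1 - q) ^+ k) (q ^+ s.+1) => x y; field.
Qed.

(** Pascal's rule turns the partial sums S of the weights of index s.+1 into
    S n.+1 = (1 - q) * S n + q * (partial sum of index s), whose limit gives the
    induction on s. *)
Lemma nb_sum s q : 0 < q < 1 -> series (nb_pmf s q) @ \oo --> (1 : R).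
Proof.
move=> q01; have /andP[q0 q1] := q01; have q00 : q != 0 by rewrite gt_eqF.
elim: s => [|s IH].
  have x1 : `|1 - q| < 1 by rewrite ger0_norm ?subr_ge0 ?ltW // ltrBlDr ltrDl.
  have := cvg_geometric_series (a := q) x1; rewrite subKr divff //.
  rewrite (_ : series (geometric _ _) = series (nb_pmf 0 q)) // funeqE => n.
  by apply: eq_bigr => k _; rewrite /nb_pmf /geometric /= bin0 mul1r mulrC.
pose S := series (nb_pmf s.+1 q).
have rec n : S n.+1 = (1 - q) * S n + q * series (nb_pmf s q) n.+1.
  rewrite /S /series /= big_nat_recl // [in RHS]big_nat_recl // mulrDr addrCA; congr (_ + _).
    by rewrite /nb_pmf !binn /= !mul1r exprS.
  rewrite !mulr_sumr -big_split /=; apply: eq_bigr => k _.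
  rewrite /nb_pmf addnS binS natrD addSnnS !exprS; by ring.
have S_nd : nondecreasing_seq S.
  by apply: nondecreasing_series => k _ _; exact: nb_pmf_ge0.
have s_nd : nondecreasing_seq (series (nb_pmf s q)).
  by apply: nondecreasing_series => k _ _; exact: nb_pmf_ge0.
have s_le n : series (nb_pmf s q) n <= 1.
  by rewrite -(cvg_lim _ IH) //; apply: nondecreasing_cvgn_le => //; apply/cvg_ex; exists 1.
have S_le n : S n <= 1.
  elim: n => [|n Sn]; first by rewrite /S /series /= big_geq.
  rewrite rec -[leRHS](subrK q) lerD //.
    by rewrite ler_piMr // subr_ge0 ltW.
  by rewrite ler_piMr // ltW.
have cS : cvgn S by apply: nondecreasing_is_cvgn => //; exists 1 => _ [n _ <-].
have e : limn S = (1 - q) * limn S + q * 1.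
  apply: cvg_lim => //; rewrite -(cvg_shiftS S).
  rewrite (_ : (fun n => _) = fun n => (1 - q) * S n + q * series (nb_pmf s q) n.+1); last first.
    by rewrite funeqE => n; exact: rec.
  apply: cvgD; first exact: cvgMr.
  by apply: cvgMr; rewrite (cvg_shiftS (series (nb_pmf s q))).
have <- // : limn S = 1.
apply: (mulfI q00); rewrite -[RHS](addrK ((1 - q) * limn S)) [X in _ = X - _]addrC -e.
by ring.
Qed.

Lemma negative_binomial_affine s :
  affine_chart (tt : chart (negative_binomial_mfd R s.+1)) [set t : 'rV[R]_1 | expR (t 0 0) < 1] /\
  forall t : 'rV[R]_1, expR (t 0 0) < 1 -> dmetric (tt : chart (negative_binomial_mfd R s.+1)) t =
    (s.+1%:R * expR (t 0 0) / (1 - expR (t 0 0)) ^+ 2)%:M.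
Proof.
pose r : R := s.+1%:R.
pose Theta := [set t : 'rV[R]_1 | expR (t 0 0) < 1].
pose qt (t : 'rV[R]_1) := 1 - expR (t 0 0).
pose psi (t : 'rV[R]_1) := - r * ln (qt t).
pose mean (t : 'rV[R]_1) := r * ((qt t)^-1 - 1).
pose var (t : 'rV[R]_1) := r * expR (t 0 0) / (qt t) ^+ 2.
pose C (k : nat) : R := ln 'C(k + s, s)%:R.
pose F (k : nat) : 'rV[R]_1 := const_mx k%:R.
pose A := [set q : R | 0 < q < 1].
have q0 t : Theta t -> 0 < qt t by rewrite subr_gt0.
have q00 t : Theta t -> qt t != 0 by move=> /q0; rewrite lt0r => /andP[].
have Aq t : Theta t -> A (qt t) by move=> Tt; rewrite /A /= q0 //= gtrBl expR_gt0.
have tq (t : 'rV[R]_1) : const_mx (ln (1 - qt t)) = t.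
  by apply/rowP => i; rewrite ord1 mxE subKr expRK.
have dE (q : R) : A q ->
    (fun k => 'C(k + s.+1 - 1, s.+1 - 1)%:R * (1 - q) ^+ k * q ^+ s.+1) =1
    exp_density C F psi (const_mx (ln (1 - q))).
  move=> /andP[q_0 q_1] k; have x0 : 0 < 1 - q by rewrite subr_gt0.
  rewrite addnS !subn1 /= /exp_density /exp_exponent big_ord1 /psi /qt !mxE lnK ?posrE //.
  rewrite subKr mulNr opprK 2!expRD /C lnK ?posrE ?ltr0n ?bin_gt0 ?leq_addl //.
  by rewrite [ln (1 - q) * _]mulrC !expRM_natl !lnK ?posrE.
have pE t k : Theta t -> exp_density C F psi t k = nb_pmf s (qt t) k.
  by move=> Tt; have := dE _ (Aq t Tt) k; rewrite /= tq addnS !subn1 => <-.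
have dq t (a : 'I_1) : is_derive t (delta_mx 0 a) qt (- expR (t 0 0)).
  have := is_deriveB (is_derive_cst (1 : R) t (delta_mx 0 a)) (is_derive_exp_coord t a 0).
  by rewrite ord1 eqxx mulr1 sub0r.
have h t : Theta t ->
    has_int (counting_measure R nat) (fun k => exp_density C F psi t k * (k%:R - mean t)) 0 /\
    has_int (counting_measure R nat)
      (fun k => exp_density C F psi t k * ((k%:R - mean t) * (k%:R - mean t))) (var t).
  move=> Tt; have qA := Aq t Tt; pose x := (1 - qt t) / qt t.
  have em : mean t = r * x by rewrite /mean /x mulrBl mul1r divff ?q00.
  have [k|k|h1 h2] := moments (m := r * x) (w := r * x * (s.+2%:R * x))
    (fun k => nb_pmf_ge0 s k qA) (nb_sum s qA) (nb_sum s.+1 qA) (nb_sum s.+2 qA).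
  - by rewrite nb_shift ?q0.
  - have e1 := nb_shift s k.+1 (q0 t Tt); have e2 := nb_shift s.+1 k (q0 t Tt).
    move: e1 e2; rewrite -/r -/x; move: (nb_pmf _ _ _) (nb_pmf _ _ _) (nb_pmf _ _ _) => n0 n1 n2 e1 e2.
    by rewrite [LHS]mulrAC e1 -[LHS]mulrA (mulrC n1) e2 [LHS]mulrA.
  split; [apply: has_int_eq h1 _ _ => // k|apply: has_int_eq h2 _ _ => [k|]];
    rewrite ?pE // ?em //.
  rewrite /var /x -[expR _](subKr 1) -/(qt t) -natr1 -/r; have := q00 t Tt.
  by move: (qt t) => q qn0; field.
have [] := @counting_family R R A _ (fun q => const_mx (ln (1 - q))) C psi mean var Theta dE.
- apply/seteqP; split=> [_ [q /andP[q_0 q_1] <-]|t Tt].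
    by rewrite /Theta /= mxE lnK ?posrE ?subr_gt0 // gtrBl.
  by exists (qt t); [exact: Aq|exact: tq].
- apply: open_smooth_lt; apply: smooth_on_expR; [exact: openT|exact: smooth_on_coord].
- move=> x y t; rewrite /Theta /= !expR_lt1 => x0 y0 /andP[t0 t1]; rewrite !mxE.
  rewrite -subr_gt0 (_ : 0 - _ = (1 - t) * (- x 0 0) + t * (- y 0 0)); last by ring.
  have [->|tn0] := eqVneq t 0; first by rewrite subr0 mul1r mul0r addr0 oppr_gt0.
  by rewrite ltr_wpDl // ?mulr_gt0 ?mulr_ge0 ?subr_ge0 ?oppr_ge0 ?oppr_gt0 // ?ltW // lt0r tn0.
- move=> t a Tt; have := is_derive_comp1 (dq t a) (is_derive1_ln (q0 t Tt)).
  move=> /(is_deriveZ (- r)); congr is_derive; rewrite /GRing.scale /= /mean.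
  rewrite -[expR _](subKr 1) -/(qt t); have := q00 t Tt.
  by move: (qt t) => q qn0; field.
- move=> t a Tt; have hV : is_derive t (delta_mx 0 a) (fun y => (qt y)^-1)
      (- (qt t) ^- 2 * - expR (t 0 0)).
    have [d1 d2] := dq t a; split; first by apply: derivableV => //; exact: q00.
    by rewrite (@deriveV _ _ qt) ?q00 // d2.
  have := is_deriveZ r (is_deriveB hV (is_derive_cst (1 : R) t (delta_mx 0 a))).
  congr is_derive; rewrite /GRing.scale /= /var subr0 mulrNN mulrA.
  exact: mulrAC.
- by move=> t Tt; case: (h t Tt).
- by move=> t Tt; case: (h t Tt).
by move=> h1 h2; split.
Qed.

End NegativeBinomial.

(** * The five torifications *)

Section Torifications.
Variable R : realType.
Local Notation C := (R[i]).

(** The constant 2 in the radius matches the Fisher metric exp(t) dt^2, with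
    t = 2 log (|z| / 2), to the flat metric. *)
Lemma poisson_torification : torification (@plane_action R) (@poisson_mfd R).
Proof.
have [aM metM] := poisson_affine R.
have e4 : (2 : R) ^+ 2 = 4 by rewrite expr2 -natrM.
apply: (@rotation_torification R (complex_plane R) tt id id 0 1 (lexx 0) ltr01 _ _ _ _ _ _ _ _
  (@plane_action R) _ (poisson_mfd R) tt 2 (ltr0n R 2)) => //.
- by case.
- by move=> z; rewrite mul0r ltr01.
- by move=> z; rewrite /realify !map_const_mx.
- by move=> x /=; rewrite mul0r subr0 expr1n divr1.
- rewrite (_ : [set x : 'rV[R]_1 | 0 * (2 ^+ 2 * expR (x 0 0)) < 1] = setT) //.
  by apply/seteqP; split=> // x _; rewrite /= mul0r ltr01.
- by exists 0; rewrite /= mul0r ltr01.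
- move=> x _; rewrite metM mul0r subr0 expr1n mulr1 mul1r e4 mulrC mulKf // pnatr_eq0.
Qed.

Lemma unit_diskE (z : C) : unit_disk z <-> nrm2 z < 1.
Proof.
rewrite /unit_disk /= normc_def -(rmorph1 (real_complex R)) ltcR -[X in _ < X]sqrtr1.
by rewrite ltr_sqrt // ltr01.
Qed.

Lemma negative_binomial_torification r : (0 < r)%N ->
  torification (@disk_action R (- (1 / r%:R))) (@negative_binomial_mfd R r).
Proof.
case: r => // s _; have [aM metM] := negative_binomial_affine R s.
pose N := disk (- (1 / s.+1%:R) : R); pose r : R := s.+1%:R.
have r0 : 0 < r by rewrite ltr0n.
have disk0 : @unit_disk R 0 by apply/unit_diskE; rewrite /nrm2 /= expr0n addr0 ltr01.
pose czi (z : C) : N := match pselect (unit_disk z) with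
  left zD => exist _ z zD | right _ => exist _ 0 disk0 end.
have ThetaE : [set x : 'rV[R]_1 | 1 * (1 ^+ 2 * expR (x 0 0)) < 1] =
    [set x : 'rV[R]_1 | expR (x 0 0) < 1].
  by apply/seteqP; split=> x; rewrite /= expr1n !mul1r.
apply: (@rotation_torification R N tt (fun p => sval p) czi 1 (4 * r) ler01 _ _ _ _ _ _ _ _ _
  (@disk_action R (- (1 / s.+1%:R))) _ (negative_binomial_mfd R s.+1) tt 1 ltr01) => //.
- by rewrite mulr_gt0 // ltr0n.
- by case.
- by case=> z zD [w wD] /= zw; exact: eq_exist.
- by move=> p; rewrite mul1r; exact/unit_diskE/(svalP p).
- move=> z; rewrite mul1r => /unit_diskE zD; rewrite /czi.
  by case: pselect.
- by move=> p; rewrite /realify !map_const_mx.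
- by move=> x /=; rewrite mul1r mul1r invrN invrK mulrN opprK.
- by rewrite ThetaE.
- exists (const_mx (-1)); rewrite ThetaE /= mxE expR_lt1.
  by rewrite oppr_lt0 ltr01.
- move=> x; rewrite ThetaE => Tx; rewrite (metM x Tx); congr (_%:M).
  rewrite expr1n !mul1r -/r; have : 1 - expR (x 0 0) != 0 by rewrite subr_eq0 gt_eqF.
  by move: (expR _) => e e0; field.
Qed.

Lemma projective_family n N (M : dmfd R n) (i0 : chart M) : (0 < n)%N -> (0 < N)%N ->
  affine_chart i0 setT /\ (forall t, dmetric i0 t = N%:R *: softmax_cov t) ->
  torification (@projective_action R n (1 / N%:R)) M.
Proof.
move=> n0 N0 [aM metM].
apply: (projective_torification _ n0 aM) => [|x]; first by rewrite div1r invr_gt0 ltr0n.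
by rewrite div1r invrK.
Qed.

End Torifications.

Theorem proposition8p11 (R : realType) (n m r : nat)
    (hn : (1 <= n)%N) (hm : (1 <= m)%N) (hr : (1 <= r)%N) :
  [/\ torification (@plane_action R) (@poisson_mfd R),
      torification (@projective_action R n 1) (@categorical_mfd R n),
      torification (@projective_action R 1 (1 / n%:R)) (@binomial_mfd R n),
      torification (@projective_action R m (1 / n%:R)) (@multinomial_mfd R m n)
    & torification (@disk_action R (- (1 / r%:R))) (@negative_binomial_mfd R r)].
Proof.
split.
- exact: poisson_torification.
- by have := projective_family hn (ltnSn 0) (categorical_affine R n); rewrite divr1.
- exact: projective_family (binomial_affine R hn).
- exact: projective_family (multinomial_affine R m hn).
- exact: negative_binomial_torification.
Qed.
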